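(* Consider the fixed-design linear model, estimators, future observation, hybrid bootstrap and assumptions described in the context, and suppose Assumptions 1–6, 8 and 9 hold (with the matrix $M$ in these assumptions taken to be $X_f$). Then $$\sup_{x\ge0}\Big|\mathrm{Prob}^*\Big(\max_{i=1,\dots,p_1}|y^*_{f,i}-\widehat y^*_{f,i}|\le x\Big)-\mathrm{Prob}^*\Big(\max_{i=1,\dots,p_1}|y_{f,i}-\widehat y_{f,i}|\le x\Big)\Big|=o_p(1),$$ and for every fixed $0<\alpha<1$, $$\mathrm{Prob}^*\Big(\max_{i=1,\dots,p_1}|y_{f,i}-\widehat y_{f,i}|\le c^*_{1-\alpha}\Big)\to_p1-\alpha\quad(n\to\infty),$$ where $c^*_{1-\alpha}=\inf\{x\in\mathbb R:\mathrm{Prob}^*(\max_i|y^*_{f,i}-\widehat y^*_{f,i}|\le x)\ge1-\alpha\}$.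
   Context: Model: $y=X\beta+\epsilon$, $y\in\mathbb R^n$, deterministic $n\times p$ design $X=(x_{ij})$ of rank $r$, unknown $\beta\in\mathbb R^p$, errors $\epsilon=(\epsilon_1,\dots,\epsilon_n)^T$. All quantities may depend on $n$; asymptotics are as $n\to\infty$. $X_f=(x_{f,ij})$ is a known deterministic $p_1\times p$ matrix; in the definitions and assumptions below $m_{ij}=x_{f,ij}$. The future observation is $y_f=X_f\beta+\epsilon_f$, where $\epsilon_f=(\epsilon_{f,1},\dots,\epsilon_{f,p_1})^T$ has i.i.d. entries with the same distribution as $\epsilon_1$, independent of $\epsilon$. Thin SVD $X=P\Lambda Q^T$: $P$ $n\times r$, $Q=(q_{jk})$ $p\times r$, $P^TP=Q^TQ=I_r$, $\Lambda=\mathrm{diag}(\lambda_1\ge\dots\ge\lambda_r>0)$. $Q_\perp$ is $p\times(p-r)$ with $Q_\perp^TQ_\perp=I_{p-r}$, $Q^TQ_\perp=0$, $QQ^T+Q_\perp Q_\perp^T=I_p$. $\theta=QQ^T\beta$, $\theta_\perp=Q_\perp Q_\perp^T\beta$ ($=0$ if $r=p$). With ridge parameter $\rho_n>0$ and threshold $b_n>0$: $\mathcal N_{b_n}=\{i:|\theta_i|>b_n\}$, $c_{ik}=\sum_{j\in\mathcal N_{b_n}}m_{ij}q_{jk}$, $\mathcal M=\{i:\sum_kc_{ik}^2>0\}$. Estimators: $\widetilde\theta^\star=(X^TX+\rho_nI_p)^{-1}X^Ty$, $\widetilde\theta=\widetilde\theta^\star+\rho_nQ(\Lambda^2+\rho_nI_r)^{-1}Q^T\widetilde\theta^\star$,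 $\widehat{\mathcal N}_{b_n}=\{i:|\widetilde\theta_i|>b_n\}$, $\widehat\theta_i=\widetilde\theta_i\mathbf 1_{i\in\widehat{\mathcal N}_{b_n}}$, $\widehat\sigma^2=\frac1n\sum_i(y_i-\sum_jx_{ij}\widehat\theta_j)^2$, $\widehat y_f=(\widehat y_{f,1},\dots,\widehat y_{f,p_1})^T=X_f\widehat\theta$. Residuals $\widehat\epsilon'=y-X\widehat\theta$, centered residuals $\widehat\epsilon_i=\widehat\epsilon'_i-\frac1n\sum_j\widehat\epsilon'_j$, and $\widehat F(x)=\frac1n\sum_i\mathbf 1_{\widehat\epsilon_i\le x}$. Hybrid bootstrap: conditionally on $y$, let $\epsilon^*_1,\dots,\epsilon^*_n$ be i.i.d. $N(0,\widehat\sigma^2)$ and, independently, $\epsilon^*_{f,1},\dots,\epsilon^*_{f,p_1}$ i.i.d. with distribution function $\widehat F$; $y^*=X\widehat\theta+\epsilon^*$; $\widehat\theta_\perp=Q_\perp Q_\perp^T\widehat\theta$ ($=0$ if $r=p$); $\widetilde\theta^{\star*}=(X^TX+\rho_nI_p)^{-1}X^Ty^*$; $\widetilde\theta^*=\widetilde\theta^{\star*}+\rho_nQ(\Lambda^2+\rho_nI_r)^{-1}Q^T\widetilde\theta^{\star*}+\widehat\theta_\perp$; $\widehat{\mathcal N}^*_{b_n}=\{i:|\widetilde\theta^*_i|>b_n\}$; $\widehat\theta^*_i=\widetilde\theta^*_i\mathbf 1_{i\in\widehat{\mathcal N}^*_{b_n}}$; $y^*_f=X_f\widehat\theta+\epsilon^*_f$;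 $\widehat y^*_f=X_f\widehat\theta^*$. $\mathrm{Prob}^*$ denotes probability conditional on $y$ (so in $\mathrm{Prob}^*(\max_i|y_{f,i}-\widehat y_{f,i}|\le x)$ only $\epsilon_f$ is random). Assumption 1: $X$ deterministic; constants $c_\lambda,C_\lambda>0$, $0<\eta\le1/2$ with $C_\lambda n^{1/2}\ge\lambda_1\ge\dots\ge\lambda_r\ge c_\lambda n^{\eta}$; $\|\theta\|_2=O(n^{\alpha_\theta})$, $0<\alpha_\theta<3\eta$. Assumption 2: $\rho_n=O(n^{2\eta-\delta})$ with $\frac{\eta+\alpha_\theta}{2}<\delta<2\eta$. Assumption 3: $\epsilon_i$ i.i.d., mean $0$, $\mathbf E|\epsilon_1|^m<\infty$ for some $m>4$. Assumption 4: $p=O(n^{\alpha_p})$, $\alpha_p\in[0,m\eta)$; $b_n=C_bn^{-\nu_b}$, $C_b,\nu_b>0$, $\nu_b+\alpha_p/m-\eta<0$; a constant $0<c_b<1$ with $\max_{i\notin\mathcal N_{b_n}}|\theta_i|\le c_bb_n$, $\min_{i\in\mathcal N_{b_n}}|\theta_i|\ge b_n/c_b$. Assumption 5: $\mathcal M\ne\emptyset$, $|\mathcal M|=O(n^{\alpha_{\mathcal M}})$, $\alpha_{\mathcal M}<m\eta$; constants $0<c_{\mathcal M}<\sum_kc_{ik}^2\le C_{\mathcal M}$ for $i\in\mathcal M$; $\max_{i\le p_1}|\sum_{j\notin\mathcal N_{b_n}}m_{ij}\theta_j|=o(1/\sqrt{n\log n})$, $\max_{i\le p_1}|\sum_jm_{ij}\theta_{\perp,j}|=o(1/\sqrt{n\log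 n})$. Assumption 6: a constant $0<\alpha_\sigma\le\eta$ with $n^{-\nu_b}\sum_{j\notin\mathcal N_{b_n}}|\theta_j|=O(n^{-\alpha_\sigma})$, $\sqrt{|\mathcal N_{b_n}|}/n^\eta=O(n^{-\alpha_\sigma})$. Assumption 8: $F(x)=\mathrm{Prob}(\epsilon_1\le x)$ is continuous. Assumption 9: $p_1=O(1)$. *)

(* Defs.v *)
From HB Require Import structures.
From mathcomp Require Import all_boot all_order all_algebra.
From mathcomp Require Import all_classical all_reals all_analysis.
Set Implicit Arguments.
Unset Strict Implicit.
Unset Printing Implicit Defensive.
Import Order.TTheory GRing.Theory Num.Theory.
Import numFieldNormedType.Exports.
Local Open Scope classical_set_scope.
Local Open Scope ring_scope.

Definition bigO_seq {R : realType} (u v : nat -> R) : Prop :=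
  exists C : R, exists N : nat, forall n, (N <= n)%N -> `|u n| <= C * `|v n|.
Definition littleo_seq {R : realType} (u v : nat -> R) : Prop :=
  forall e : R, 0 < e -> exists N : nat, forall n, (N <= n)%N -> `|u n| <= e * `|v n|.

Definition npow {R : realType} (n : nat) (a : R) : R := n%:R `^ a.

Definition mutually_independent d (I : eqType) (T : measurableType d) (R : realType)
  (P : probability T R) (X : I -> T -> R) : Prop :=
  forall (S : seq I) (B : I -> set R), uniq S -> (forall i, measurable (B i)) ->
    fine (P (\bigcap_(i in [set i | i \in S]) (X i @^-1` B i))) =
    \prod_(i <- S) fine (P (X i @^-1` B i)).

Definition colmaxabs {R : realType} {k : nat} (v : 'cV[R]_k) : R :=
  \big[Num.max/0]_(i < k) `|v i 0|.

Definition norm2 {R : realType} {k : nat} (v : 'cV[R]_k) : R :=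
  Num.sqrt (\sum_(i < k) v i 0 ^+ 2).

Definition ridge_star {R : realType} {n p : nat} (X : 'M[R]_(n, p)) (rho : R)
  (y : 'cV[R]_n) : 'cV[R]_p :=
  invmx (X^T *m X + rho%:M) *m X^T *m y.

Definition ridge_debiased {R : realType} {n p r : nat} (X : 'M[R]_(n, p))
  (Q : 'M[R]_(p, r)) (lam : 'rV[R]_r) (rho : R) (y : 'cV[R]_n) : 'cV[R]_p :=
  let ts := ridge_star X rho y in
  ts + rho *: (Q *m invmx (diag_mx lam *m diag_mx lam + rho%:M) *m Q^T *m ts).

Definition hard_threshold {R : realType} {p : nat} (b : R) (t : 'cV[R]_p) : 'cV[R]_p :=
  \col_i (if b < `|t i 0| then t i 0 else 0).

Definition theta_hat {R : realType} {n p r : nat} (X : 'M[R]_(n, p))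
  (Q : 'M[R]_(p, r)) (lam : 'rV[R]_r) (rho b : R) (y : 'cV[R]_n) : 'cV[R]_p :=
  hard_threshold b (ridge_debiased X Q lam rho y).

Definition sigma_hat2 {R : realType} {n p : nat} (X : 'M[R]_(n, p))
  (th : 'cV[R]_p) (y : 'cV[R]_n) : R :=
  n%:R^-1 * \sum_(i < n) (y i 0 - (X *m th) i 0) ^+ 2.

Definition centered_resid {R : realType} {n p : nat} (X : 'M[R]_(n, p))
  (th : 'cV[R]_p) (y : 'cV[R]_n) : 'cV[R]_n :=
  let e' := y - X *m th in
  \col_i (e' i 0 - n%:R^-1 * \sum_(j < n) e' j 0).

Definition Fhat {R : realType} {n : nat} (e : 'cV[R]_n) (x : R) : R :=
  n%:R^-1 * \sum_(i < n) ((e i 0 <= x)%R)%:R.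

Definition Fhat_quantile {R : realType} {n : nat} (e : 'cV[R]_n) (v : R) : R :=
  inf [set x : R | v <= Fhat e x].

(** * Bootstrap prediction error  y^*_f - hat y^*_f
    given the data y, a vector z of i.i.d. N(0,1) variables (so that
    eps^* = hat sigma z is i.i.d. N(0, hat sigma^2)) and a vector v of i.i.d.
    Uniform(0,1) variables (so that eps^*_f = Fhat^{-1}(v) is i.i.d. with
    distribution function Fhat). *)
Definition boot_pred_err {R : realType} {n p p1 r : nat} (X : 'M[R]_(n, p))
  (Xf : 'M[R]_(p1, p)) (Q : 'M[R]_(p, r)) (lam : 'rV[R]_r)
  (Qperp : 'M[R]_(p, p - r)) (rho b : R) (y : 'cV[R]_n)
  (z : 'cV[R]_n) (v : 'cV[R]_p1) : 'cV[R]_p1 :=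
  let th := theta_hat X Q lam rho b y in
  let ystar := X *m th + Num.sqrt (sigma_hat2 X th y) *: z in
  let th_perp := Qperp *m Qperp^T *m th in
  let tstar := ridge_debiased X Q lam rho ystar + th_perp in
  let thstar := hard_threshold b tstar in
  let efstar := \col_i Fhat_quantile (centered_resid X th y) (v i 0) in
  (Xf *m th + efstar) - Xf *m thstar.

Definition pred_err {R : realType} {n p p1 r : nat} (X : 'M[R]_(n, p))
  (Xf : 'M[R]_(p1, p)) (Q : 'M[R]_(p, r)) (lam : 'rV[R]_r) (rho b : R)
  (beta : 'cV[R]_p) (y : 'cV[R]_n) (ef : 'cV[R]_p1) : 'cV[R]_p1 :=
  (Xf *m beta + ef) - Xf *m theta_hat X Q lam rho b y.

Definition theta_of {R : realType} {p r : nat} (Q : 'M[R]_(p, r)) (beta : 'cV[R]_p) :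
  'cV[R]_p := Q *m Q^T *m beta.

Definition theta_perp_of {R : realType} {p r : nat} (Qperp : 'M[R]_(p, p - r))
  (beta : 'cV[R]_p) : 'cV[R]_p := Qperp *m Qperp^T *m beta.

Definition activeN {R : realType} {p : nat} (b : R) (th : 'cV[R]_p) : {set 'I_p} :=
  [set j | b < `|th j 0|].

Definition cmat {R : realType} {p p1 r : nat} (M : 'M[R]_(p1, p)) (Q : 'M[R]_(p, r))
  (N : {set 'I_p}) : 'M[R]_(p1, r) :=
  \matrix_(i, k) \sum_(j in N) M i j * Q j k.

Definition setM {R : realType} {p1 r : nat} (c : 'M[R]_(p1, r)) : {set 'I_p1} :=
  [set i | 0 < \sum_(k < r) c i k ^+ 2].

(* Main.v *)
Require Import Defs.
From HB Require Import structures.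
From mathcomp Require Import all_boot all_order all_algebra.
From mathcomp Require Import all_classical all_reals all_analysis.
From mathcomp Require Import ring lra.
Import Order.TTheory GRing.Theory Num.Theory.
Import numFieldNormedType.Exports measurable_realfun.
Local Open Scope classical_set_scope.
Local Open Scope ring_scope.

(** Writing the debiased ridge estimator in the SVD basis gives
    tilde theta = theta + Q w, where w is a linear form of the errors with
    coefficients of size O(1 / lambda_r) minus a bias of size
    (rho / lambda_r^2)^2 |theta|.  A Marcinkiewicz-Zygmund bound on the m-th
    moment of the linear forms and a union bound show that with probability
    tending to one thresholding selects exactly N_b, the prediction
    X_f hat theta is within o(1) of X_f beta, and X hat theta is within o(1)
    of X beta in empirical mean square.  The residuals are then close to the
    errors, so hat F is uniformly close to F by Glivenko-Cantelli and the
    continuity of F.  The same analysis applies to the bootstrap sample, whose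
    regression error is Gaussian with bounded variance.  Both conditional laws
    are therefore uniformly close to the law of the maximum of p_1 independent
    copies of |epsilon|, namely G(x) = max(0, F x - F (- x))^p_1, which is
    uniformly continuous; this also controls the level at the bootstrap
    quantile. *)

(** * Powers and polynomial rates *)

(** The linear forms in the prediction error have coefficient norm O(n^-eta), so estimation is
    negligible next to a single future error, and a crude moment bound of order [m] suffices. That
    bound is proved for a real exponent, by adding one independent summand at a time, so that it
    covers the Gaussian bootstrap errors too. The main obstacle is that selection has to succeed
    twice at the same threshold. The gap between [c_b * b] and [b / c_b] leaves room [2 k b] inside
    the active set, with [k = (1 - c_b) / 2]: the estimator uses at most [k b] of it, its bootstrap
    copy the rest. The bootstrap law of a future error has atoms, so every comparison moves the
    argument by a fixed [t] and pays with the uniform modulus of [F]. Prob^* lives on the second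
    space, where the sample is a fixed vector. This splits the proof into a statement about one good
    sample and an estimate of the probability that the sample is good. Probabilities on the first
    space then involve a supremum over x and a random quantile, whose measurability is proved
    separately. *)

Lemma expR_taylor2 (R : realType) (u : R) :
  expR u <= 1 + u + u ^+ 2 * expR `|u|.
Proof.
(* [1 - v <= expR (- v)] multiplied by [expR v]. For [u < 0] the bound [1 + u <= expR u] is then
   inserted into [u * expR u]. *)
have step (v : R) : expR v - 1 <= v * expR v.
  have := expR_ge1Dx (- v); rewrite expRN => h.
  have e0 := expR_gt0 v.
  have : (1 - v) * expR v <= 1 by rewrite -ler_pdivlMr// div1r.
  lra.
have [u0|u0] := leP 0 u.
  have h := step u.
  have e1 : 1 <= expR u by rewrite -expR0 ler_expR.
  rewrite ger0_norm//.
  have : u * (expR u - 1) <= u * (u * expR u) by rewrite ler_wpM2l.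
  nra.
have e1 : 1 <= expR `|u| by rewrite -expR0 ler_expR.
have h1 := expR_ge1Dx u.
have h := step u.
nra.
Qed.

(** Split at [x = 1]. It lets a bound on the [q]-th moment control every lower moment. *)
Lemma powR_le1D (R : realType) (x s q : R) : 0 <= x -> 0 <= s -> s <= q ->
  x `^ s <= 1 + x `^ q.
Proof.
move=> x0 s0 sq; have [x1|x1] := leP x 1.
  have [->|sn0] := eqVneq s 0; first by rewrite powRr0 lerDl powR_ge0.
  have : x `^ s <= 1 `^ s by rewrite ge0_ler_powR// nnegrE.
  by rewrite powR1 => /le_trans; apply; rewrite lerDl powR_ge0.
by rewrite (le_trans (ler_powR _ sq)) ?ltW// ltrDr.
Qed.

(** Exponentiate [ln (x / q) < x / q]; the Gaussian moments are read off from it. *)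
Lemma powR_le_expR (R : realType) (x q : R) : 0 <= x -> 0 < q ->
  x `^ q <= q `^ q * expR x.
Proof.
move=> x0 q0; have [->|xn0] := eqVneq x 0.
  by rewrite powR0 ?gt_eqF// mulr_ge0// ?powR_ge0// expR_ge0.
have xp : 0 < x by rewrite lt_neqAle eq_sym xn0.
have u0 : 0 < x / q by rewrite divr_gt0.
have xE : x = q * (x / q) by rewrite mulrC divfK// gt_eqF.
rewrite {1}xE (powRM _ (ltW q0) (ltW u0)) ler_pM2l ?powR_gt0//.
rewrite /powR gt_eqF// ler_expR [leRHS]xE ler_pM2l//.
by rewrite ltW// ln_sublinear.
Qed.

(** Near 0 the power is at most [expR (q * t)], whose expansion gives [q ^+ 2 * expR q]. For |t| >
    1/2 one has |1 + t| <= 3 |t|, which gives the q-th power of 3. *)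
Lemma powR_taylor2_1D (R : realType) (q t : R) : 2 <= q ->
  `|1 + t| `^ q <= 1 + q * t + (3 `^ q + q ^+ 2 * expR q) * (t ^+ 2 + `|t| `^ q).
Proof.
move=> q2.
have q0 : 0 < q by lra.
have Cq : 0 < q ^+ 2 * expR q by rewrite mulr_gt0 ?expR_gt0// exprn_gt0.
have C3 : 0 < 3 `^ q :> R by rewrite powR_gt0.
have tq : 0 <= `|t| `^ q by rewrite powR_ge0.
have t2 : 0 <= t ^+ 2 by rewrite sqr_ge0.
have [th|th] := leP `|t| (1/2).
  have : `|1 + t| `^ q <= expR (q * t).
    move: th; rewrite ler_norml => /andP[th1 th2].
    have p1 : 0 < 1 + t by lra.
    rewrite gtr0_norm// /powR gt_eqF// ler_expR ler_pM2l// le_ln1Dx//; lra.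
  move/le_trans; apply; apply: (le_trans (expR_taylor2 _ _)).
  rewrite lerD2l exprMn mulrAC.
  have : expR `|q * t| <= expR q.
    by rewrite ler_expR normrM gtr0_norm// ler_piMr ?ltW//; lra.
  move=> /(ler_wpM2l (sqr_ge0 q)) /(ler_wpM2r t2) h.
  apply: (le_trans h); nra.
have : `|1 + t| `^ q <= (3 * `|t|) `^ q.
  rewrite ge0_ler_powR ?nnegrE ?mulr_ge0 ?(ltW q0)//.
  apply: (le_trans (ler_normD _ _)); rewrite normr1; lra.
rewrite powRM// => /le_trans; apply.
have e1 : 1 <= expR q by rewrite -expR0 ler_expR ltW.
(* [1 + q * t] may be negative here; the quadratic term absorbs it. *)
have h0 : 0 <= 1 + q * t + q ^+ 2 * t ^+ 2 by nra.
have h1 : 0 <= q ^+ 2 * t ^+ 2 * (expR q - 1).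
  by rewrite mulr_ge0 ?subr_ge0// mulr_ge0// sqr_ge0.
have h2 : 0 <= q ^+ 2 * expR q * `|t| `^ q by rewrite mulr_ge0// ltW.
have h3 : 0 <= 3 `^ q * t ^+ 2 by rewrite mulr_ge0// ltW.
nra.
Qed.

(** Homogeneity: factor out |x| and use the previous bound at [t = y / x]. The linear term is kept
    with its sign, so that it disappears on integration against a centered variable. *)
Lemma powR_taylor2 (R : realType) (q x y : R) : 2 <= q ->
  `|x + y| `^ q <= `|x| `^ q + q * (x * `|x| `^ (q - 2)) * y +
     (3 `^ q + q ^+ 2 * expR q) * (`|x| `^ (q - 2) * y ^+ 2 + `|y| `^ q).
Proof.
move=> q2.
have q0 : 0 < q by lra.
have Cq : 0 < q ^+ 2 * expR q by rewrite mulr_gt0 ?expR_gt0// exprn_gt0.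
have C3 : 1 <= 3 `^ q :> R.
  have : 1 `^ q <= 3 `^ q :> R by rewrite ge0_ler_powR ?nnegrE ?(ltW q0)//; lra.
  by rewrite powR1.
have [->|xn0] := eqVneq x 0.
  rewrite add0r mul0r mulr0 mul0r addr0 normr0 powR0 ?gt_eqF// add0r.
  apply: (@le_trans _ _ ((3 `^ q + q ^+ 2 * expR q) * `|y| `^ q)).
    by rewrite ler_peMl ?powR_ge0//; lra.
  by apply: ler_wpM2l; [lra|rewrite lerDr mulr_ge0 ?powR_ge0 ?sqr_ge0].
have xp : 0 < `|x| by rewrite normr_gt0.
have xq : 0 < `|x| `^ q by rewrite powR_gt0.
have [t ->] : exists t, y = x * t by exists (y / x); rewrite mulrC divfK.
have -> : x + x * t = x * (1 + t) by rewrite mulrDr mulr1.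
rewrite !normrM !powRM//.
have x2 : `|x| `^ (q - 2) * x ^+ 2 = `|x| `^ q.
  rewrite -[x ^+ 2]real_normK ?num_real// -powR_mulrn// -powRD; last first.
    by rewrite (gt_eqF xp) implybT.
  by congr (_ `^ _); rewrite subrK.
apply: (le_trans (ler_wpM2l (ltW xq) (powR_taylor2_1D _ _ t q2))).
rewrite le_eqVlt; apply/orP; left; apply/eqP.
rewrite -x2 exprMn; ring.
Qed.

Lemma npow_gt0 (R : realType) (n : nat) (a : R) : (0 < n)%N -> 0 < npow n a.
Proof. by move=> n0; rewrite /npow powR_gt0// ltr0n. Qed.

Lemma npow_ge0 (R : realType) (n : nat) (a : R) : 0 <= npow n a.
Proof. exact: powR_ge0. Qed.

Lemma npowD (R : realType) (n : nat) (a c : R) : (0 < n)%N ->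
  npow n (a + c) = npow n a * npow n c.
Proof. by move=> n0; rewrite /npow powRD// pnatr_eq0 gtn_eqF// implybT. Qed.

Lemma npowN (R : realType) (n : nat) (a : R) : npow n (- a) = (npow n a)^-1.
Proof. exact: powRN. Qed.

Lemma npowM (R : realType) (n : nat) (a c : R) : npow n (a * c) = npow n a `^ c.
Proof. by rewrite /npow powRrM. Qed.

Lemma npow_le (R : realType) (n : nat) (a c : R) : (0 < n)%N -> a <= c ->
  npow n a <= npow n c.
Proof. by move=> n0 ac; rewrite /npow ler_powR// ler1n. Qed.

Lemma npow_eventually_le (R : realType) (a C e : R) : a < 0 -> 0 < e ->
  exists N : nat, forall n, (N <= n)%N -> C * npow n a <= e.
Proof.
move=> a0 e0.
have K0 : 0 < (`|C| + 1) / e by rewrite divr_gt0// ltr_wpDl.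
(* Solves n^(-a) = (|C| + 1) / e; the absolute value and the 1 keep the base positive whatever the
   sign of [C]. *)
pose B := ((`|C| + 1) / e) `^ (- a^-1).
exists (Num.bound B).+1 => n Nn.
have Bn : B <= n%:R.
  rewrite ltW//; apply: (lt_le_trans (archi_boundP _)); first exact: powR_ge0.
  by rewrite ler_nat (leq_trans _ Nn).
have n0 : 0 < n%:R :> R by rewrite ltr0n (leq_trans _ Nn).
have : (`|C| + 1) / e <= npow n (- a).
  have h : B `^ (- a) <= n%:R `^ (- a).
    by apply: ge0_ler_powR Bn; rewrite ?nnegrE ?oppr_ge0 ?powR_ge0 ?ltW.
  move: h; rewrite {1}/B -powRrM mulrNN mulVf ?lt_eqF// powRr1//.
  exact: ltW.
have pn : 0 < npow n a by rewrite /npow powR_gt0.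
rewrite npowN -[leRHS]mul1r ler_pdivlMr// mulrAC ler_pdivrMr// mul1r => h.
have Cn : C <= `|C| by exact: ler_norm.
nra.
Qed.

Lemma bigO_npowP (R : realType) (u : nat -> R) (a : R) :
  bigO_seq u (fun n => npow n a) ->
  exists2 C : R, 0 < C & exists N, forall n, (N <= n)%N -> `|u n| <= C * npow n a.
Proof.
move=> [C [N h]]; exists (`|C| + 1); first by rewrite ltr_wpDl.
exists N => n /h /le_trans; apply; rewrite ger0_norm ?npow_ge0//.
by rewrite ler_wpM2r ?npow_ge0// (le_trans (ler_norm _))// lerDl.
Qed.

(** * Independence and moment bounds for linear forms *)

Definition mfun_of d d' (T : measurableType d) (T' : measurableType d')
  (f : T -> T') (mf : measurable_fun setT f) : {mfun T >-> T'} :=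
  mfun_Sub (mem_set mf).

Lemma mutually_independent_comp d (I : eqType) (T : measurableType d) (R : realType)
    (P : probability T R) (X : I -> T -> R) (g : I -> R -> R) :
  (forall i, measurable_fun setT (g i)) -> mutually_independent P X ->
  mutually_independent P (fun i => g i \o X i).
Proof.
move=> mg iX S B uS mB.
have mgB i : measurable (g i @^-1` B i) by rewrite -[X in measurable X]setTI; exact: mg.
exact: (iX S (fun i => g i @^-1` B i)).
Qed.

Lemma mutually_independent_inj d (I J : eqType) (T : measurableType d) (R : realType)
    (P : probability T R) (X : I -> T -> R) (f : J -> I) :
  injective f -> mutually_independent P X -> mutually_independent P (X \o f).
Proof.
move=> fi iX S B uS mB.
have [-> | [j0 j0S]] : S = [::] \/ exists j, j \in S.
    by case: S {uS} => [|j S]; [left|right; exists j; rewrite mem_head].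
  rewrite big_nil (_ : [set _ | _] = set0) ?bigcap_set0 ?probability_setT//.
  by apply/seteqP; split => i.
(* The event attached to [f j] is recovered from the position of [f j] in [map f S]. [nth] needs a
   default element, which is why the empty list was treated apart. *)
pose B' i := B (nth j0 S (index i (map f S))).
have B'f j : j \in S -> B' (f j) = B j.
  by move=> jS; rewrite /B' index_map// nth_index.
have := iX (map f S) B'; rewrite map_inj_uniq// => /(_ uS (fun i => mB _)).
rewrite big_map => h.
under eq_big_seq => j jS do rewrite -(B'f _ jS).
rewrite -h; congr (fine (P _)); apply/seteqP; split => w /= H i.
  by move=> /mapP[j jS ->]; rewrite B'f//; exact: H.
by move=> iS; rewrite -B'f//; apply: H; apply/mapP; exists i.
Qed.

Lemma set_mem_iota (n : nat) : [set i | i \in iota 0 n] = `I_n.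
Proof. by apply/seteqP; split => i /=; rewrite mem_iota. Qed.

Lemma bigcap_mem_iota (T : Type) (n : nat) (F : nat -> set T) :
  \bigcap_(i in [set i | i \in iota 0 n.+1]) F i =
  (\bigcap_(i in [set i | i \in iota 0 n]) F i) `&` F n.
Proof. by rewrite !set_mem_iota IIS bigcap_setU bigcap_set1. Qed.

(** Uniqueness of measures: P (A and X n in B) and P A * P (X n in B) are finite measures in A that
    agree on the pi-system of cylinders over the first [n] variables, and the partial sum is
    measurable for the sigma-algebra these generate. *)
Lemma mutually_independent_sum d (T : measurableType d) (R : realType)
    (P : probability T R) (X : nat -> T -> R) (a : nat -> R) (n : nat)
    (A B : set R) :
  (forall i, measurable_fun setT (X i)) -> mutually_independent P X ->
  measurable A -> measurable B ->
  P ((fun w => \sum_(i < n) a i * X i w) @^-1` A `&` X n @^-1` B) =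
  (P ((fun w => (\sum_(i < n) a i * X i w)%R) @^-1` A) * P (X n @^-1` B))%E.
Proof.
move=> mX iX mA mB.
pose cap (D : nat -> set R) k := \bigcap_(i in [set i | i \in iota 0 k]) X i @^-1` D i.
pose G : set (set T) := [set C | exists2 D : nat -> set R,
  (forall i, measurable (D i)) & C = cap D n].
have mXB i D : measurable D -> measurable (X i @^-1` D).
  by move=> mD; rewrite -[X in measurable X]setTI; exact: mX.
have mC : measurable (X n @^-1` B) by exact: mXB.
have mcap D k : (forall i, measurable (D i)) -> measurable (cap D k).
  by move=> mD; apply: bigcap_measurableType => i _; exact: mXB.
have fP C : measurable C -> (fine (P C))%:E = P C.
  by move=> ?; rewrite fineK// fin_num_measure.
have sG : <<s G >> ((fun w => \sum_(i < n) a i * X i w) @^-1` A).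
  have : measurable_fun [set: g_sigma_algebraType G]
      (fun w : g_sigma_algebraType G => \sum_(i < n) a i * X i w).
    apply: measurable_sum => i; apply: measurable_funM => // _ D mD.
    rewrite setTI; apply: sub_sigma_algebra.
    exists (fun j : nat => if j == i :> nat then D else setT) => [j|]; first by case: ifP.
    apply/seteqP; split => w /= H.
      by move=> j _ /=; case: eqP => // ->.
    have := H i; rewrite /= eqxx; apply.
    by rewrite mem_iota add0n/=.
  by move=> /(_ measurableT A mA); rewrite setTI.
have GT : G setT.
  exists (fun=> setT) => //; apply/seteqP; split => // w _ i _ //.
pose p : {nonneg R} := NngNum (fine_ge0 (measure_ge0 P (X n @^-1` B))).
have := @g_sigma_algebra_measure_unique _ R T G _ (fun=> setT) (fun=> GT) _
  (mrestr P mC) (mscale p P) _ _ _ _ sG.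
rewrite /= /mrestr /mscale /= fP// muleC; apply.
- by move=> _ [D mD ->]; exact: mcap.
- by rewrite bigcup_const//; exists 0.
- move=> _ _ [D mD ->] [D' mD' ->]; exists (fun i => D i `&` D' i).
    by move=> i; exact: measurableI.
  rewrite /cap; apply/seteqP; split => w /=.
    by move=> [h1 h2] i iS; split; [exact: h1|exact: h2].
  by move=> h; split => i /h [].
- move=> _ [D mD ->].
  (* The product formula is applied over [n + 1] indices, with [B] in the last slot. *)
  pose D' i := if i == n then B else D i.
  have mD' i : measurable (D' i) by rewrite /D'; case: ifP.
  have capD : cap D' n = cap D n.
    by apply: eq_bigcapr => i; rewrite set_mem_iota /D' => ilt; rewrite (ltn_eqF ilt).
  have := iX (iota 0 n.+1) D' (iota_uniq _ _) mD'.
  rewrite bigcap_mem_iota -/(cap D' n) capD.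
  rewrite -(addn1 n) iotaD big_cat/= big_seq1 add0n {1 3}/D' eqxx.
  rewrite -(iX (iota 0 n) D') ?iota_uniq// -/(cap D' n) capD => h.
  rewrite -[LHS]fP; last by apply: measurableI => //; exact: mcap.
  by rewrite h mulrC EFinM !fP//; exact: mcap.
- by move=> k; apply: (@le_lt_trans _ _ 1%E); [rewrite setTI; exact: probability_le1|exact: ltry].
Qed.

(** The law of the pair agrees with the product of the two laws on rectangles, hence everywhere;
    Tonelli's theorem then separates the integrals. *)
Lemma ge0_integral_indep d (T : measurableType d) (R : realType)
    (P : probability T R) (S Y : T -> R) (h : R * R -> \bar R) :
  measurable_fun setT S -> measurable_fun setT Y -> measurable_fun setT h ->
  (forall z, (0 <= h z)%E) ->
  (forall A B, measurable A -> measurable B ->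
     P (S @^-1` A `&` Y @^-1` B) = (P (S @^-1` A) * P (Y @^-1` B))%E) ->
  (\int[P]_w h (S w, Y w) = \int[P]_w \int[P]_w' h (S w, Y w'))%E.
Proof.
move=> mS mY mh h0 ind.
pose S' := mfun_of _ _ _ _ _ mS; pose Y' := mfun_of _ _ _ _ _ mY.
have mSY : measurable_fun setT (fun w => (S w, Y w)) by exact: measurable_fun_pair.
pose SY := mfun_of _ _ _ _ _ mSY.
have hx x : measurable_fun setT (fun y => h (x, y)).
  by apply: measurableT_comp => //; exact: measurable_fun_pair.
transitivity (\int[distribution P SY]_z h z)%E.
  by rewrite (ge0_integral_pushforward mSY).
transitivity (\int[distribution P S' \x distribution P Y']_z h z)%E.
  apply: eq_measure_integral => A mA _; apply/esym.
  by apply: product_measure_unique => // C D mC mD; exact: ind.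
rewrite fubini_tonelli1//= (ge0_integral_pushforward mS) /=; last 3 first.
- by [].
- exact: measurable_fun_fubini_tonelli_F.
- by move=> x _; apply: integral_ge0.
apply: eq_integral => w _ /=; rewrite /fubini_F.
by rewrite (ge0_integral_pushforward mY).
Qed.

(* A Marcinkiewicz-Zygmund constant: adding the summand [a_i Y_i] multiplies
   [E (1 + |S|^q)] by at most [1 + K a_i^2], and the product of these factors is
   at most [expR K] when [\sum a_i^2 <= 1]. *)
Definition mz_const (R : realType) (q M : R) : R :=
  expR ((3 `^ q + q ^+ 2 * expR q) * (1 + 2 * M)).

Lemma measurable_normpow d (T : measurableType d) (R : realType) (f : T -> R) (q : R) :
  measurable_fun setT f -> measurable_fun setT (fun w => `|f w| `^ q).
Proof.
move=> mf.
apply: (@measurableT_comp _ _ _ _ _ _ (fun x => x `^ q) _ (fun w => `|f w|)) => //.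
exact: measurableT_comp.
Qed.

Lemma integral_cst_prob d (T : measurableType d) (R : realType)
    (P : probability T R) (c : R) : (\int[P]_w c%:E = c%:E)%E.
Proof. by rewrite -[RHS](expectation_cst P) unlock. Qed.

(* The first-order term of the Taylor bound integrates to 0 because Y is centered. *)
Lemma integral_affine_pow_le d (T : measurableType d) (R : realType)
    (P : probability T R) (Y : T -> R) (q M a s : R) :
  2 <= q -> measurable_fun setT Y -> (\int[P]_w (Y w)%:E = 0)%E ->
  (\int[P]_w (`|Y w| `^ q)%:E <= M%:E)%E -> `|a| <= 1 ->
  (\int[P]_w (1 + `|s + a * Y w| `^ q)%:E <=
   ((1 + (3 `^ q + q ^+ 2 * expR q) * (1 + 2 * M) * a ^+ 2) * (1 + `|s| `^ q))%:E)%E.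
Proof.
move=> q2 mY EY EYq a1.
set C := 3 `^ q + q ^+ 2 * expR q.
have C0 : 0 <= C.
  by rewrite addr_ge0 ?powR_ge0// mulr_ge0 ?expR_ge0// sqr_ge0.
have q0 : 0 <= q by lra.
(* Coefficients of 1, Y and |Y|^q in the Taylor bound, once Y^2 is replaced by 1 + |Y|^q and |a|^q
   by a^2; the latter uses |a| <= 1 and [q >= 2]. *)
pose c0 := 1 + `|s| `^ q + C * `|s| `^ (q - 2) * a ^+ 2.
pose c1 := q * (s * `|s| `^ (q - 2)) * a.
pose c2 := C * (`|s| `^ (q - 2) + 1) * a ^+ 2.
have sq0 : 0 <= `|s| `^ (q - 2) by exact: powR_ge0.
have a20 : 0 <= a ^+ 2 by exact: sqr_ge0.
have c20 : 0 <= c2 by rewrite /c2; apply: mulr_ge0 => //; apply: mulr_ge0 => //; exact: addr_ge0.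
have mYq : measurable_fun setT (fun w => `|Y w| `^ q) by exact: measurable_normpow.
have iYq : P.-integrable setT (EFin \o (fun w => `|Y w| `^ q)).
  apply/integrableP; split; first exact/measurable_EFinP.
  under eq_integral do rewrite /= ger0_norm ?powR_ge0//.
  by rewrite (le_lt_trans EYq)// ltry.
have icst c : P.-integrable setT (EFin \o (fun=> c)).
  exact: finite_measure_integrable_cst.
have iY : P.-integrable setT (EFin \o Y).
  apply: (@le_integrable _ _ _ P _ measurableT _
    (fun w => (1 + `|Y w| `^ q)%:E)) => //.
  - exact/measurable_EFinP.
  - move=> w _ /=; rewrite lee_fin (ger0_norm (addr_ge0 _ _)) ?powR_ge0//.
    by have := powR_le1D R `|Y w| 1 q; rewrite powRr1//; apply => //; lra.
  - exact: (integrableD measurableT (icst 1) iYq).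
have M0 : 0 <= M.
  rewrite -lee_fin (le_trans _ EYq)//.
  by apply: integral_ge0 => w _; rewrite lee_fin powR_ge0.
apply: (@le_trans _ _ (\int[P]_w (c0%:E + (c1%:E * (Y w)%:E + c2%:E * (`|Y w| `^ q)%:E)))%E).
  apply: ge0_le_integral => //.
  - apply/measurable_EFinP/measurable_funD => //; apply: measurable_normpow.
    by apply: measurable_funD => //; exact: measurable_funM.
  - apply: emeasurable_funD => //; apply: emeasurable_funD.
      by apply: measurable_funeM; exact/measurable_EFinP.
    by apply: measurable_funeM; exact/measurable_EFinP.
  - move=> w _; rewrite -!EFinM -!EFinD lee_fin.
    have h1 := powR_taylor2 _ q s (a * Y w) q2.
    have h2 : `|Y w| ^+ 2 <= 1 + `|Y w| `^ q.
      by rewrite -powR_mulrn// powR_le1D.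
    have h3 : `|a * Y w| `^ q <= a ^+ 2 * `|Y w| `^ q.
      rewrite normrM powRM// ler_wpM2r ?powR_ge0//.
      have [->|an0] := eqVneq a 0.
        by rewrite normr0 powR0 ?sqr_ge0//; lra.
      rewrite -real_normK ?num_real// -powR_mulrn//.
      by apply: ger_powR => //; rewrite a1 normr_gt0 an0.
    rewrite real_normK ?num_real// in h2.
    have h4 : `|s| `^ (q - 2) * (a * Y w) ^+ 2 + `|a * Y w| `^ q <=
       `|s| `^ (q - 2) * (a ^+ 2 * (1 + `|Y w| `^ q)) + a ^+ 2 * `|Y w| `^ q.
      apply: lerD => //; rewrite exprMn; apply: ler_wpM2l => //.
      exact: ler_wpM2l.
    have := ler_wpM2l C0 h4; rewrite /c0 /c1 /c2; move: h1; rewrite -/C.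
    nra.
rewrite integralD//=; last 2 first.
- exact: icst.
- by apply: integrableD => //; apply: integrableZl.
rewrite integral_cst_prob integralD//=; last 2 first.
- by apply: integrableZl.
- by apply: integrableZl.
rewrite !integralZl// EY mule0 add0e.
have : (c2%:E * \int[P]_w (`|Y w| `^ q)%:E <= c2%:E * M%:E)%E.
  by apply: lee_wpmul2l; rewrite ?lee_fin.
move=> h; apply: (le_trans (leeD2l _ h)); rewrite -EFinM -EFinD lee_fin.
have hs : `|s| `^ (q - 2) <= 1 + `|s| `^ q by apply: powR_le1D => //; lra.
have hsq : 0 <= `|s| `^ q by exact: powR_ge0.
have k1 : 0 <= C * a ^+ 2 by exact: mulr_ge0.
rewrite /c0 /c2.
have k2 : C * a ^+ 2 * ((1 + M) * `|s| `^ (q - 2) + M) <=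
  C * a ^+ 2 * ((1 + 2 * M) * (1 + `|s| `^ q)).
  by apply: ler_wpM2l => //; nra.
move: k2; nra.
Qed.

(** Induction on the number of summands: the partial sum is independent of the next variable, so it
    is frozen as [s] in [integral_affine_pow_le]. The 1 added to |S|^q absorbs the power [q - 2] of
    the partial sum and keeps the recursion multiplicative. *)
Lemma moment_sum_indep d (T : measurableType d) (R : realType)
    (P : probability T R) (Y : nat -> T -> R) (q M : R) (a : nat -> R) (n : nat) :
  2 <= q -> (forall i, measurable_fun setT (Y i)) -> mutually_independent P Y ->
  (forall i, \int[P]_w (Y i w)%:E = 0)%E ->
  (forall i, \int[P]_w (`|Y i w| `^ q)%:E <= M%:E)%E ->
  \sum_(i < n) a i ^+ 2 <= 1 ->
  (\int[P]_w (1 + `|(\sum_(i < n) a i * Y i w)%R| `^ q)%:E <= (mz_const R q M)%:E)%E.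
Proof.
move=> q2 mY iY EY EYq a1.
set K := (3 `^ q + q ^+ 2 * expR q) * (1 + 2 * M).
have M0 : 0 <= M.
  rewrite -lee_fin (le_trans _ (EYq 0%N))//.
  by apply: integral_ge0 => w _; rewrite lee_fin powR_ge0.
have K0 : 0 <= K.
  rewrite mulr_ge0//; last lra.
  by rewrite addr_ge0 ?powR_ge0// mulr_ge0 ?expR_ge0// sqr_ge0.
have mS k : measurable_fun setT (fun w => \sum_(i < k) a i * Y i w).
  by apply: measurable_sum => i; apply: measurable_funM.
suff H k : (k <= n)%N ->
    (\int[P]_w (1 + `|(\sum_(i < k) a i * Y i w)%R| `^ q)%:E <=
     (expR (K * \sum_(i < k) a i ^+ 2))%:E)%E.
  apply: (le_trans (H n _)) => //; rewrite lee_fin ler_expR -[leRHS]mulr1.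
  exact: ler_wpM2l.
elim: k => [_|k IH kn].
  have q0 : q != 0 by rewrite gt_eqF//; lra.
  under eq_integral do rewrite big_ord0 normr0 (powR0 q0) addr0.
  by rewrite big_ord0 mulr0 expR0 integral_cst_prob.
have ak : `|a k| <= 1.
  rewrite -(@ler_pXn2r _ 2) ?nnegrE// expr1n real_normK ?num_real//.
  rewrite (le_trans _ a1)// (bigD1 (Ordinal kn))//= lerDl.
  by apply: sumr_ge0 => i _; exact: sqr_ge0.
pose h (z : R * R) := (1 + `|z.1 + a k * z.2| `^ q)%:E.
have mh : measurable_fun setT h.
  apply/measurable_EFinP/measurable_funD => //; apply: measurable_normpow.
  by apply: measurable_funD => //; exact: measurable_funM.
have h0 z : (0 <= h z)%E by rewrite lee_fin addr_ge0// powR_ge0.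
under eq_integral do rewrite big_ord_recr/=.
have ind A B : measurable A -> measurable B ->
   P ((fun w => \sum_(i < k) a i * Y i w) @^-1` A `&` Y k @^-1` B) =
   (P ((fun w => (\sum_(i < k) a i * Y i w)%R) @^-1` A) * P (Y k @^-1` B))%E.
  by move=> mA mB; exact: mutually_independent_sum.
have := @ge0_integral_indep _ _ _ P _ _ h (mS k) (mY k) mh h0 ind.
rewrite /h /= => ->.
pose c := 1 + K * a k ^+ 2.
have c0 : 0 <= c by rewrite addr_ge0// mulr_ge0// sqr_ge0.
apply: (@le_trans _ _ (\int[P]_w (c%:E * (1 + `|(\sum_(i < k) a i * Y i w)%R| `^ q)%:E))%E).
  apply: ge0_le_integral => //.
  - by move=> w _; apply: integral_ge0 => w' _; rewrite lee_fin addr_ge0// powR_ge0.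
  - have := @measurable_fun_fubini_tonelli_F _ _ T T R P
      (fun z => h (\sum_(i < k) a i * Y i z.1, Y k z.2)).
    apply => //.
    apply: measurableT_comp => //; apply: measurable_fun_pair.
      exact: (measurableT_comp (mS k)).
    exact: (measurableT_comp (mY k)).
  - apply: measurable_funeM; apply/measurable_EFinP/measurable_funD => //.
    exact: measurable_normpow.
  - by move=> w _; rewrite -EFinM; exact: integral_affine_pow_le.
rewrite ge0_integralZl//; last first.
  by apply/measurable_EFinP/measurable_funD => //; exact: measurable_normpow.
apply: (@le_trans _ _ (c%:E * (expR (K * \sum_(i < k) a i ^+ 2))%:E)%E).
  apply: lee_wpmul2l; [by rewrite lee_fin|exact/IH/ltnW].
rewrite -EFinM lee_fin big_ord_recr/= mulrDr addrC expRD.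
by rewrite ler_wpM2r ?expR_ge0// expR_ge1Dx.
Qed.

Lemma linear_form_moment d (T : measurableType d) (R : realType)
    (P : probability T R) (Y : nat -> T -> R) (q M : R) (a : nat -> R) (n : nat) (s : R) :
  2 <= q -> (forall i, measurable_fun setT (Y i)) -> mutually_independent P Y ->
  (forall i, \int[P]_w (Y i w)%:E = 0)%E ->
  (forall i, \int[P]_w (`|Y i w| `^ q)%:E <= M%:E)%E ->
  0 < s -> \sum_(i < n) a i ^+ 2 <= s ^+ 2 ->
  (\int[P]_w (1 + `|(\sum_(i < n) a i * Y i w)%R / s| `^ q)%:E <= (mz_const R q M)%:E)%E.
Proof.
move=> q2 mY iY EY EYq s0 as1.
under eq_integral do rewrite mulr_suml.
under eq_integral => w _ do under eq_bigr do rewrite mulrAC.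
apply: (@moment_sum_indep _ _ _ P Y q M (fun i => a i / s)) => //.
under eq_bigr do rewrite exprMn.
by rewrite -mulr_suml exprVn ler_pdivrMr ?exprn_gt0// mul1r.
Qed.

Lemma linear_form_tail d (T : measurableType d) (R : realType)
    (P : probability T R) (Y : nat -> T -> R) (q M : R) (a : nat -> R) (n : nat) (s t : R) :
  2 <= q -> (forall i, measurable_fun setT (Y i)) -> mutually_independent P Y ->
  (forall i, \int[P]_w (Y i w)%:E = 0)%E ->
  (forall i, \int[P]_w (`|Y i w| `^ q)%:E <= M%:E)%E ->
  0 < s -> 0 < t -> \sum_(i < n) a i ^+ 2 <= s ^+ 2 ->
  (P [set w | (t < `|\sum_(i < n) a i * Y i w|)%R] <= (mz_const R q M * (s / t) `^ q)%:E)%E.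
Proof.
move=> q2 mY iY EY EYq s0 t0 as1.
have q0 : 0 <= q by lra.
have st0 : 0 < s / t by exact: divr_gt0.
have mS : measurable_fun setT (fun w => \sum_(i < n) a i * Y i w).
  by apply: measurable_sum => i; apply: measurable_funM.
set A := [set w | _].
have mA : measurable A.
  have := measurable_fun_ltr (@measurable_cst _ _ T _ setT t)
    (measurableT_comp (@normr_measurable R setT) mS).
  by move=> /(_ measurableT [set true]); rewrite setTI; exact.
have -> : P A = (\int[P]_w (\1_A w)%:E)%E by rewrite integral_indic// setIT.
have mF : measurable_fun setT (fun w => (1 + `|(\sum_(i < n) a i * Y i w)%R / s| `^ q)%:E).
  apply/measurable_EFinP/measurable_funD => //; apply: measurable_normpow.
  exact: measurable_funM.
apply: (@le_trans _ _ (\int[P]_w (((s / t) `^ q)%:E *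
   (1 + `|(\sum_(i < n) a i * Y i w)%R / s| `^ q)%:E))%E).
  apply: ge0_le_integral => //.
  - by apply/measurable_EFinP; exact: measurable_indic.
  - exact: measurable_funeM.
  - move=> w _; rewrite -EFinM lee_fin indicE.
    have [|_] := boolP (w \in A); last first.
      by rewrite mulr_ge0 ?powR_ge0// addr_ge0// powR_ge0.
    rewrite inE /A /= => tS.
    apply: (@le_trans _ _ ((s / t) `^ q * `|(\sum_(i < n) a i * Y i w) / s| `^ q)); last first.
      by rewrite ler_wpM2l ?powR_ge0// lerDr.
    have one : 1 = 1 `^ q :> R by rewrite powR1.
    rewrite -powRM ?(ltW st0)// [leLHS]one.
    apply: ge0_ler_powR; rewrite ?nnegrE//; first exact: (mulr_ge0 (ltW st0)).
    rewrite normrM (gtr0_norm (x := s^-1)) ?invr_gt0//.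
    rewrite mulrC -mulrA mulKf ?gt_eqF//.
    by rewrite ler_pdivlMr// mul1r ltW.
rewrite ge0_integralZl//; last by rewrite lee_fin powR_ge0.
rewrite [X in (_ <= X%:E)%E]mulrC [X in (_ <= X)%E]EFinM; apply: lee_wpmul2l; first by rewrite lee_fin powR_ge0.
exact: linear_form_moment.
Qed.

(** Since x^2 <= 1 + |x|^q, the second moment is controlled by the same constant as the tail. *)
Lemma linear_form_second_moment d (T : measurableType d) (R : realType)
    (P : probability T R) (Y : nat -> T -> R) (q M : R) (a : nat -> R) (n : nat) (s : R) :
  2 <= q -> (forall i, measurable_fun setT (Y i)) -> mutually_independent P Y ->
  (forall i, \int[P]_w (Y i w)%:E = 0)%E ->
  (forall i, \int[P]_w (`|Y i w| `^ q)%:E <= M%:E)%E ->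
  0 < s -> \sum_(i < n) a i ^+ 2 <= s ^+ 2 ->
  (\int[P]_w ((\sum_(i < n) a i * Y i w) ^+ 2)%:E <= (mz_const R q M * s ^+ 2)%:E)%E.
Proof.
move=> q2 mY iY EY EYq s0 as1.
have mS : measurable_fun setT (fun w => \sum_(i < n) a i * Y i w).
  by apply: measurable_sum => i; apply: measurable_funM.
have mF : measurable_fun setT (fun w => (1 + `|(\sum_(i < n) a i * Y i w)%R / s| `^ q)%:E).
  apply/measurable_EFinP/measurable_funD => //; apply: measurable_normpow.
  exact: measurable_funM.
apply: (@le_trans _ _ (\int[P]_w ((s ^+ 2)%:E *
   (1 + `|(\sum_(i < n) a i * Y i w)%R / s| `^ q)%:E))%E).
  apply: ge0_le_integral => //.
  - by move=> w _; rewrite lee_fin sqr_ge0.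
  - apply/measurable_EFinP; exact: measurable_funX.
  - exact: measurable_funeM.
  - move=> w _; rewrite -EFinM lee_fin.
    set S := \sum_(i < n) _.
    have := powR_le1D R `|S / s| 2 q (normr_ge0 _) (ler0n _ _) q2.
    rewrite powR_mulrn// real_normK ?num_real// => /(ler_wpM2l (sqr_ge0 s)).
    by rewrite exprMn exprVn mulrCA divff ?mulr1// expf_neq0// gt_eqF.
rewrite ge0_integralZl//; last by rewrite lee_fin sqr_ge0.
rewrite [X in (_ <= X%:E)%E]mulrC [X in (_ <= X)%E]EFinM; apply: lee_wpmul2l; first by rewrite lee_fin sqr_ge0.
exact: linear_form_moment.
Qed.

(** * Transfer between spaces and Gaussian moments *)

Lemma integral_eq_law d1 d2 (T1 : measurableType d1) (T2 : measurableType d2)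
    (R : realType) (m1 : {measure set T1 -> \bar R}) (m2 : {measure set T2 -> \bar R})
    (X : T1 -> R) (Y : T2 -> R) (f : R -> R) :
  measurable_fun setT X -> measurable_fun setT Y -> measurable_fun setT f ->
  (forall B, measurable B -> m1 (X @^-1` B) = m2 (Y @^-1` B)) ->
  (\int[m1]_w (f (X w))%:E = \int[m2]_w (f (Y w))%:E)%E.
Proof.
move=> mX mY mf law.
have nneg (g : R -> \bar R) : measurable_fun setT g -> (forall x, 0 <= g x)%E ->
    (\int[m1]_w (g \o X) w = \int[m2]_w (g \o Y) w)%E.
  move=> mg g0.
  rewrite -(ge0_integral_pushforward mX m1 measurableT mg); last by move=> x _.
  rewrite -(ge0_integral_pushforward mY m2 measurableT mg); last by move=> x _.
  by apply: eq_measure_integral => A mA _; exact: law.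
have mfE : measurable_fun setT (EFin \o f) by exact/measurable_EFinP.
rewrite [LHS]integralE [RHS]integralE; congr (_ - _)%E.
  by have := nneg _ (measurable_funepos mfE) (funepos_ge0 _); rewrite -!funepos_comp.
by have := nneg _ (measurable_funeneg mfE) (funeneg_ge0 _); rewrite -!funeneg_comp.
Qed.

(** The Radon-Nikodym derivative of [normal_prob] and [normal_pdf] have the same integral over every
    measurable set, so they agree almost everywhere. *)
Lemma ge0_integral_normal_prob (R : realType) (mu s : R) (f : R -> R) :
  measurable_fun setT f -> (forall x, 0 <= f x) ->
  (\int[normal_prob mu s]_x (f x)%:E =
   \int[lebesgue_measure]_x (f x * normal_pdf mu s x)%:E)%E.
Proof.
move=> mf f0; have dom := @normal_prob_dominates R mu s.
have mfE : measurable_fun setT (EFin \o f) by exact/measurable_EFinP.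
rewrite -(Radon_Nikodym_SigmaFinite.change_of_variables dom) //=.
have iRN := Radon_Nikodym_SigmaFinite.f_integrable dom.
apply: ae_eq_integral => //.
- by apply: emeasurable_funM => //; exact: measurable_int iRN.
- by apply/measurable_EFinP/measurable_funM => //; exact: measurable_normal_pdf.
have : ae_eq lebesgue_measure setT
    (Radon_Nikodym_SigmaFinite.f (normal_prob mu s) lebesgue_measure)
    (fun x => (normal_pdf mu s x)%:E).
  apply: integral_ae_eq => //.
  - by apply/measurable_EFinP; exact: measurable_normal_pdf.
  - by move=> E _ mE; rewrite -Radon_Nikodym_SigmaFinite.f_integral.
by apply: filterS => x /= + _ => ->.
Qed.

Lemma integral_expR_normal (R : realType) (t : R) :
  (\int[normal_prob 0 1]_x (expR (t * x))%:E = (expR (t ^+ 2 / 2))%:E)%E.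
Proof.
rewrite ge0_integral_normal_prob => [||x]; last exact: expR_ge0.
  (* Completing the square: expR (t x) times the N(0,1) density is expR (t^2 / 2) times the N(t,1)
     density. *)
  transitivity (\int[lebesgue_measure]_x ((expR (t ^+ 2 / 2))%:E * (normal_pdf t 1 x)%:E))%E.
    apply: eq_integral => x _; rewrite -EFinM; congr EFin.
    rewrite !normal_pdfE// mulrCA [RHS]mulrCA; congr (_ * _).
    by rewrite /normal_fun -!expRD; congr expR; lra.
  rewrite ge0_integralZl//.
  - by rewrite integral_normal_pdf mule1.
  - by apply/measurable_EFinP; exact: measurable_normal_pdf.
  - by move=> x _; rewrite lee_fin normal_pdf_ge0.
by apply: measurableT_comp => //; exact: measurable_expR.
Qed.

Lemma integrable_expR_normal (R : realType) (t : R) :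
  (normal_prob 0 1).-integrable setT (EFin \o (fun x : R => expR (t * x))).
Proof.
apply/integrableP; split.
  by apply/measurable_EFinP/measurableT_comp => //; exact: measurable_expR.
under eq_integral do rewrite /= ger0_norm ?expR_ge0//.
by rewrite integral_expR_normal ltry.
Qed.

Lemma normal_prob_moment (R : realType) (q : R) : 0 < q ->
  (\int[normal_prob 0 1]_x (`|x| `^ q)%:E <= (q `^ q * (2 * expR 1))%:E)%E.
Proof.
move=> q0.
have mexp (t : R) : measurable_fun setT (fun x : R => expR (t * x)).
  by apply: measurableT_comp => //; exact: measurable_expR.
have M (t : R) : (\int[normal_prob 0 1]_x (expR (t * x))%:E <= (expR (t ^+ 2))%:E)%E.
  rewrite integral_expR_normal lee_fin ler_expR; have := sqr_ge0 t; lra.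
(* |x|^q <= q^q expR |x|, and expR |x| is at most expR x + expR (- x). *)
apply: (@le_trans _ _ (\int[normal_prob 0 1]_x
    ((q `^ q)%:E * ((expR (1 * x))%:E + (expR (-1 * x))%:E)))%E).
  apply: ge0_le_integral => //.
  - by apply/measurable_EFinP; exact: measurable_normpow.
  - by apply: measurable_funeM; apply: emeasurable_funD; apply/measurable_EFinP; exact: mexp.
  - move=> x _; rewrite -EFinD -EFinM lee_fin.
    apply: (le_trans (powR_le_expR _ _ _ (normr_ge0 x) q0)).
    apply: ler_wpM2l; first exact: powR_ge0.
    rewrite mul1r mulN1r; case: (ger0P x) => x0; [rewrite lerDl|rewrite lerDr];
      exact: expR_ge0.
rewrite ge0_integralZl//;
  try by [move=> x _; apply: adde_ge0; rewrite lee_fin expR_ge0|rewrite lee_fin powR_ge0|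
          apply: emeasurable_funD; apply/measurable_EFinP; exact: mexp].
rewrite EFinM; apply: lee_wpmul2l; first by rewrite lee_fin powR_ge0.
rewrite ge0_integralD//;
  try by [move=> x _; rewrite lee_fin expR_ge0|apply/measurable_EFinP; exact: mexp].
apply: (le_trans (leeD (M 1) (M (-1)))).
by rewrite sqrrN expr1n -EFinD lee_fin; lra.
Qed.

(** Read off from the moment generating function: the mean v satisfies 1 + t v <= expR (t^2 / 2) for
    every real t, which a small t of the sign of v refutes unless v = 0. *)
Lemma normal_prob_mean (R : realType) :
  (\int[normal_prob 0 1]_x (x : R)%:E = 0)%E.
Proof.
have mid : measurable_fun setT (@id R) by exact: measurable_id.
have iZ : (normal_prob 0 1).-integrable setT (EFin \o (@id R)).
  apply/integrableP; split; first exact/measurable_EFinP.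
  have := normal_prob_moment R 1 ltr01.
  under eq_integral do rewrite powRr1//.
  by move=> /le_lt_trans; apply; exact: ltry.
have fZ := integrable_fin_num measurableT iZ.
set mu := (\int[_]_x _)%E in fZ *.
rewrite -(fineK fZ); set v := fine mu.
have i1 : (normal_prob 0 1).-integrable setT (EFin \o (fun _ : R => 1)).
  exact: finite_measure_integrable_cst.
have key (t : R) : 1 + t * v <= expR (t ^+ 2 / 2).
  have : (\int[normal_prob 0 1]_x (1 + t * x)%:E <=
          \int[normal_prob 0 1]_x (expR (t * x))%:E)%E.
    apply: le_integral => //.
    - have := integrableD measurableT i1 (integrableZl measurableT t iZ).
      by apply: eq_integrable.
    - exact: integrable_expR_normal.
    - by move=> x _; rewrite lee_fin expR_ge1Dx.
  rewrite integral_expR_normal.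
  under eq_integral do rewrite EFinD EFinM.
  rewrite (integralD measurableT i1 (integrableZl measurableT t iZ)).
  rewrite integral_cst_prob (integralZl measurableT iZ).
  by rewrite -/mu -(fineK fZ) -/v -EFinM -EFinD lee_fin.
have [->//|v0] := eqVneq v 0.
have up (u : R) : 0 <= u -> u <= 1 / 2 -> expR u <= 1 + 2 * u.
  move=> u0 u1; have := expR_ge1Dx (- u); rewrite expRN => h.
  have e0 := expR_gt0 u.
  have : (1 - u) * expR u <= 1 by rewrite -ler_pdivlMr// div1r.
  nra.
have av : 0 < `|v| by rewrite normr_gt0.
(* [w <= 1] keeps w^2 / 2 in the range of [up], which gives |v| <= w; this contradicts w <= |v| /
   2. *)
pose w := Num.min 1 (`|v| / 2).
have w0 : 0 < w by rewrite lt_min ltr01 divr_gt0.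
have w1 : w <= 1 by rewrite ge_min lexx.
have w2 : w <= `|v| / 2 by rewrite ge_min lexx orbT.
have := key (Num.sg v * w).
rewrite mulrAC -normrEsg exprMn sqr_sg v0 mul1r => h1.
have w20 : 0 <= w ^+ 2 / 2 by rewrite divr_ge0 ?sqr_ge0.
have w21 : w ^+ 2 / 2 <= 1 / 2 by rewrite ler_pM2r ?invr_gt0// expr_le1// ltW.
have h2 := le_trans h1 (up _ w20 w21).
suff : w < w by rewrite ltxx.
have h3 : `|v| <= w.
  have : `|v| * w <= w * w by rewrite -expr2; move: h2; rewrite mulrCA divff ?mulr1 ?lerD2l.
  by rewrite ler_pM2r.
rewrite (lt_le_trans _ h3)// (le_lt_trans w2)// ltr_pdivrMr// ltr_pMr//.
by rewrite ltr1n.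
Qed.

(** * The debiased ridge estimator in the SVD basis *)

(* The noise coefficient [lam (lam^2 + 2 rho) / (lam^2 + rho)^2] equals
   [lam^-1 (1 - (rho / (lam^2 + rho))^2)]; [bias_row] is the remaining relative bias. *)
Definition shrink_row (R : realType) (r : nat) (lam : 'rV[R]_r) (rho : R) : 'rV[R]_r :=
  \row_k (lam 0 k * (lam 0 k ^+ 2 + 2 * rho) / (lam 0 k ^+ 2 + rho) ^+ 2).

Definition bias_row (R : realType) (r : nat) (lam : 'rV[R]_r) (rho : R) : 'rV[R]_r :=
  \row_k (rho / (lam 0 k ^+ 2 + rho)) ^+ 2.

(** Coefficients of the errors in [c *m coord_err]. The row [c] is a row of [Q] when selection is
    studied and a row of [cmat] when prediction is. *)
Definition noise_form (R : realType) (n r : nat) (Pm : 'M[R]_(n, r)) (lam : 'rV[R]_r)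
  (rho : R) (c : 'rV[R]_r) : 'rV[R]_n := c *m diag_mx (shrink_row _ _ lam rho) *m Pm^T.

(** The vector w of the SVD representation. With [beta] replaced by the thresholded estimator it
    also describes the bootstrap estimator. *)
Definition coord_err (R : realType) (n p r : nat) (Pm : 'M[R]_(n, r)) (Q : 'M[R]_(p, r))
  (lam : 'rV[R]_r) (rho : R) (beta : 'cV[R]_p) (e : 'cV[R]_n) : 'cV[R]_r :=
  diag_mx (shrink_row _ _ lam rho) *m Pm^T *m e -
  diag_mx (bias_row _ _ lam rho) *m Q^T *m beta.

(** The columns of [Q] and [Qp] form an orthonormal eigenbasis of the ridge Gram matrix, with
    eigenvalues lam^2 + rho and rho; checking one product with the candidate inverse is enough. *)
Lemma gram_ridge_inv (R : realType) (n p r : nat) (X : 'M[R]_(n, p)) (Pm : 'M[R]_(n, r))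
    (Q : 'M[R]_(p, r)) (lam : 'rV[R]_r) (Qp : 'M[R]_(p, p - r)) (rho : R) :
  X = Pm *m diag_mx lam *m Q^T -> Pm^T *m Pm = 1%:M -> Q^T *m Q = 1%:M ->
  Qp^T *m Qp = 1%:M -> Q^T *m Qp = 0 -> Q *m Q^T + Qp *m Qp^T = 1%:M -> 0 < rho ->
  invmx (X^T *m X + rho%:M) =
  Q *m diag_mx (\row_k (lam 0 k ^+ 2 + rho)^-1) *m Q^T + rho^-1 *: (Qp *m Qp^T).
Proof.
move=> -> PP QQ QpQp QQp one rho0.
have QpQ : Qp^T *m Q = 0 by rewrite -[LHS]trmxK trmx_mul trmxK QQp trmx0.
have -> : (Pm *m diag_mx lam *m Q^T)^T *m (Pm *m diag_mx lam *m Q^T) + rho%:M =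
    Q *m diag_mx (\row_k (lam 0 k ^+ 2 + rho)) *m Q^T + rho *: (Qp *m Qp^T).
  rewrite !trmx_mul trmxK tr_diag_mx !mulmxA.
  rewrite -(mulmxA _ Pm^T) PP mulmx1 -(mulmxA Q (diag_mx lam)) mulmx_diag.
  rewrite -[rho%:M]mulr1 -[rho%:M * 1]/(rho%:M *m 1%:M) -one mul_scalar_mx scalerDr addrA.
  congr (_ + _); rewrite scalemxAl -mulmxDl; congr (_ *m _).
  rewrite -[rho *: Q]mulmx1 -scalemxAl scalemxAr -mulmxDr; congr (_ *m _).
  apply/matrixP => i j; rewrite !mxE.
  by case: eqP => _; rewrite ?mulr0n ?mulr1n ?mulr0 ?addr0 ?mulr1 ?expr2.
set A := (X in invmx X); set B := (RHS).
have AB : A *m B = 1%:M.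
  rewrite /A /B mulmxDl !mulmxDr -!scalemxAl -!scalemxAr !mulmxA.
  rewrite -(mulmxA _ Q^T Q) QQ mulmx1 -(mulmxA _ Q^T Qp) QQp mulmx0 mul0mx scaler0 addr0.
  rewrite -(mulmxA _ Qp^T Q) QpQ mulmx0 !mul0mx scaler0 add0r.
  rewrite -(mulmxA _ Qp^T Qp) QpQp mulmx1 scalerA divff ?gt_eqF// scale1r.
  rewrite -(mulmxA Q) mulmx_diag -one; congr (_ + _); congr (_ *m _).
  rewrite -[RHS]mulmx1; congr (_ *m _); apply/matrixP => i j; rewrite !mxE.
  by rewrite divff// gt_eqF// ltr_wpDl// sqr_ge0.
have [uA _] := mulmx1_unit AB.
by rewrite -[LHS]mulmx1 -AB mulKmx.
Qed.

(** The range of X^T lies in that of [Q], so the part of the inverse along [Qp] drops out. The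
    correction multiplies the ridge factor lam / (lam^2 + rho) by 1 + rho / (lam^2 + rho), which
    yields [shrink_row]. *)
Lemma ridge_debiased_svd (R : realType) (n p r : nat) (X : 'M[R]_(n, p)) (Pm : 'M[R]_(n, r))
    (Q : 'M[R]_(p, r)) (lam : 'rV[R]_r) (Qp : 'M[R]_(p, p - r)) (rho : R) (y : 'cV[R]_n) :
  X = Pm *m diag_mx lam *m Q^T -> Pm^T *m Pm = 1%:M -> Q^T *m Q = 1%:M ->
  Qp^T *m Qp = 1%:M -> Q^T *m Qp = 0 -> Q *m Q^T + Qp *m Qp^T = 1%:M -> 0 < rho ->
  ridge_debiased X Q lam rho y =
  Q *m (diag_mx (shrink_row _ _ lam rho) *m Pm^T *m y).
Proof.
move=> XE PP QQ QpQp QQp one rho0.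
have QpQ : Qp^T *m Q = 0 by rewrite -[LHS]trmxK trmx_mul trmxK QQp trmx0.
have g0 k : 0 < lam 0 k ^+ 2 + rho by rewrite ltr_wpDl// sqr_ge0.
pose ginv := \row_k (lam 0 k ^+ 2 + rho)^-1 : 'rV[R]_r.
have tsE : ridge_star X rho y = Q *m (diag_mx ginv *m diag_mx lam *m Pm^T *m y).
  rewrite /ridge_star (@gram_ridge_inv _ _ _ _ X Pm Q lam Qp rho)// {1}XE.
  rewrite !trmx_mul trmxK tr_diag_mx mulmxDl -scalemxAl !mulmxA.
  rewrite -(mulmxA _ Q^T Q) QQ mulmx1 -(mulmxA _ Qp^T Q) QpQ mulmx0 !mul0mx scaler0 addr0.
  by [].
have invE : invmx (diag_mx lam *m diag_mx lam + rho%:M) = diag_mx ginv.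
  have AB : (diag_mx lam *m diag_mx lam + rho%:M) *m diag_mx ginv = 1%:M.
    rewrite mulmx_diag -diag_const_mx -raddfD/= mulmx_diag.
    apply/matrixP => i j; rewrite !mxE -expr2.
    by rewrite divff// gt_eqF.
  have [uA _] := mulmx1_unit AB.
  by rewrite -[LHS]mulmx1 -AB mulKmx.
rewrite /ridge_debiased tsE invE; set t := _ *m y.
have -> : Q *m diag_mx ginv *m Q^T *m (Q *m t) = Q *m (diag_mx ginv *m t).
  by rewrite !mulmxA -(mulmxA _ Q^T Q) QQ mulmx1.
rewrite scalemxAr -mulmxDr; congr (_ *m _); rewrite /t.
rewrite !mulmxA !scalemxAl -!mulmxDl.
congr (_ *m _ *m _); rewrite -scalemxAl mulmxDl -scalemxAl !mulmx_diag.
apply/matrixP => i j; rewrite !mxE; have [->|_] := eqVneq i j; last by rewrite !mulr0n mulr0 addr0.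
rewrite !mulr1n; have /lt0r_neq0 := g0 j; move: (lam 0 j) => l h.
by field.
Qed.

(** Entrywise, lam times [shrink_row] is 1 minus [bias_row]: debiasing squares the relative bias rho
    / (lam^2 + rho) of ridge regression. *)
Lemma ridge_debiased_err (R : realType) (n p r : nat) (X : 'M[R]_(n, p)) (Pm : 'M[R]_(n, r))
    (Q : 'M[R]_(p, r)) (lam : 'rV[R]_r) (Qp : 'M[R]_(p, p - r)) (rho : R)
    (beta : 'cV[R]_p) (e : 'cV[R]_n) :
  X = Pm *m diag_mx lam *m Q^T -> Pm^T *m Pm = 1%:M -> Q^T *m Q = 1%:M ->
  Qp^T *m Qp = 1%:M -> Q^T *m Qp = 0 -> Q *m Q^T + Qp *m Qp^T = 1%:M -> 0 < rho ->
  ridge_debiased X Q lam rho (X *m beta + e) =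
  theta_of Q beta + Q *m coord_err _ _ _ _ Pm Q lam rho beta e.
Proof.
move=> XE PP QQ QpQp QQp one rho0.
rewrite (@ridge_debiased_svd _ _ _ _ X Pm Q lam Qp)// /theta_of /coord_err.
rewrite -(mulmxA Q Q^T beta) -mulmxDr; congr (_ *m _).
rewrite mulmxDr addrCA [LHS]addrC; congr (_ + _).
rewrite XE !mulmxA -(mulmxA _ Pm^T Pm) PP mulmx1 -mulmxBl -{2}[Q^T]mul1mx -mulmxBl.
congr (_ *m _ *m _); rewrite mulmx_diag.
apply/matrixP => i j; rewrite !mxE; have [->|_] := eqVneq i j; last by rewrite !mulr0n subr0.
rewrite !mulr1n; have : lam 0 j ^+ 2 + rho != 0 by rewrite gt_eqF// ltr_wpDl// sqr_ge0.
by move: (lam 0 j) => l h; field.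
Qed.

Lemma cauchy_schwarz_mx (R : realType) (r : nat) (c : 'rV[R]_r) (u : 'cV[R]_r) :
  ((c *m u) 0 0) ^+ 2 <= (\sum_k c 0 k ^+ 2) * (\sum_k u k 0 ^+ 2).
Proof.
rewrite mxE; set a := \sum_k c 0 k ^+ 2; set b := \sum_k u k 0 ^+ 2.
set s := \sum_k c 0 k * u k 0.
have H t : 0 <= a * t ^+ 2 + 2 * s * t + b.
  have -> : a * t ^+ 2 + 2 * s * t + b = \sum_k (c 0 k * t + u k 0) ^+ 2.
    rewrite /a /b /s mulr_suml mulr_sumr mulr_suml -!big_split/=.
    by apply: eq_bigr => k _; ring.
  by apply: sumr_ge0 => k _; exact: sqr_ge0.
have a0 : 0 <= a by apply: sumr_ge0 => k _; exact: sqr_ge0.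
have b0 : 0 <= b by apply: sumr_ge0 => k _; exact: sqr_ge0.
have [az|an0] := eqVneq a 0.
  have s0 : s = 0.
    rewrite /s big1// => k _.
    have /eqP : c 0 k ^+ 2 = 0.
      apply/eqP; rewrite eq_le sqr_ge0 andbT -az /a (bigD1 k)//= lerDl.
      by apply: sumr_ge0 => i _; exact: sqr_ge0.
    by rewrite sqrf_eq0 => /eqP ->; rewrite mul0r.
  by rewrite s0 az expr0n/= mul0r.
have ap : 0 < a by rewrite lt_neqAle eq_sym an0.
(* The point where the quadratic in [t] is minimal. *)
have := H (- s / a).
have -> : a * (- s / a) ^+ 2 + 2 * s * (- s / a) + b = b - s ^+ 2 / a by field.
by rewrite subr_ge0 ler_pdivrMr// mulrC.
Qed.

Lemma sumsq_isometry (R : realType) (p r : nat) (Q : 'M[R]_(p, r)) (u : 'cV[R]_r) :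
  Q^T *m Q = 1%:M -> \sum_i (Q *m u) i 0 ^+ 2 = \sum_k u k 0 ^+ 2.
Proof.
have sqE k (v : 'cV[R]_k) : \sum_i v i 0 ^+ 2 = (v^T *m v) 0 0.
  by rewrite mxE; apply: eq_bigr => i _; rewrite mxE expr2.
by move=> QQ; rewrite !sqE trmx_mul -mulmxA (mulmxA Q^T) QQ mul1mx.
Qed.

(** The difference of the two sides is the squared norm of [v - Q *m (Q^T *m v)]. *)
Lemma sumsq_contraction (R : realType) (p r : nat) (Q : 'M[R]_(p, r)) (v : 'cV[R]_p) :
  Q^T *m Q = 1%:M -> \sum_k (Q^T *m v) k 0 ^+ 2 <= \sum_i v i 0 ^+ 2.
Proof.
have sqE k (w : 'cV[R]_k) : \sum_i w i 0 ^+ 2 = (w^T *m w) 0 0.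
  by rewrite mxE; apply: eq_bigr => i _; rewrite mxE expr2.
move=> QQ; have : 0 <= \sum_i (v - Q *m (Q^T *m v)) i 0 ^+ 2.
  by apply: sumr_ge0 => i _; exact: sqr_ge0.
rewrite !sqE trmx_mul trmxK.
have -> : (v - Q *m (Q^T *m v))^T = v^T - v^T *m Q *m Q^T.
  by rewrite linearB/= !trmx_mul trmxK.
rewrite mulmxBl !mulmxBr.
rewrite !mulmxA -(mulmxA _ Q^T Q) QQ mulmx1 subrr subr0.
by rewrite mxE [X in _ + X]mxE subr_ge0.
Qed.

Lemma noise_form_sumsq (R : realType) (n r : nat) (Pm : 'M[R]_(n, r)) (lam : 'rV[R]_r)
    (rho L : R) (c : 'rV[R]_r) :
  Pm^T *m Pm = 1%:M -> 0 < rho -> 0 < L -> (forall k, L <= lam 0 k) ->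
  \sum_l noise_form _ _ _ Pm lam rho c 0 l ^+ 2 <= (\sum_k c 0 k ^+ 2) / L ^+ 2.
Proof.
move=> PP rho0 L0 Ll.
have -> : \sum_l noise_form _ _ _ Pm lam rho c 0 l ^+ 2 =
    \sum_k (c *m diag_mx (shrink_row _ _ lam rho)) 0 k ^+ 2.
  have := @sumsq_isometry _ _ _ Pm (c *m diag_mx (shrink_row _ _ lam rho))^T PP.
  under [X in _ = X -> _]eq_bigr do rewrite mxE.
  move=> <-; apply: eq_bigr => l _.
  by rewrite -[Pm]trmxK -trmx_mul trmxK [in RHS]mxE.
rewrite mulr_suml; apply: ler_sum => k _.
rewrite mul_mx_diag !mxE exprMn ler_wpM2l ?sqr_ge0//.
have l0 : 0 < lam 0 k by exact: lt_le_trans (Ll k).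
have := Ll k; move: (lam 0 k) l0 => l l0 Lk.
have g0 : 0 < l ^+ 2 + rho by rewrite ltr_wpDl// sqr_ge0.
(* lam^2 (lam^2 + 2 rho) <= (lam^2 + rho)^2, so the noise factor never exceeds 1 / lam. *)
have d1 : l * (l ^+ 2 + 2 * rho) / (l ^+ 2 + rho) ^+ 2 <= L^-1.
  rewrite (@le_trans _ _ l^-1)// ?lef_pV2//.
  rewrite ler_pdivrMr ?exprn_gt0// [leRHS]mulrC ler_pdivlMr// sqrrD.
  have := sqr_ge0 rho; rewrite !expr2; nra.
have d0 : 0 <= l * (l ^+ 2 + 2 * rho) / (l ^+ 2 + rho) ^+ 2.
  rewrite divr_ge0 ?sqr_ge0// mulr_ge0 ?ltW// addr_gt0 ?exprn_gt0//; lra.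
have -> : L ^- 2 = L^-1 ^+ 2 by rewrite exprVn.
by apply: lerXn2r => //; rewrite nnegrE// invr_ge0 ltW.
Qed.

Lemma bias_form_le (R : realType) (p r : nat) (Q : 'M[R]_(p, r)) (lam : 'rV[R]_r)
    (rho L : R) (c : 'rV[R]_r) (v : 'cV[R]_p) :
  0 < rho -> 0 < L -> (forall k, L <= lam 0 k) ->
  ((c *m (diag_mx (bias_row _ _ lam rho) *m Q^T *m v)) 0 0) ^+ 2 <=
  (\sum_k c 0 k ^+ 2) * (((rho / L ^+ 2) ^+ 2) ^+ 2 * \sum_k (Q^T *m v) k 0 ^+ 2).
Proof.
move=> rho0 L0 Ll; apply: (le_trans (cauchy_schwarz_mx _ _ _ _)).
apply: ler_wpM2l; first by apply: sumr_ge0 => k _; exact: sqr_ge0.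
rewrite mulr_sumr -mulmxA; apply: ler_sum => k _.
rewrite mul_diag_mx !mxE exprMn ler_wpM2r ?sqr_ge0//.
have l0 : 0 < lam 0 k by exact: lt_le_trans (Ll k).
have := Ll k; move: (lam 0 k) l0 => l l0 Lk.
have g0 : 0 < l ^+ 2 + rho by rewrite ltr_wpDl// sqr_ge0.
have h : rho / (l ^+ 2 + rho) <= rho / L ^+ 2.
  rewrite ler_pM2l// lef_pV2 ?posrE ?exprn_gt0//.
  rewrite (@le_trans _ _ (l ^+ 2))// ?lerDl ?(ltW rho0)//.
  by apply: lerXn2r => //; rewrite nnegrE ltW.
have h0 : 0 <= rho / (l ^+ 2 + rho) by rewrite divr_ge0 ?ltW.
have h1 : 0 <= rho / L ^+ 2 by rewrite divr_ge0 ?exprn_ge0 ?ltW.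
by do 2 (apply: lerXn2r; rewrite ?nnegrE ?sqr_ge0//).
Qed.

Lemma design_sumsq_le (R : realType) (n p r : nat) (X : 'M[R]_(n, p)) (Pm : 'M[R]_(n, r))
    (Q : 'M[R]_(p, r)) (lam : 'rV[R]_r) (U : R) (v : 'cV[R]_p) :
  X = Pm *m diag_mx lam *m Q^T -> Pm^T *m Pm = 1%:M -> Q^T *m Q = 1%:M ->
  (forall k, 0 < lam 0 k) -> (forall k, lam 0 k <= U) ->
  \sum_i (X *m v) i 0 ^+ 2 <= U ^+ 2 * \sum_j v j 0 ^+ 2.
Proof.
move=> -> PP QQ lam0 lamU.
rewrite -!mulmxA sumsq_isometry//.
apply: (@le_trans _ _ (U ^+ 2 * \sum_k (Q^T *m v) k 0 ^+ 2)).
  rewrite mulr_sumr; apply: ler_sum => k _.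
  rewrite mul_diag_mx mxE exprMn ler_wpM2r ?sqr_ge0//.
  have := lam0 k; have := lamU k => h1 h0.
  by apply: lerXn2r => //; rewrite nnegrE ?(ltW h0)// (le_trans (ltW h0)).
by rewrite ler_wpM2l ?sqr_ge0// sumsq_contraction.
Qed.

Lemma row_sumsq_le1 (R : realType) (p r : nat) (Q : 'M[R]_(p, r)) (Qp : 'M[R]_(p, p - r))
    (j : 'I_p) :
  Q *m Q^T + Qp *m Qp^T = 1%:M -> \sum_k Q j k ^+ 2 <= 1.
Proof.
move=> /matrixP/(_ j j); rewrite !mxE eqxx mulr1n => <-.
under [X in X + _]eq_bigr do rewrite mxE -expr2.
rewrite lerDl; apply: sumr_ge0 => k _; rewrite mxE -expr2; exact: sqr_ge0.
Qed.

(** * Distribution functions and empirical distribution functions *)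

Lemma fine_prob_le d (T : measurableType d) (R : realType) (P : probability T R)
    (A B : set T) : measurable A -> measurable B -> A `<=` B ->
  fine (P A) <= fine (P B).
Proof.
move=> mA mB AB; apply: fine_le; rewrite ?fin_num_measure//.
by apply: le_measure; rewrite ?inE.
Qed.

Lemma fine_prob_ge0 d (T : measurableType d) (R : realType) (P : probability T R)
    (A : set T) : 0 <= fine (P A).
Proof. exact: fine_ge0. Qed.

Lemma fine_prob_le1 d (T : measurableType d) (R : realType) (P : probability T R)
    (A : set T) : measurable A -> fine (P A) <= 1.
Proof.
move=> mA; rewrite -[leRHS]/(fine 1%E); apply: fine_le; rewrite ?fin_num_measure//.
exact: probability_le1.
Qed.

Lemma fine_prob_leU d (T : measurableType d) (R : realType) (P : probability T R)
    (A B C : set T) : measurable A -> measurable B -> measurable C ->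
  A `<=` B `|` C -> fine (P A) <= fine (P B) + fine (P C).
Proof.
move=> mA mB mC AB.
apply: (@le_trans _ _ (fine (P (B `|` C)))).
  by apply: fine_prob_le => //; exact: measurableU.
rewrite -fineD ?fin_num_measure//; apply: fine_le.
- by rewrite fin_num_measure//; exact: measurableU.
- by rewrite fin_numD !fin_num_measure.
- exact: measureU2.
Qed.

Lemma fine_probD d (T : measurableType d) (R : realType) (P : probability T R)
    (A B : set T) : measurable A -> measurable B -> B `<=` A ->
  fine (P (A `\` B)) = fine (P A) - fine (P B).
Proof.
move=> mA mB BA.
rewrite -fineB ?fin_num_measure//; congr fine.
by rewrite measureD ?(setIidr BA)// ltey_eq fin_num_measure.
Qed.

(** Telescoping, one factor at a time; since all factors lie in [0, 1] the errors add up. *)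
Lemma prod_sub_exp_le (R : realType) (k : nat) (a : 'I_k -> R) (c e : R) :
  0 <= c <= 1 -> (forall i, 0 <= a i <= 1) -> (forall i, `|a i - c| <= e) ->
  `|\prod_i a i - c ^+ k| <= k%:R * e.
Proof.
move=> /andP[c0 c1]; elim: k a => [|k IH] a ha hc.
  by rewrite big_ord0 expr0 subrr normr0 mul0r.
rewrite big_ord_recl exprS.
set p := \prod_(i < k) _.
have hp : `|p - c ^+ k| <= k%:R * e by apply: IH => i; [exact: ha|exact: hc].
have -> : a ord0 * p - c * c ^+ k = a ord0 * (p - c ^+ k) + (a ord0 - c) * c ^+ k by ring.
apply: (le_trans (ler_normD _ _)); rewrite !normrM -natr1 mulrDl mul1r.
have /andP[a0 a1] := ha ord0.
apply: lerD.
  by rewrite (ger0_norm a0) (le_trans _ hp)// ler_piMl.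
rewrite (le_trans _ (hc ord0))// ler_piMr// ger0_norm ?exprn_ge0//.
exact: exprn_ile1.
Qed.

(* A finite grid of points at which the law of large numbers is applied; the
   disjunctions replace grid points at infinity. *)
Lemma cdf_grid (R : realType) (F : R -> R) (e : R) :
  {homo F : x y / x <= y} -> continuous F -> (forall x, 0 <= F x <= 1) ->
  (forall d, 0 < d -> exists x, F x <= d) ->
  (forall d, 0 < d -> exists x, 1 - d <= F x) -> 0 < e ->
  exists s : seq R, forall x,
    (1 <= F x + e \/ exists2 u, u \in s & x <= u /\ F u <= F x + e) /\
    (F x <= e \/ exists2 l, l \in s & l <= x /\ F x <= F l + e).
Proof.
move=> Fm Fc F01 F0 F1 e0.
(* The lower neighbour chosen below may lie two levels down, hence a mesh 1/K with 2/K <= e. *)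
pose K := (Num.bound (2 / e)).+1.
have K0 : 0 < K%:R :> R by rewrite ltr0n.
have Ke : 2 / K%:R <= e.
  rewrite ler_pdivrMr// mulrC -ler_pdivrMr// ltW//.
  have := archi_boundP (ltW (divr_gt0 (ltr0n R 2) e0)) => h.
  by apply: (lt_le_trans h); rewrite ler_nat.
have ex k : exists x, (0 < k < K)%N -> F x = k%:R / K%:R.
  have [/andP[k0 kK]|_] := boolP (0 < k < K)%N; last by exists 0.
  have kK0 : 0 < k%:R / K%:R :> R by rewrite divr_gt0// ltr0n.
  have [a Fa] := F0 _ kK0.
  have kK1 : 0 < 1 - k%:R / K%:R :> R by rewrite subr_gt0 ltr_pdivrMr// mul1r ltr_nat.
  have [b] := F1 _ kK1; rewrite opprB addrCA subrr addr0 => Fb.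
  have ab : a <= Num.max a b by rewrite le_max lexx.
  have Fb' : k%:R / K%:R <= F (Num.max a b).
    by rewrite (le_trans Fb)// Fm// le_max lexx orbT.
  have cw : {within `[a, Num.max a b], continuous F} by exact: continuous_subspaceT.
  have [|c _ Fce] := IVT ab cw (v := k%:R / K%:R); last by exists c.
  by rewrite ge_min Fa/= le_max Fb' orbT.
pose xs k := projT1 (cid (ex k)).
have xsP k : (0 < k < K)%N -> F (xs k) = k%:R / K%:R := projT2 (cid (ex k)).
exists (map xs (iota 0 K)) => x.
have /andP[Fx0 Fx1] := F01 x.
pose t := Num.truncn (K%:R * F x).
have KF0 : 0 <= K%:R * F x by rewrite mulr_ge0// ltW.
have /andP[t1 t2] : t%:R <= K%:R * F x < t.+1%:R.
  by rewrite /t truncn_le//= KF0 truncnS_gt.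
have invK : 0 < K%:R^-1 :> R by rewrite invr_gt0.
have FK : F x = K%:R * F x / K%:R by rewrite mulrAC divff ?mul1r// gt_eqF.
have tF : t%:R / K%:R <= F x by rewrite ler_pdivrMr// mulrC.
have tF2 : F x < t.+1%:R / K%:R by rewrite ltr_pdivlMr// mulrC.
have S1 : t.+1%:R / K%:R = t%:R / K%:R + K%:R^-1 :> R by rewrite -natr1 mulrDl mul1r.
have Ke1 : K%:R^-1 <= e by rewrite (le_trans _ Ke)// ler_pMl// ler1n.
split.
  have [tK|tK] := ltnP t.+1 K; last first.
    left; have : 1 <= t.+1%:R / K%:R :> R by rewrite ler_pdivlMr// mul1r ler_nat.
    by rewrite S1; move: tF Ke1; lra.
  right; exists (xs t.+1); first by apply: map_f; rewrite mem_iota add0n.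
  have E := xsP t.+1 tK; rewrite E S1; split; last lra.
  by rewrite leNgt; apply/negP => /ltW/Fm; rewrite E leNgt tF2.
(* Level [t - 1] rather than [t]: [F] may be flat, and only a strict inequality between values of
   [F] yields [l <= x]. *)
case: t t1 t2 tF tF2 S1 => [|[|t]] t1 t2 tF tF2 S1.
- by left; rewrite (le_trans (ltW tF2))//; move: Ke1; rewrite mul1r.
- by left; rewrite (le_trans (ltW tF2)).
right; exists (xs t.+1).
  apply: map_f; rewrite mem_iota add0n.
  have : t.+2%:R <= K%:R :> R by rewrite (le_trans t1)// ler_piMr// ltW.
  by rewrite ler_nat.
have tK : (0 < t.+1 < K)%N.
  have : t.+2%:R <= K%:R :> R by rewrite (le_trans t1)// ler_piMr// ltW.
  by rewrite ler_nat.
have E := xsP _ tK; rewrite E.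
have S0 : t.+2%:R / K%:R = t.+1%:R / K%:R + K%:R^-1 :> R by rewrite -natr1 mulrDl mul1r.
have K2 : 2 / K%:R = K%:R^-1 + K%:R^-1 :> R by rewrite mulrDl mul1r.
split; last lra.
rewrite leNgt; apply/negP => /ltW/Fm; rewrite E; lra.
Qed.

(** If [u] is a grid point above [x] and [y <= x + t], then [F y <= F (u + t)] by monotonicity; so
    one radius for the finitely many grid points is enough. *)
Lemma cdf_unif_continuous (R : realType) (F : R -> R) (e : R) :
  {homo F : x y / x <= y} -> continuous F -> (forall x, 0 <= F x <= 1) ->
  (forall d, 0 < d -> exists x, F x <= d) ->
  (forall d, 0 < d -> exists x, 1 - d <= F x) -> 0 < e ->
  exists2 t, 0 < t & forall x y, `|x - y| <= t -> `|F x - F y| <= e.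
Proof.
move=> Fm Fc F01 F0 F1 e0.
have e2 : 0 < e / 2 by rewrite divr_gt0.
have [s sP] := @cdf_grid _ F _ Fm Fc F01 F0 F1 e2.
have [t t0 tP] : exists2 t, 0 < t & forall u, u \in s -> F (u + t) <= F u + e / 2.
  elim: s {sP} => [|u s [t t0 tP]]; first by exists 1.
  have /cvgrPdist_le/(_ _ e2) := Fc u.
  rewrite -nbhs_ballE => -[r /= r0 rP].
  exists (Num.min t (r / 2)); first by rewrite lt_min t0 divr_gt0.
  move=> v; rewrite inE => /orP[/eqP ->|/tP h]; last first.
    by rewrite (le_trans _ h)// Fm// lerD2l ge_min lexx.
  have m0 : 0 <= Num.min t (r / 2) by rewrite le_min !ltW// divr_gt0.
  have : `|F u - F (u + Num.min t (r / 2))| <= e / 2.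
    apply: rP; rewrite /ball/= opprD addrA subrr sub0r normrN ger0_norm//.
    by rewrite gt_min; apply/orP; right; rewrite ltr_pdivrMr// ltr_pMr// ltr1n.
  by rewrite ler_norml => /andP[+ _]; lra.
have up x y : x <= y -> y <= x + t -> F y <= F x + e.
  move=> xy yx; have [[h|[u us [xu Fu]]] _] := sP x.
    by have /andP[_ Fy] := F01 y; lra.
  have h1 := tP u us.
  have h2 : F y <= F (u + t) by apply: Fm; rewrite (le_trans yx)// lerD2r.
  lra.
exists t => // x y; rewrite ler_norml => /andP[h1 h2].
have [xy|yx] := leP x y.
  by have := Fm _ _ xy; have := up _ _ xy; rewrite ler_norml => h h'; lra.
by have := Fm _ _ (ltW yx); have := up _ _ (ltW yx); rewrite ler_norml => h h'; lra.
Qed.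

Lemma Fhat_le1 (R : realType) (n : nat) (e : 'cV[R]_n) (x : R) : 0 <= Fhat e x <= 1.
Proof.
rewrite /Fhat mulr_ge0 ?invr_ge0 ?sumr_ge0//=.
case: n e => [|n] e; first by rewrite big_ord0 mulr0.
rewrite mulrC ler_pdivrMr ?ltr0n// mul1r -[n.+1 in leRHS]card_ord -sumr_const.
by apply: ler_sum => i _; rewrite lern1 leq_b1.
Qed.

Lemma Fhat_homo (R : realType) (n : nat) (e : 'cV[R]_n) : {homo Fhat e : x y / x <= y}.
Proof.
move=> x y xy; rewrite /Fhat ler_wpM2l ?invr_ge0//.
apply: ler_sum => i _; rewrite ler_nat; case: (leP (e i 0) x) => // ex.
by rewrite (le_trans ex xy).
Qed.

(** Sandwich [Fhat v x] between its values at the grid neighbours; a missing neighbour means that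
    [F x] is within [e] of 0 or 1. *)
Lemma glivenko_grid (R : realType) (n : nat) (v : 'cV[R]_n) (F : R -> R) (s : seq R) (e : R) :
  (forall x, 0 <= F x <= 1) -> 0 <= e ->
  (forall x,
    (1 <= F x + e \/ exists2 u, u \in s & x <= u /\ F u <= F x + e) /\
    (F x <= e \/ exists2 l, l \in s & l <= x /\ F x <= F l + e)) ->
  (forall u, u \in s -> `|Fhat v u - F u| <= e) ->
  forall x, `|Fhat v x - F x| <= 2 * e.
Proof.
move=> F01 e0 sP sF x; have [h1 h2] := sP x.
have /andP[Fx0 Fx1] := F01 x; have /andP[Hx0 Hx1] := Fhat_le1 _ _ v x.
rewrite ler_norml; apply/andP; split.
  case: h2 => [h|[l ls [lx Fl]]]; first lra.
  have := sF _ ls; rewrite ler_norml => /andP[k1 k2].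
  have := Fhat_homo _ _ v _ _ lx; lra.
case: h1 => [h|[u us [xu Fu]]]; first lra.
have := sF _ us; rewrite ler_norml => /andP[k1 k2].
have := Fhat_homo _ _ v _ _ xu; lra.
Qed.

(* By Chebyshev, at most a fraction k / t^2 of the entries moves by more than t. *)
Lemma Fhat_perturb (R : realType) (n : nat) (v v' : 'cV[R]_n) (F : R -> R) (t e k : R) :
  0 < t -> (forall x y, `|x - y| <= t -> `|F x - F y| <= e) ->
  (forall x, `|Fhat v x - F x| <= 2 * e) ->
  n%:R^-1 * \sum_i (v' i 0 - v i 0) ^+ 2 <= k ->
  forall x, `|Fhat v' x - F x| <= 3 * e + k / t ^+ 2.
Proof.
move=> t0 Ft Fv kP x.
have t20 : 0 < t ^+ 2 by rewrite exprn_gt0.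
have gen (a b : 'cV[R]_n) z : n%:R^-1 * \sum_i (a i 0 - b i 0) ^+ 2 <= k ->
    Fhat a z <= Fhat b (z + t) + k / t ^+ 2.
  move=> abk; apply: (@le_trans _ _ (Fhat b (z + t) + n%:R^-1 * \sum_i (a i 0 - b i 0) ^+ 2 / t ^+ 2)).
    rewrite /Fhat -mulrDr -big_split/= ler_wpM2l ?invr_ge0//.
    apply: ler_sum => i _.
    have q0 : 0 <= (a i 0 - b i 0) ^+ 2 / t ^+ 2 by rewrite divr_ge0 ?sqr_ge0.
    case: (leP (a i 0) z) => [az|_]; last by rewrite addr_ge0.
    case: (leP (b i 0) (z + t)) => [_|bz]; first by rewrite lerDl.
    rewrite add0r ler_pdivlMr// mul1r -[leRHS]sqrrN.
    by apply: lerXn2r; rewrite ?nnegrE; lra.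
  by rewrite lerD2l -mulr_suml mulrA ler_pM2r ?invr_gt0.
have kP' : n%:R^-1 * \sum_i (v i 0 - v' i 0) ^+ 2 <= k.
  rewrite (le_trans _ kP)// le_eqVlt; apply/orP; left; apply/eqP; congr (_ * _).
  by apply: eq_bigr => i _; rewrite -sqrrN opprB.
have h1 := gen v' v x kP.
have h2 := gen v v' (x - t) kP'; rewrite subrK in h2.
have := Fv (x + t); rewrite ler_norml => /andP[_ k1].
have := Fv (x - t); rewrite ler_norml => /andP[k2 _].
have : `|F (x + t) - F x| <= e by apply: Ft; rewrite addrAC subrr add0r gtr0_norm.
rewrite ler_norml => /andP[_ k3].
have : `|F (x - t) - F x| <= e.
  by apply: Ft; rewrite addrAC subrr add0r normrN gtr0_norm.
rewrite ler_norml => /andP[k4 _].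
rewrite ler_norml; apply/andP; split; lra.
Qed.

(* Outside 0 < v <= 1 the set defining the quantile is empty or unbounded below,
   and [inf] takes a junk value. *)
Lemma Fhat_quantile_le (R : realType) (n : nat) (e : 'cV[R]_n) (v x : R) :
  (0 < n)%N -> 0 < v <= 1 -> (Fhat_quantile e v <= x) = (v <= Fhat e x).
Proof.
move=> n0 /andP[v0 v1].
have n0R : 0 < n%:R :> R by rewrite ltr0n.
pose M := \sum_i `|e i 0|.
have eM i : `|e i 0| <= M.
  by rewrite /M (bigD1 i)//= lerDl; apply: sumr_ge0.
have FM : v <= Fhat e M.
  rewrite (le_trans v1)// /Fhat.
  rewrite (eq_bigr (fun=> 1)) => [|i _]; last by rewrite (le_trans (ler_norm _) (eM i)).
  by rewrite sumr_const card_ord mulVf// gt_eqF.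
have lb z : v <= Fhat e z -> - M <= z.
  move=> vz; rewrite leNgt; apply/negP => zM; move: vz; rewrite leNgt => /negP; apply.
  rewrite /Fhat big1 ?mulr0// => i _; case: leP => // ez.
  have : - M <= e i 0 by have := eM i; rewrite ler_norml => /andP[].
  by move=> /le_lt_trans /(_ (le_lt_trans ez zM)); rewrite ltxx.
have hlb : has_lbound [set z | v <= Fhat e z] by exists (- M) => z; exact: lb.
apply/idP/idP; last by move=> vx; exact: ge_inf.
move=> qx; rewrite leNgt; apply/negP => Fxv.
(* The least entry above [x], or at most [x + 1] if none is smaller. [Fhat] is constant from [x] up
   to [g], so the quantile cannot fall below [g]. *)
pose g := \big[Num.min/x + 1]_(i | x < e i 0) e i 0.
have gx : x < g.
  rewrite /g; elim/big_rec : _ => [|i y xe xy]; first by rewrite ltrDl.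
  by rewrite lt_min xe.
have gP i : x < e i 0 -> g <= e i 0.
  by move=> xe; rewrite /g (bigD1 i)//= ge_min lexx.
have : g <= Fhat_quantile e v.
  apply: lb_le_inf; first by exists M.
  move=> z /= vz; rewrite leNgt; apply/negP => zg.
  have : Fhat e z <= Fhat e x.
    rewrite /Fhat ler_wpM2l ?invr_ge0//; apply: ler_sum => i _; rewrite ler_nat.
    case: (leP (e i 0) z) => // ez; case: leP => // xe.
    by have := le_lt_trans (le_trans (gP i xe) ez) zg; rewrite ltxx.
  by move=> h; have := le_lt_trans (le_trans vz h) Fxv; rewrite ltxx.
by move=> /(lt_le_trans gx)/lt_le_trans/(_ qx); rewrite ltxx.
Qed.

(* Neither A nor B has to be continuous at its quantile: only their common
   approximation G is. *)
Lemma quantile_level (R : realType) (A B G : R -> R) (a t e : R) :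
  0 < t -> (forall x, `|A x - G x| <= e) -> (forall x, `|B x - G x| <= e) ->
  (forall x y, `|x - y| <= t -> `|G x - G y| <= e) ->
  [set x | a <= A x] !=set0 -> has_lbound [set x | a <= A x] ->
  `|B (inf [set x | a <= A x]) - a| <= 3 * e.
Proof.
move=> t0 hA hB hG S0 Slb; set c := inf _.
have [x /= ax xc] : exists2 x, [set x | a <= A x] x & x < c + t.
  by apply: inf_lt; rewrite ?ltrDl//; split.
have cx : c <= x by exact: ge_inf.
(* [A] crosses the level [a] between [c - t] and a point below [c + t], so [G c] is within [2 * e]
   of [a]; the third [e] is the distance from [B] to [G]. *)
have Act : A (c - t) < a.
  rewrite ltNge; apply/negP => h.
  by have := ge_inf Slb h; rewrite -/c lerBrDr gerDl leNgt t0.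
have := hA x; have := hA (c - t); have := hB c.
have : `|G x - G c| <= e by apply: hG; rewrite ger0_norm; lra.
have : `|G (c - t) - G c| <= e.
  by apply: hG; rewrite addrAC subrr add0r normrN gtr0_norm.
rewrite !ler_norml => /andP[a1 a2] /andP[b1 b2] /andP[c1 c2] /andP[d1 d2] /andP[f1 f2].
by apply/andP; split; lra.
Qed.

(** * Measurability of the prediction errors *)

Lemma measurable_set_le d (T : measurableType d) (R : realType) (f g : T -> R) :
  measurable_fun setT f -> measurable_fun setT g -> measurable [set w | f w <= g w].
Proof.
move=> mf mg; have := measurable_fun_ler mf mg.
by move=> /(_ measurableT [set true]); rewrite setTI; exact.
Qed.

Lemma measurable_set_lt d (T : measurableType d) (R : realType) (f g : T -> R) :
  measurable_fun setT f -> measurable_fun setT g -> measurable [set w | f w < g w].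
Proof.
move=> mf mg; have := measurable_fun_ltr mf mg.
by move=> /(_ measurableT [set true]); rewrite setTI; exact.
Qed.

Lemma measurable_fun_set_le d (T : measurableType d) (R : realType) (f : T -> R) :
  (forall x, measurable [set w | f w <= x]) -> measurable_fun setT f.
Proof.
move=> mf; apply: (measurability _ (RGenOInfty.measurableE R)) => //.
move=> _ [_ [a ->] <-]; rewrite preimage_itvoy setTI.
have -> : [set w | a < f w] = ~` [set w | f w <= a].
  by apply/seteqP; split => w /=; rewrite ltNge => /negP.
exact: measurableC.
Qed.

Definition entrywise_measurable d (T : measurableType d) (R : realType) (m n : nat)
  (f : T -> 'M[R]_(m, n)) : Prop := forall i j, measurable_fun setT (fun w => f w i j).

Lemma entrywise_cst d (T : measurableType d) (R : realType) (m n : nat) (A : 'M[R]_(m, n)) :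
  @entrywise_measurable d T R m n (fun=> A).
Proof. by move=> i j; exact: measurable_cst. Qed.

Lemma entrywiseD d (T : measurableType d) (R : realType) (m n : nat)
    (f g : T -> 'M[R]_(m, n)) :
  entrywise_measurable _ _ _ _ _ f -> entrywise_measurable _ _ _ _ _ g ->
  entrywise_measurable _ _ _ _ _ (fun w => f w + g w).
Proof.
move=> mf mg i j; under eq_fun do rewrite mxE.
exact: (measurable_funD (mf i j) (mg i j)).
Qed.

Lemma entrywiseN d (T : measurableType d) (R : realType) (m n : nat)
    (f : T -> 'M[R]_(m, n)) :
  entrywise_measurable _ _ _ _ _ f -> entrywise_measurable _ _ _ _ _ (fun w => - f w).
Proof.
move=> mf i j; under eq_fun do rewrite mxE.
exact: (measurable_funN (mf i j)).
Qed.

Lemma entrywiseM d (T : measurableType d) (R : realType) (m n k : nat)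
    (f : T -> 'M[R]_(m, n)) (g : T -> 'M[R]_(n, k)) :
  entrywise_measurable _ _ _ _ _ f -> entrywise_measurable _ _ _ _ _ g ->
  entrywise_measurable _ _ _ _ _ (fun w => f w *m g w).
Proof.
move=> mf mg i j; under eq_fun do rewrite mxE.
by apply: measurable_sum => l; exact: (measurable_funM (mf i l) (mg l j)).
Qed.

Lemma entrywiseZ d (T : measurableType d) (R : realType) (m n : nat)
    (a : T -> R) (f : T -> 'M[R]_(m, n)) :
  measurable_fun setT a -> entrywise_measurable _ _ _ _ _ f ->
  entrywise_measurable _ _ _ _ _ (fun w => a w *: f w).
Proof.
move=> ma mf i j; under eq_fun do rewrite mxE.
exact: (measurable_funM ma (mf i j)).
Qed.

Lemma entrywise_col d (T : measurableType d) (R : realType) (m : nat)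
    (f : 'I_m -> T -> R) :
  (forall i, measurable_fun setT (f i)) ->
  entrywise_measurable _ _ _ _ _ (fun w => \col_i f i w).
Proof. by move=> mf i j; under eq_fun do rewrite mxE; exact: mf. Qed.

Lemma measurable_colmaxabs d (T : measurableType d) (R : realType) (k : nat)
    (f : T -> 'cV[R]_k) :
  entrywise_measurable _ _ _ _ _ f -> measurable_fun setT (fun w => colmaxabs (f w)).
Proof.
move=> mf; rewrite /colmaxabs.
elim: (index_enum _) => [|i s IH].
  by under eq_fun do rewrite big_nil; exact: measurable_cst.
under eq_fun do rewrite big_cons.
apply: measurable_maxr => //; apply: (measurableT_comp (@normr_measurable R setT)).
exact: mf.
Qed.

Lemma entrywise_hard_threshold d (T : measurableType d) (R : realType) (k : nat)
    (b : R) (f : T -> 'cV[R]_k) :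
  entrywise_measurable _ _ _ _ _ f ->
  entrywise_measurable _ _ _ _ _ (fun w => hard_threshold b (f w)).
Proof.
move=> mf i j; under eq_fun do rewrite mxE.
apply: measurable_fun_ifT => //; apply: measurable_fun_ltr => //.
exact: (measurableT_comp (@normr_measurable R setT) (mf i 0)).
Qed.

Lemma entrywise_ridge_debiased d (T : measurableType d) (R : realType) (n p r : nat)
    (X : 'M[R]_(n, p)) (Q : 'M[R]_(p, r)) (lam : 'rV[R]_r) (rho : R) (y : T -> 'cV[R]_n) :
  entrywise_measurable _ _ _ _ _ y ->
  entrywise_measurable _ _ _ _ _ (fun w => ridge_debiased X Q lam rho (y w)).
Proof.
move=> my.
have mts : entrywise_measurable _ _ _ _ _ (fun w => ridge_star X rho (y w)).
  by apply: entrywiseM => //; exact: entrywise_cst.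
apply: entrywiseD => //; apply: entrywiseZ; first exact: measurable_cst.
by apply: entrywiseM => //; exact: entrywise_cst.
Qed.

Lemma entrywise_theta_hat d (T : measurableType d) (R : realType) (n p r : nat)
    (X : 'M[R]_(n, p)) (Q : 'M[R]_(p, r)) (lam : 'rV[R]_r) (rho b : R) (y : T -> 'cV[R]_n) :
  entrywise_measurable _ _ _ _ _ y ->
  entrywise_measurable _ _ _ _ _ (fun w => theta_hat X Q lam rho b (y w)).
Proof. by move=> my; exact/entrywise_hard_threshold/entrywise_ridge_debiased. Qed.

Lemma entrywise_centered_resid d (T : measurableType d) (R : realType) (n p : nat)
    (X : 'M[R]_(n, p)) (th : T -> 'cV[R]_p) (y : T -> 'cV[R]_n) :
  entrywise_measurable _ _ _ _ _ th -> entrywise_measurable _ _ _ _ _ y ->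
  entrywise_measurable _ _ _ _ _ (fun w => centered_resid X (th w) (y w)).
Proof.
move=> mth my.
have me : entrywise_measurable _ _ _ _ _ (fun w => y w - X *m th w).
  apply: entrywiseD => //; apply: entrywiseN; apply: entrywiseM => //.
apply: entrywise_col => i; apply: measurable_funB; first exact: me.
apply: measurable_funM; first exact: measurable_cst.
by apply: measurable_sum => j; exact: me.
Qed.

Lemma measurable_sigma_hat2 d (T : measurableType d) (R : realType) (n p : nat)
    (X : 'M[R]_(n, p)) (th : T -> 'cV[R]_p) (y : T -> 'cV[R]_n) :
  entrywise_measurable _ _ _ _ _ th -> entrywise_measurable _ _ _ _ _ y ->
  measurable_fun setT (fun w => sigma_hat2 X (th w) (y w)).
Proof.
move=> mth my; apply: measurable_funM; first exact: measurable_cst.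
apply: measurable_sum => i; apply: measurable_funX; apply: measurable_funB => //.
by apply: entrywiseM => //; exact: entrywise_cst.
Qed.

Lemma measurable_Fhat d (T : measurableType d) (R : realType) (n : nat)
    (e : T -> 'cV[R]_n) (x : T -> R) :
  entrywise_measurable _ _ _ _ _ e -> measurable_fun setT x ->
  measurable_fun setT (fun w => Fhat (e w) (x w)).
Proof.
move=> me mx; apply: measurable_funM; first exact: measurable_cst.
apply: measurable_sum => i.
have -> : (fun w => (e w i 0 <= x w)%R%:R : R) = \1_[set w | e w i 0 <= x w].
  by apply/funext => w; rewrite indicE mem_setE.
apply: measurable_indic; exact: measurable_set_le.
Qed.

Lemma Fhat_quantile_out (R : realType) (n : nat) (e : 'cV[R]_n) (v : R) :
  ~~ (0 < v <= 1) -> Fhat_quantile e v = 0.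
Proof.
move=> v01; rewrite /Fhat_quantile.
have [v0|v0] := leP v 0.
  have -> : [set x | v <= Fhat e x] = setT.
    apply/seteqP; split => // x _ /=; rewrite (le_trans v0)//.
    by have /andP[] := Fhat_le1 _ _ e x.
  by apply: inf_out => -[_ [l /(_ (l - 1) I)]]; rewrite lerBrDl gerDr leNgt ltr01.
have -> : [set x | v <= Fhat e x] = set0; last exact: inf0.
apply/seteqP; split => // x /= h; move: v01; rewrite v0/= => /negP; apply.
by rewrite (le_trans h)//; have /andP[] := Fhat_le1 _ _ e x.
Qed.

(** On 0 < v <= 1 the Galois connection with [Fhat] turns sublevel sets into comparisons of
    measurable functions; elsewhere the quantile is the constant junk value 0. *)
Lemma measurable_Fhat_quantile d (T : measurableType d) (R : realType) (n : nat)
    (e : T -> 'cV[R]_n) (v : T -> R) : (0 < n)%N ->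
  entrywise_measurable _ _ _ _ _ e -> measurable_fun setT v ->
  measurable_fun setT (fun w => Fhat_quantile (e w) (v w)).
Proof.
move=> n0 me mv; apply: measurable_fun_set_le => x.
pose I01 := [set w | 0 < v w] `&` [set w | v w <= 1].
have mI : measurable I01.
  by apply: measurableI; [apply: measurable_set_lt|apply: measurable_set_le] => //; exact: measurable_cst.
have -> : [set w | Fhat_quantile (e w) (v w) <= x] =
   (I01 `&` [set w | v w <= Fhat (e w) x]) `|` (~` I01 `&` [set w | 0 <= x]).
  apply/seteqP; split => w /=.
    have [h|h] := boolP (0 < v w <= 1).
      by rewrite (Fhat_quantile_le _ _ _ _ _ n0 h) => ?; left; split => //; move/andP: h.
    rewrite (Fhat_quantile_out _ _ _ _ h) => x0; right; split => // -[h1 h2].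
    by move: h; rewrite h1 h2.
  move=> [[[h1 h2] h3]|[h1 x0]].
    by rewrite (Fhat_quantile_le _ _ _ _ _ n0)// h1 h2.
  rewrite Fhat_quantile_out//; apply/negP => /andP[h2 h3]; exact: h1.
apply: measurableU; apply: measurableI => //.
- by apply: measurable_set_le => //; apply: measurable_Fhat => //; exact: measurable_cst.
- exact: measurableC.
- by apply: measurable_set_le; exact: measurable_cst.
Qed.

Lemma entrywise_boot_pred_err d (T : measurableType d) (R : realType) (n p p1 r : nat)
    (X : 'M[R]_(n, p)) (Xf : 'M[R]_(p1, p)) (Q : 'M[R]_(p, r)) (lam : 'rV[R]_r)
    (Qp : 'M[R]_(p, p - r)) (rho b : R) (y z : T -> 'cV[R]_n) (v : T -> 'cV[R]_p1) :
  (0 < n)%N -> entrywise_measurable _ _ _ _ _ y -> entrywise_measurable _ _ _ _ _ z ->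
  entrywise_measurable _ _ _ _ _ v ->
  entrywise_measurable _ _ _ _ _
    (fun w => boot_pred_err X Xf Q lam Qp rho b (y w) (z w) (v w)).
Proof.
move=> n0 my mz mv; rewrite /boot_pred_err.
have mth : entrywise_measurable _ _ _ _ _ (fun w => theta_hat X Q lam rho b (y w)).
  exact: entrywise_theta_hat.
have mM m k (A : 'M[R]_(m, k)) (f : T -> 'cV[R]_k) : entrywise_measurable _ _ _ _ _ f ->
    entrywise_measurable _ _ _ _ _ (fun w => A *m f w).
  by move=> mf; apply: entrywiseM => //; exact: entrywise_cst.
apply: entrywiseD.
  apply: entrywiseD; first exact: mM.
  apply: entrywise_col => i; apply: measurable_Fhat_quantile => //.
  exact: entrywise_centered_resid.
apply: entrywiseN; apply: (mM); apply: entrywise_hard_threshold.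
apply: entrywiseD; last exact: mM.
apply: entrywise_ridge_debiased; apply: entrywiseD; first exact: mM.
apply: entrywiseZ => //.
have ms : measurable_fun setT (fun w => sigma_hat2 X (theta_hat X Q lam rho b (y w)) (y w)).
  exact: measurable_sigma_hat2.
exact: (measurableT_comp (continuous_measurable_fun (@sqrt_continuous R)) ms).
Qed.

Lemma entrywise_pred_err d (T : measurableType d) (R : realType) (n p p1 r : nat)
    (X : 'M[R]_(n, p)) (Xf : 'M[R]_(p1, p)) (Q : 'M[R]_(p, r)) (lam : 'rV[R]_r)
    (rho b : R) (beta : 'cV[R]_p) (y : T -> 'cV[R]_n) (ef : T -> 'cV[R]_p1) :
  entrywise_measurable _ _ _ _ _ y -> entrywise_measurable _ _ _ _ _ ef ->
  entrywise_measurable _ _ _ _ _ (fun w => pred_err X Xf Q lam rho b beta (y w) (ef w)).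
Proof.
move=> my mef; rewrite /pred_err; apply: entrywiseD.
  by apply: entrywiseD => //; exact: entrywise_cst.
apply: entrywiseN; apply: entrywiseM; first exact: entrywise_cst.
exact: entrywise_theta_hat.
Qed.

(** Sections of a measurable subset of the product. The threshold [g] depends on [w] so that a
    random quantile can be inserted. *)
Lemma measurable_section_prob d d' (T : measurableType d) (T' : measurableType d')
    (R : realType) (P' : probability T' R) (h : T * T' -> R) (g : T -> R) :
  measurable_fun setT h -> measurable_fun setT g ->
  measurable_fun setT (fun w => fine (P' [set w' | h (w, w') <= g w])).
Proof.
move=> mh mg.
have mA : measurable [set z : T * T' | h z <= g z.1].
  by apply: measurable_set_le => //; exact: (measurableT_comp mg).
have := measurable_fun_xsection P' mA.
move=> /(measurableT_comp (@fine_measurable _ setT measurableT)).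
have -> // : fine \o (P' \o xsection [set z : T * T' | h z <= g z.1]) =
   (fun w => fine (P' [set w' | h (w, w') <= g w])).
apply/funext => w /=; congr (fine (P' _)); apply/seteqP; split => w'.
  by rewrite /xsection /= inE.
by rewrite /xsection /= inE.
Qed.

Lemma section_measurable d d' (T : measurableType d) (T' : measurableType d')
    (R : realType) (h : T * T' -> R) (w : T) :
  measurable_fun setT h -> measurable_fun setT (fun w' => h (w, w')).
Proof. by move=> mh; apply: (measurableT_comp mh); exact: measurable_fun_pair. Qed.

(** * Comparison of distribution functions *)

Lemma fine_cdfE d (T : measurableType d) (R : realType) (P : probability T R)
    (X : {RV P >-> R}) (x : R) : fine (cdf X x) = fine (P [set w | X w <= x]).
Proof.
rewrite /cdf /distribution /pushforward; congr (fine (P _)).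
Qed.

Lemma prob_le_homo d (T : measurableType d) (R : realType) (P : probability T R)
    (f : T -> R) : measurable_fun setT f ->
  {homo (fun x => fine (P [set w | f w <= x])) : x y / x <= y}.
Proof.
move=> mf x y xy; apply: fine_prob_le; try (apply: measurable_set_le => //; exact: measurable_cst).
by move=> w /= /le_trans; exact.
Qed.

Lemma prob_le_right_continuous d (T : measurableType d) (R : realType)
    (P : probability T R) (f : T -> R) (x e : R) : measurable_fun setT f -> 0 < e ->
  exists2 r, 0 < r & forall y, x <= y -> y < x + r ->
    `|fine (P [set w | f w <= x]) - fine (P [set w | f w <= y])| <= e.
Proof.
move=> mf e0; pose X : {RV P >-> R} := mfun_of _ _ _ _ _ mf.
have h := @cdf_right_continuous _ _ _ P X x.
have fx : cdf X x = (fine (cdf X x))%:E by rewrite fineK// fin_num_measure.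
rewrite fx in h.
have : fine \o cdf X @ x^'+ --> fine (cdf X x) by exact: fine_cvg h.
move=> /cvgrPdist_le/(_ _ e0).
rewrite /at_right /within -nbhs_ballE => -[r /= r0 rP].
exists r => // y; rewrite le_eqVlt => /orP[/eqP <- _|xy yr].
  by rewrite subrr normr0 ltW.
have := rP y; rewrite !fine_cdfE; apply=> //.
by rewrite /ball/= distrC gtr0_norm ?subr_gt0// ltrBlDl.
Qed.

Lemma prob_le_lim1 d (T : measurableType d) (R : realType)
    (P : probability T R) (f : T -> R) (e : R) : measurable_fun setT f -> 0 < e ->
  exists x, 1 - e <= fine (P [set w | f w <= x]).
Proof.
move=> mf e0; pose X : {RV P >-> R} := mfun_of _ _ _ _ _ mf.
have : fine \o cdf X @ +oo --> (1 : R) by exact: fine_cvg (@cvg_cdfy1 _ _ _ P X).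
move=> /cvgrPdist_le/(_ _ e0).
move=> [M [_ MP]]; exists (M + 1).
have := MP (M + 1); rewrite ltrDl ltr01 => /(_ isT).
by rewrite /= fine_cdfE ler_norml => /andP[_]; rewrite lerBlDr addrC lerBlDr.
Qed.

Lemma prob_le_lim0 d (T : measurableType d) (R : realType)
    (P : probability T R) (f : T -> R) (e : R) : measurable_fun setT f -> 0 < e ->
  exists x, fine (P [set w | f w <= x]) <= e.
Proof.
move=> mf e0; pose X : {RV P >-> R} := mfun_of _ _ _ _ _ mf.
have : fine \o cdf X @ -oo --> 0 by exact: fine_cvg (@cvg_cdfNy0 _ _ _ P X).
move=> /cvgrPdist_le/(_ _ e0).
move=> [M [_ MP]]; exists (M - 1).
have := MP (M - 1); rewrite ltrBlDr ltrDl ltr01 => /(_ isT).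
by rewrite /= fine_cdfE sub0r normrN => /(le_trans (ler_norm _)).
Qed.

(* Right continuity lets x range over the rationals. *)
Lemma measurable_sup_dist d d' (T : measurableType d) (T' : measurableType d')
    (R : realType) (P' : probability T' R) (h1 h2 : T * T' -> R) (e : R) :
  measurable_fun setT h1 -> measurable_fun setT h2 ->
  measurable [set w | exists x : R, 0 <= x /\
    e < `|fine (P' [set w' | h1 (w, w') <= x]) - fine (P' [set w' | h2 (w, w') <= x])|].
Proof.
move=> m1 m2.
pose D w x := `|fine (P' [set w' | h1 (w, w') <= x]) - fine (P' [set w' | h2 (w, w') <= x])|.
have -> : [set w | exists x : R, 0 <= x /\ e < D w x] =
    \bigcup_(q : rat) [set w | (0 <= ratr q :> R) && (e < D w (ratr q))].
  apply/seteqP; split => w /=; last first.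
    by move=> [q _ /= /andP[q0 qe]]; exists (ratr q).
  move=> [x [x0 xe]].
  pose g := (D w x - e) / 4.
  have g0 : 0 < g by rewrite divr_gt0// subr_gt0.
  have [r1 r10 r1P] := @prob_le_right_continuous _ _ _ P' _ x _ (section_measurable _ _ _ _ _ _ w m1) g0.
  have [r2 r20 r2P] := @prob_le_right_continuous _ _ _ P' _ x _ (section_measurable _ _ _ _ _ _ w m2) g0.
  have xr : x < x + Num.min r1 r2 by rewrite ltrDl lt_min r10.
  have [q] := rat_in_itvoo xr; rewrite in_itv/= => /andP[xq qr].
  exists q => //=; rewrite (le_trans x0 (ltW xq))/=.
  have k1 := r1P (ratr q) (ltW xq) (lt_le_trans qr _).
  have k2 := r2P (ratr q) (ltW xq) (lt_le_trans qr _).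
  have {k1}k1 := k1 ltac:(by rewrite lerD2l ge_min lexx).
  have {k2}k2 := k2 ltac:(by rewrite lerD2l ge_min lexx orbT).
  have gE : 4 * g = D w x - e by rewrite /g mulrC divfK.
  move: k1 k2 g0 gE; rewrite /D.
  set a := fine _; set b := fine _; set a' := fine _; set b' := fine _.
  move=> k1 k2 k3 k4.
  have t : `|a - a'| <= `|a - b| + `|b - b'| + `|b' - a'|.
    rewrite (_ : a - a' = (a - b) + (b - b') + (b' - a')); last by ring.
    by rewrite (le_trans (ler_normD _ _))// lerD2r ler_normD.
  move: t; rewrite (distrC b') => t; lra.
apply: bigcupT_measurable_rat => q.
have [q0|q0] := boolP (0 <= ratr q :> R); last first.
  by rewrite (_ : [set w | _] = set0)//; apply/seteqP; split.
rewrite /=; apply: measurable_set_lt; first exact: measurable_cst.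
apply: (measurableT_comp (@normr_measurable R setT)); apply: measurable_funB;
  by apply: measurable_section_prob => //; exact: measurable_cst.
Qed.

Lemma prob_le_neg0 d (T : measurableType d) (R : realType) (P : probability T R)
    (f : T -> R) (x : R) : (forall w, 0 <= f w) -> x < 0 ->
  fine (P [set w | f w <= x]) = 0.
Proof.
move=> f0 x0; rewrite (_ : [set w | _] = set0) ?measure0//.
apply/seteqP; split => w //= /(le_lt_trans)/(_ x0).
by rewrite ltNge f0.
Qed.

Lemma quantile_set_nonempty d (T : measurableType d) (R : realType)
    (P : probability T R) (f : T -> R) (a : R) : measurable_fun setT f -> 0 < a ->
  [set x | 1 - a <= fine (P [set w | f w <= x])] !=set0.
Proof. by move=> mf a0; have [x xP] := @prob_le_lim1 _ _ _ P f a mf a0; exists x. Qed.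

Lemma quantile_set_lbound d (T : measurableType d) (R : realType)
    (P : probability T R) (f : T -> R) (a : R) : (forall w, 0 <= f w) -> a < 1 ->
  has_lbound [set x | 1 - a <= fine (P [set w | f w <= x])].
Proof.
move=> f0 a1; exists 0 => x /= ax; rewrite leNgt; apply/negP => x0.
by move: ax; rewrite prob_le_neg0// subr_le0 leNgt a1.
Qed.

(** By right continuity the infimum is attained. This reduces measurability of the bootstrap
    quantile in the data to that of the conditional distribution function. *)
Lemma quantile_le d (T : measurableType d) (R : realType)
    (P : probability T R) (f : T -> R) (a x : R) :
  measurable_fun setT f -> (forall w, 0 <= f w) -> 0 < a -> a < 1 ->
  (inf [set x | 1 - a <= fine (P [set w | f w <= x])] <= x) =
  (1 - a <= fine (P [set w | f w <= x])).
Proof.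
move=> mf f0 a0 a1.
have lb := @quantile_set_lbound _ _ _ P f a f0 a1.
have ne := @quantile_set_nonempty _ _ _ P f a mf a0.
apply/idP/idP => [ix|]; last exact: ge_inf.
rewrite leNgt; apply/negP => Fx.
have g0 : 0 < (1 - a - fine (P [set w | f w <= x])) / 2 by rewrite divr_gt0// subr_gt0.
have [r r0 rP] := @prob_le_right_continuous _ _ _ P f x _ mf g0.
have : x + r / 2 <= inf [set x | 1 - a <= fine (P [set w | f w <= x])].
  apply: lb_le_inf => // z /= az; rewrite leNgt; apply/negP => zx.
  have xr : x <= x + r / 2 by rewrite lerDl ltW// divr_gt0.
  have xr2 : x + r / 2 < x + r by rewrite ltrD2l ltr_pdivrMr// ltr_pMr// ltr1n.
  have := rP _ xr xr2; have := prob_le_homo _ _ _ P f mf _ _ (ltW zx) => /=.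
  rewrite ler_norml => h /andP[h1 h2]; lra.
by move=> /le_trans/(_ ix); rewrite gerDl leNgt divr_gt0.
Qed.

Lemma measurable_level_dist d d' (T : measurableType d) (T' : measurableType d')
    (R : realType) (P' : probability T' R) (h1 h2 : T * T' -> R) (a e : R) :
  measurable_fun setT h1 -> (forall z, 0 <= h1 z) -> measurable_fun setT h2 ->
  0 < a -> a < 1 ->
  measurable [set w | e < `|fine (P' [set w' | h2 (w, w') <=
     inf [set x | 1 - a <= fine (P' [set w' | h1 (w, w') <= x])]]) - (1 - a)|].
Proof.
move=> m1 h10 m2 a0 a1; apply: measurable_set_lt; first exact: measurable_cst.
apply: (measurableT_comp (@normr_measurable R setT)); apply: measurable_funB; last exact: measurable_cst.
apply: measurable_section_prob => //; apply: measurable_fun_set_le => x.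
have -> : [set w | inf [set x | 1 - a <= fine (P' [set w' | h1 (w, w') <= x])] <= x] =
    [set w | 1 - a <= fine (P' [set w' | h1 (w, w') <= x])].
  apply/seteqP; split => w /=; rewrite (quantile_le _ _ _ _ (fun w' => h1 (w, w')))//;
    exact: section_measurable.
apply: measurable_set_le; first exact: measurable_cst.
by apply: measurable_section_prob => //; exact: measurable_cst.
Qed.

(* The maximum with 0 takes care of negative x. *)
Lemma abs_cdf_close d (T : measurableType d) (R : realType) (P : probability T R)
    (Y : T -> R) (F : R -> R) (e t : R) :
  measurable_fun setT Y -> {homo F : x y / x <= y} -> 0 < t ->
  (forall x y, `|x - y| <= t -> `|F x - F y| <= e) ->
  (forall x, `|fine (P [set w | Y w <= x]) - F x| <= e) ->
  forall x, `|fine (P [set w | `|Y w| <= x]) - Num.max 0 (F x - F (- x))| <= 3 * e.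
Proof.
move=> mY Fm t0 Ft YF x.
have e0 : 0 <= e by exact: le_trans (normr_ge0 _) (YF 0).
have mle z : measurable [set w | Y w <= z] by apply: measurable_set_le => //; exact: measurable_cst.
have mlt z : measurable [set w | Y w < z] by apply: measurable_set_lt => //; exact: measurable_cst.
have [x0|x0] := ltP x 0.
  rewrite (@prob_le_neg0 _ _ _ P (fun w => `|Y w|))//.
  have -> : Num.max 0 (F x - F (- x)) = 0.
    apply/eqP; rewrite eq_maxl subr_le0 Fm//; lra.
  by rewrite subrr normr0 mulr_ge0.
have -> : Num.max 0 (F x - F (- x)) = F x - F (- x).
  apply/eqP; rewrite eq_maxr subr_ge0 Fm//; lra.
have -> : [set w | `|Y w| <= x] = [set w | Y w <= x] `\` [set w | Y w < - x].
  apply/seteqP; split => w /=; rewrite ler_norml.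
    by move=> /andP[h1 h2]; split => //; apply/negP; rewrite -leNgt.
  by move=> [-> /negP]; rewrite -leNgt => ->.
rewrite fine_probD//; last by move=> w /= /ltW /le_trans; apply; lra.
(* [Y] may have atoms, as it does under [Fhat], so P (Y < - x) is trapped between the distribution
   function at [- x - t] and at [- x]. *)
have h1 : fine (P [set w | Y w < - x]) <= fine (P [set w | Y w <= - x]).
  by apply: fine_prob_le => // w /= /ltW.
have h2 : fine (P [set w | Y w <= - x - t]) <= fine (P [set w | Y w < - x]).
  by apply: fine_prob_le => // w /= h; lra.
have := YF x; have := YF (- x); have := YF (- x - t).
have : `|F (- x - t) - F (- x)| <= e.
  by apply: Ft; rewrite addrAC subrr add0r normrN gtr0_norm.
rewrite !ler_norml => /andP[a1 a2] /andP[b1 b2] /andP[c1 c2] /andP[d1 d2].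
by apply/andP; split; lra.
Qed.

(** [D] may depend on [Y]; off [B] it only moves the argument by at most [t]. The constant collects
    [3 * e] per factor from [abs_cdf_close], [2 * e] per factor from moving [x] by [t], and [e] for
    [B]. *)
Lemma max_abs_prob_close d (T : measurableType d) (R : realType) (P : probability T R)
    (Y : nat -> T -> R) (F : R -> R) (e t : R) (k : nat) (D : 'I_k -> T -> R) (B : set T) :
  (forall i, measurable_fun setT (Y i)) -> mutually_independent P Y ->
  {homo F : x y / x <= y} -> (forall x, 0 <= F x <= 1) -> 0 < t ->
  (forall x y, `|x - y| <= t -> `|F x - F y| <= e) ->
  (forall i x, `|fine (P [set w | Y i w <= x]) - F x| <= e) ->
  (forall i, measurable_fun setT (D i)) -> measurable B -> fine (P B) <= e ->
  (forall w i, ~ B w -> `|D i w| <= t) ->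
  forall x, `|fine (P [set w | forall i : 'I_k, `|Y i w + D i w| <= x]) -
              (Num.max 0 (F x - F (- x))) ^+ k| <= (5 * k%:R + 1) * e.
Proof.
move=> mY iY Fm F01 t0 Ft YF mD mB PB hB x.
pose Phi z := Num.max 0 (F z - F (- z)).
have Phi01 z : 0 <= Phi z <= 1.
  rewrite le_max lexx/= ge_max ler01/=.
  by have /andP[? ?] := F01 z; have /andP[? ?] := F01 (- z); lra.
have mall (f : 'I_k -> T -> R) z : (forall i, measurable_fun setT (f i)) ->
    measurable [set w | forall i, `|f i w| <= z].
  move=> mf; rewrite (_ : [set w | _] = \bigcap_(i : 'I_k) [set w | `|f i w| <= z]); last first.
    by apply/seteqP; split => w /= h i; [move=> _; exact: h|exact: (h i I)].
  apply: fin_bigcap_measurable => // i _.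
  apply: measurable_set_le; last exact: measurable_cst.
  exact: (measurableT_comp (@normr_measurable R setT)).
have mYD i : measurable_fun setT (fun w => Y (nat_of_ord i) w + D i w) by exact: measurable_funD.
have ind z : `|fine (P [set w | forall i : 'I_k, `|Y i w| <= z]) - Phi z ^+ k| <= k%:R * (3 * e).
  have -> : fine (P [set w | forall i : 'I_k, `|Y i w| <= z]) =
      \prod_(i < k) fine (P [set w | `|Y i w| <= z]).
    have := iY (iota 0 k) (fun=> [set y | `|y| <= z]) (iota_uniq 0 k).
    rewrite set_mem_iota -{2}[k]subn0 -/(index_iota 0 k) big_mkord => <-.
      congr (fine (P _)); apply/seteqP; split => w /= h i.
        by move=> ik; exact: (h (Ordinal ik)).
      exact: h (ltn_ord i).
    move=> _; apply: measurable_set_le; last exact: measurable_cst.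
    exact: normr_measurable.
  have mi (i : 'I_k) : measurable [set w | `|Y i w| <= z].
    apply: measurable_set_le; last exact: measurable_cst.
    exact: (measurableT_comp (@normr_measurable R setT)).
  apply: prod_sub_exp_le => // i.
    by rewrite fine_prob_ge0/= fine_prob_le1.
  exact: (@abs_cdf_close _ _ _ P (Y i) F e t).
have Phi_close z z' : `|z - z'| <= t -> `|Phi z ^+ k - Phi z' ^+ k| <= k%:R * (2 * e).
  move=> zz; have -> : Phi z ^+ k = \prod_(i < k) Phi z by rewrite prodr_const card_ord.
  apply: prod_sub_exp_le => // _.
  have := Ft _ _ zz; have := Ft (- z) (- z'); rewrite -opprD normrN => /(_ zz).
  rewrite /Phi !ler_norml => /andP[a1 a2] /andP[b1 b2].
  rewrite /Num.max; case: ifPn => c1; case: ifPn => c2; apply/andP; split; lra.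
have up : fine (P [set w | forall i : 'I_k, `|Y i w + D i w| <= x]) <=
    fine (P [set w | forall i : 'I_k, `|Y i w| <= x + t]) + fine (P B).
  apply: fine_prob_leU => //; try exact: mall.
  move=> w /= h; have [Bw|Bw] := pselect (B w); [by right|left => i].
  have := hB w i Bw; have := h i; rewrite !ler_norml => /andP[a1 a2] /andP[b1 b2].
  by apply/andP; split; lra.
have lo : fine (P [set w | forall i : 'I_k, `|Y i w| <= x - t]) <=
    fine (P [set w | forall i : 'I_k, `|Y i w + D i w| <= x]) + fine (P B).
  apply: fine_prob_leU => //; try exact: mall.
  move=> w /= h; have [Bw|Bw] := pselect (B w); [by right|left => i].
  have := hB w i Bw; have := h i; rewrite !ler_norml => /andP[a1 a2] /andP[b1 b2].
  by apply/andP; split; lra.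
have := ind (x + t); have := ind (x - t).
have := Phi_close (x + t) x; rewrite addrAC subrr add0r gtr0_norm// lexx => /(_ isT).
have := Phi_close (x - t) x; rewrite addrAC subrr add0r normrN gtr0_norm// lexx => /(_ isT).
rewrite -/(Phi x) !ler_norml => /andP[a1 a2] /andP[b1 b2] /andP[c1 c2] /andP[d1 d2].
by apply/andP; split; lra.
Qed.

Lemma uniform_prob_le (R : realType) (c : R) : 0 <= c <= 1 ->
  fine (uniform_prob (@ltr01 R) [set v | (0 < v <= 1) && (v <= c)]) = c.
Proof.
move=> /andP[c0 c1].
rewrite /uniform_prob integral_uniform_pdf.
have -> : [set v | (0 < v <= 1) && (v <= c)] `&` `[0, 1] = `]0, c]%classic :> set R.
  apply/seteqP; split => v /=; rewrite !in_itv/=.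
    by move=> [/andP[/andP[-> _] ->] _].
  move=> /andP[v0 vc]; rewrite v0 vc (le_trans vc c1)/=; split => //.
  by rewrite ltW.
rewrite (eq_integral (fun=> 1%E)); last first.
  move=> v; rewrite inE/= in_itv/= => /andP[v0 vc].
  by rewrite /uniform_pdf (ltW v0) (le_trans vc c1)/= subr0 invr1.
rewrite integral_cst//= mul1e lebesgue_measure_itv/= lte_fin.
case: ltP => [_|]; first by rewrite -EFinB subr0.
by move=> c0'; apply/eqP; rewrite eq_le c0.
Qed.

(** Inverse transform. The equivalence between quantile and distribution function is available for 0
    < V <= 1, an event of probability one. *)
Lemma Fhat_quantile_cdf d (T : measurableType d) (R : realType) (P : probability T R)
    (V : T -> R) (n : nat) (e : 'cV[R]_n) (x : R) : (0 < n)%N ->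
  measurable_fun setT V ->
  (forall B, measurable B -> P (V @^-1` B) = uniform_prob (@ltr01 R) B) ->
  fine (P [set w | Fhat_quantile e (V w) <= x]) = Fhat e x.
Proof.
move=> n0 mV law.
have F01 := Fhat_le1 _ _ e x.
have mI c : measurable [set v : R | (0 < v <= 1) && (v <= c)].
  rewrite (_ : [set v | _] = [set v | 0 < v] `&` [set v | v <= 1] `&` [set v | v <= c]); last first.
    by apply/seteqP; split => v /=; [move=> /andP[/andP[]]|move=> [[-> ->] ->]].
  apply: measurableI; [apply: measurableI|];
    by [apply: measurable_set_lt|apply: measurable_set_le].
have PV c : 0 <= c <= 1 -> fine (P (V @^-1` [set v | (0 < v <= 1) && (v <= c)])) = c.
  by move=> c01; rewrite law// uniform_prob_le.
have mpre c : measurable (V @^-1` [set v | (0 < v <= 1) && (v <= c)]).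
  by rewrite -[X in measurable X]setTI; exact: mV.
have mq : measurable [set w | Fhat_quantile e (V w) <= x].
  apply: measurable_set_le; last exact: measurable_cst.
  by apply: (@measurable_Fhat_quantile _ _ _ _ (fun=> e)) => //; exact: entrywise_cst.
have P1 : fine (P (~` (V @^-1` [set v | (0 < v <= 1) && (v <= 1)]))) = 0.
  rewrite probability_setC// fineB ?fin_num_measure//= PV ?subrr//.
  by rewrite ler01 lexx.
apply/eqP; rewrite eq_le; apply/andP; split.
  rewrite -[leRHS]addr0 -P1 -{1}(PV _ F01).
  apply: fine_prob_leU => //; first exact: measurableC.
  move=> w /= h; have [v01|v01] := boolP (0 < V w <= 1); last by right.
  by left; rewrite /= -(Fhat_quantile_le _ _ _ _ _ n0 v01).
rewrite -{1}(PV _ F01); apply: fine_prob_le => // w /= /andP[v01 h].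
by rewrite (Fhat_quantile_le _ _ _ _ _ n0 v01).
Qed.

(** * Effect of thresholding *)

Lemma hard_threshold_active (R : realType) (p : nat) (b : R) (t : 'cV[R]_p) (N : {set 'I_p}) :
  (forall j, j \notin N -> `|t j 0| <= b) -> (forall j, j \in N -> b < `|t j 0|) ->
  hard_threshold b t = \col_j (if j \in N then t j 0 else 0).
Proof.
move=> out inN; apply/colP => j; rewrite !mxE.
have [jN|jN] := boolP (j \in N); first by rewrite inN.
by rewrite ltNge out.
Qed.

Lemma col_addE (R : realType) (p : nat) (u v : 'cV[R]_p) (i : 'I_p) :
  (u + v) i 0 = u i 0 + v i 0.
Proof. by rewrite mxE. Qed.

Lemma col_subE (R : realType) (p : nat) (u v : 'cV[R]_p) (i : 'I_p) :
  (u - v) i 0 = u i 0 - v i 0.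
Proof. by rewrite !mxE. Qed.

Lemma mulmx_active (R : realType) (p p1 : nat) (Xf : 'M[R]_(p1, p)) (u : 'cV[R]_p)
    (N : {set 'I_p}) (i : 'I_p1) :
  (Xf *m \col_j (if j \in N then u j 0 else 0)) i 0 = \sum_(j in N) Xf i j * u j 0.
Proof.
rewrite mxE (bigID (mem N))/= [X in _ + X]big1 ?addr0; last first.
  by move=> j jN; rewrite mxE (negbTE jN) mulr0.
by apply: eq_bigr => j jN; rewrite mxE jN.
Qed.

(** Exchanging the sums shows that the prediction error of the coordinates in [N] is a linear form
    in the SVD coordinates, which is the origin of [cmat]. *)
Lemma cmat_form (R : realType) (p p1 r : nat) (Xf : 'M[R]_(p1, p)) (Q : 'M[R]_(p, r))
    (N : {set 'I_p}) (w : 'cV[R]_r) (i : 'I_p1) :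
  \sum_(j in N) Xf i j * (Q *m w) j 0 = (row i (cmat Xf Q N) *m w) 0 0.
Proof.
rewrite mxE; under eq_bigr do rewrite mxE mulr_sumr.
rewrite exchange_big/=; apply: eq_bigr => k _; rewrite !mxE mulr_suml.
by apply: eq_bigr => j _; rewrite mulrA.
Qed.

Lemma colmaxabs_ge (R : realType) (k : nat) (v : 'cV[R]_k) (i : 'I_k) : `|v i 0| <= colmaxabs v.
Proof. by rewrite /colmaxabs (bigD1 i)//= le_max lexx. Qed.

(** For [k = 0] the maximum is 0 and the right side is vacuous, so the equivalence would fail at
    negative [x]. *)
Lemma colmaxabs_leP (R : realType) (k : nat) (v : 'cV[R]_k) (x : R) : (0 < k)%N ->
  colmaxabs v <= x <-> forall i, `|v i 0| <= x.
Proof.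
move=> k0; split=> [vx i|vx]; first exact: le_trans (colmaxabs_ge _ _ _ _) vx.
have x0 : 0 <= x by rewrite (le_trans _ (vx (Ordinal k0))).
rewrite /colmaxabs; elim/big_rec : _ => // i y _ yx.
by rewrite ge_max vx yx.
Qed.

Lemma colmaxabs_ge0 (R : realType) (k : nat) (v : 'cV[R]_k) : 0 <= colmaxabs v.
Proof.
by rewrite /colmaxabs; elim/big_rec : _ => // i y _ y0; rewrite le_max y0 orbT.
Qed.

Lemma coord_err_form_le (R : realType) (n p r : nat) (Pm : 'M[R]_(n, r)) (Q : 'M[R]_(p, r))
    (lam : 'rV[R]_r) (rho L k M : R) (beta : 'cV[R]_p) (e : 'cV[R]_n) (c : 'rV[R]_r) :
  0 < rho -> 0 < L -> (forall i, L <= lam 0 i) -> 0 <= k -> 0 <= M ->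
  \sum_i c 0 i ^+ 2 <= k ^+ 2 -> \sum_i (Q^T *m beta) i 0 ^+ 2 <= M ^+ 2 ->
  `|(c *m coord_err _ _ _ _ Pm Q lam rho beta e) 0 0| <=
  `|\sum_l noise_form _ _ _ Pm lam rho c 0 l * e l 0| + k * ((rho / L ^+ 2) ^+ 2 * M).
Proof.
move=> rho0 L0 Ll k0 M0 ck bM.
rewrite /coord_err mulmxBr [X in `|X|]mxE; apply: (le_trans (ler_normD _ _)); apply: lerD.
  by rewrite !mulmxA mxE.
rewrite mxE normrN.
set z := (_ *m _) 0 0.
have q0 : 0 <= (rho / L ^+ 2) ^+ 2 by exact: sqr_ge0.
have kM : 0 <= k * ((rho / L ^+ 2) ^+ 2 * M) by apply: mulr_ge0 => //; exact: mulr_ge0.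
rewrite -(@ler_pXn2r _ 2) ?nnegrE// real_normK ?num_real//.
apply: (le_trans (bias_form_le _ _ _ _ _ _ _ _ _ rho0 L0 Ll)).
set q := (rho / L ^+ 2) ^+ 2; rewrite !exprMn; apply: ler_pM => //.
- by apply: sumr_ge0 => i _; exact: sqr_ge0.
- by rewrite mulr_ge0 ?sqr_ge0//; apply: sumr_ge0 => i _; exact: sqr_ge0.
by rewrite ler_wpM2l ?sqr_ge0.
Qed.

Lemma theta_decomp (R : realType) (p r : nat) (Q : 'M[R]_(p, r)) (Qp : 'M[R]_(p, p - r))
    (beta : 'cV[R]_p) : Q *m Q^T + Qp *m Qp^T = 1%:M ->
  beta = theta_of Q beta + theta_perp_of Qp beta.
Proof. by move=> one; rewrite /theta_of /theta_perp_of -mulmxDl one mul1mx. Qed.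

(** Once the selected set is [N], three errors remain: the coordinates left out, the part of [beta]
    invisible to the design, and the linear form in [w]. *)
Lemma pred_shift_le (R : realType) (p p1 r : nat) (Xf : 'M[R]_(p1, p)) (Q : 'M[R]_(p, r))
    (Qp : 'M[R]_(p, p - r)) (beta : 'cV[R]_p) (w : 'cV[R]_r) (N : {set 'I_p}) (i : 'I_p1) :
  Q *m Q^T + Qp *m Qp^T = 1%:M ->
  `|(Xf *m beta - Xf *m (\col_j (if j \in N then (theta_of Q beta + Q *m w) j 0 else 0))) i 0| <=
  colmaxabs (\col_(i < p1) \sum_(j in ~: N) Xf i j * theta_of Q beta j 0) +
  colmaxabs (Xf *m theta_perp_of Qp beta) + `|(row i (cmat Xf Q N) *m w) 0 0|.
Proof.
move=> one.
have -> : (Xf *m beta - Xf *m (\col_j (if j \in N then (theta_of Q beta + Q *m w) j 0 else 0))) i 0 =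
    (\col_(i < p1) \sum_(j in ~: N) Xf i j * theta_of Q beta j 0) i 0 +
    (Xf *m theta_perp_of Qp beta) i 0 - (row i (cmat Xf Q N) *m w) 0 0.
  rewrite {1}(theta_decomp _ _ _ Q Qp beta one) mulmxDr -cmat_form col_subE col_addE.
  rewrite addrAC [RHS]addrAC; congr (_ + _); rewrite mulmx_active.
  under eq_bigr do rewrite col_addE mulrDr.
  rewrite big_split/= opprD addrA; congr (_ - _).
  rewrite [RHS]mxE mxE (bigID (mem N))/= addrAC subrr add0r.
  by apply: eq_bigl => j; rewrite inE.
apply: (le_trans (ler_normB _ _)); rewrite lerD2r.
by apply: (le_trans (ler_normD _ _)); apply: lerD; exact: colmaxabs_ge.
Qed.

(** The thresholded estimator is the truth of the bootstrap world. It vanishes off [N], and adding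
    back its component along [Qp] makes the bootstrap estimator equal to [th + Q *m w], so of the
    three errors in [pred_shift_le] only the linear form survives. *)
Lemma boot_shift (R : realType) (n p p1 r : nat) (X : 'M[R]_(n, p)) (Xf : 'M[R]_(p1, p))
    (Pm : 'M[R]_(n, r)) (Q : 'M[R]_(p, r)) (lam : 'rV[R]_r) (Qp : 'M[R]_(p, p - r))
    (rho b : R) (y z : 'cV[R]_n) (v : 'cV[R]_p1) (N : {set 'I_p}) (i : 'I_p1) :
  X = Pm *m diag_mx lam *m Q^T -> Pm^T *m Pm = 1%:M -> Q^T *m Q = 1%:M ->
  Qp^T *m Qp = 1%:M -> Q^T *m Qp = 0 -> Q *m Q^T + Qp *m Qp^T = 1%:M -> 0 < rho ->
  let th := theta_hat X Q lam rho b y in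
  let w := coord_err _ _ _ _ Pm Q lam rho th (Num.sqrt (sigma_hat2 X th y) *: z) in
  (forall j, j \notin N -> th j 0 = 0) ->
  (forall j, j \notin N -> `|(th + Q *m w) j 0| <= b) ->
  (forall j, j \in N -> b < `|(th + Q *m w) j 0|) ->
  boot_pred_err X Xf Q lam Qp rho b y z v i 0 =
  Fhat_quantile (centered_resid X th y) (v i 0) - (row i (cmat Xf Q N) *m w) 0 0.
Proof.
move=> XE PP QQ QpQp QQp one rho0 th w thN out inN.
rewrite /boot_pred_err -/th (@ridge_debiased_err _ _ _ _ X Pm Q lam Qp)// -/w.
have -> : theta_of Q th + Q *m w + Qp *m Qp^T *m th = th + Q *m w.
  by rewrite addrAC /theta_of -mulmxDl one mul1mx.
rewrite (@hard_threshold_active _ _ _ _ N)// -cmat_form.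
rewrite col_subE col_addE mulmx_active [X in _ + X - _]mxE.
rewrite [LHS]addrAC addrC; congr (_ + _).
under eq_bigr do rewrite col_addE mulrDr.
rewrite big_split/= opprD addrA mxE (bigID (mem N))/=.
have -> : \sum_(j < p | j \notin N) Xf i j * th j 0 = 0.
  by rewrite big1// => j jN; rewrite thN ?mulr0.
by rewrite addr0 subrr add0r.
Qed.

(** The design annihilates the component of [beta] orthogonal to its row space. *)
Lemma resid_err (R : realType) (n p r : nat) (X : 'M[R]_(n, p)) (Pm : 'M[R]_(n, r))
    (Q : 'M[R]_(p, r)) (lam : 'rV[R]_r) (beta th : 'cV[R]_p) (e : 'cV[R]_n) :
  X = Pm *m diag_mx lam *m Q^T -> Q^T *m Q = 1%:M ->
  X *m beta + e - X *m th = e - X *m (th - theta_of Q beta).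
Proof.
move=> XE QQ; have -> : X *m beta = X *m theta_of Q beta.
  by rewrite /theta_of XE !mulmxA -(mulmxA _ Q^T Q) QQ mulmx1.
by rewrite mulmxBr opprB addrA [e + _]addrC.
Qed.

Lemma sum_centered_le (R : realType) (n : nat) (d : 'I_n -> R) : (0 < n)%N ->
  \sum_i (d i - n%:R^-1 * \sum_j d j) ^+ 2 <= \sum_i d i ^+ 2.
Proof.
move=> n0; set m := n%:R^-1 * _.
have n0R : n%:R != 0 :> R by rewrite pnatr_eq0 -lt0n.
have nm : \sum_j d j = n%:R * m by rewrite /m mulrA divff// mul1r.
have -> : \sum_i (d i - m) ^+ 2 = \sum_i d i ^+ 2 - n%:R * m ^+ 2.
  rewrite (eq_bigr (fun i => d i ^+ 2 + (- (2 * m)) * d i + m ^+ 2)); last first.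
    by move=> i _; ring.
  rewrite !big_split/= -mulr_sumr sumr_const card_ord nm -[_ *+ n]mulr_natl; ring.
by rewrite gerBl mulr_ge0 ?sqr_ge0.
Qed.

Lemma centered_resid_close (R : realType) (n p : nat) (X : 'M[R]_(n, p)) (th : 'cV[R]_p)
    (y e d : 'cV[R]_n) : (0 < n)%N -> y - X *m th = e - d ->
  n%:R^-1 * \sum_i (centered_resid X th y i 0 - e i 0) ^+ 2 <=
  2 * (n%:R^-1 * \sum_i d i 0 ^+ 2) + 2 * (n%:R^-1 * \sum_i e i 0) ^+ 2.
Proof.
move=> n0 yE.
have n0R : n%:R != 0 :> R by rewrite pnatr_eq0 -lt0n.
have i0 : 0 <= n%:R^-1 :> R by rewrite invr_ge0.
set mu := n%:R^-1 * \sum_i e i 0.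
have E i : centered_resid X th y i 0 - e i 0 =
    - (d i 0 - n%:R^-1 * \sum_j d j 0) - mu.
  rewrite /centered_resid yE !mxE /mu.
  under eq_bigr do rewrite !mxE.
  by rewrite sumrB; ring.
apply: (@le_trans _ _ (n%:R^-1 * \sum_i (2 * (d i 0 - n%:R^-1 * \sum_j d j 0) ^+ 2 + 2 * mu ^+ 2))).
  rewrite ler_wpM2l//; apply: ler_sum => i _; rewrite E.
  set a := d i 0 - _; have := sqr_ge0 (a - mu); nra.
rewrite big_split/= -mulr_sumr mulrDr; apply: lerD.
  rewrite mulrCA ler_wpM2l// ler_wpM2l//; exact: (sum_centered_le _ _ (fun i => d i 0)).
by rewrite sumr_const card_ord -[(_ * _) *+ n]mulr_natl mulKf.
Qed.

(** An upper bound is enough, because the bootstrap regression error vanishes at any bounded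
    scale. *)
Lemma sigma_hat2_le (R : realType) (n p : nat) (X : 'M[R]_(n, p)) (th : 'cV[R]_p)
    (y e d : 'cV[R]_n) : y - X *m th = e - d ->
  sigma_hat2 X th y <=
  2 * (n%:R^-1 * \sum_i e i 0 ^+ 2) + 2 * (n%:R^-1 * \sum_i d i 0 ^+ 2).
Proof.
move=> /colP yE; rewrite /sigma_hat2 mulrCA [X in _ <= _ + X]mulrCA -mulrDr.
rewrite ler_wpM2l ?invr_ge0// !mulr_sumr -big_split/=; apply: ler_sum => i _.
have := yE i; rewrite !mxE => ->.
by have := sqr_ge0 (e i 0 + d i 0); nra.
Qed.

(** Off [N] the error is the coordinate itself, whose square is at most [c * b] times its absolute
    value; this converts the assumed l1 bound into an l2 bound. *)
Lemma active_err_sumsq (R : realType) (p r : nat) (Q : 'M[R]_(p, r)) (th0 : 'cV[R]_p)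
    (w : 'cV[R]_r) (N : {set 'I_p}) (c b B : R) (f : 'I_p -> R) :
  0 <= B -> (forall j, j \in N -> `|(Q *m w) j 0| <= `|f j| + B) ->
  (forall j, j \notin N -> `|th0 j 0| <= c * b) ->
  \sum_j ((\col_j (if j \in N then (th0 + Q *m w) j 0 else 0) - th0) j 0) ^+ 2 <=
  2 * (\sum_(j in N) f j ^+ 2) + 2 * (#|N|%:R * B ^+ 2) +
  c * (b * \sum_(j in ~: N) `|th0 j 0|).
Proof.
move=> B0 wN thN; rewrite (bigID (mem N))/=; apply: lerD.
  have -> : #|N|%:R * B ^+ 2 = \sum_(j in N) B ^+ 2 by rewrite sumr_const mulr_natl.
  rewrite !mulr_sumr -big_split/=; apply: ler_sum => j jN.
  have -> : (\col_j (if j \in N then (th0 + Q *m w) j 0 else 0) - th0) j 0 = (Q *m w) j 0.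
    by rewrite col_subE mxE jN col_addE addrAC subrr add0r.
  have h := wN j jN; rewrite -[leLHS]real_normK ?num_real//.
  have h0 : 0 <= `|(Q *m w) j 0| by [].
  rewrite -[f j ^+ 2]real_normK ?num_real//.
  apply: (@le_trans _ _ ((`|f j| + B) ^+ 2)).
    by apply: lerXn2r => //; rewrite nnegrE addr_ge0.
  by have := sqr_ge0 (`|f j| - B); nra.
rewrite mulrA mulr_sumr (eq_bigl (fun j => j \in ~: N)); last by move=> j; rewrite !inE.
apply: ler_sum => j; rewrite inE => jN.
have -> : (\col_j (if j \in N then (th0 + Q *m w) j 0 else 0) - th0) j 0 = - th0 j 0.
  by rewrite col_subE mxE (negbTE jN) sub0r.
by rewrite sqrrN -real_normK ?num_real// expr2 ler_wpM2r// thN.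
Qed.

(** * Events of probability tending to one *)

(* The exceptional set is covered by a measurable set, so that the events E n
   themselves need not be measurable. *)
Definition whp d (T : measurableType d) (R : realType) (P : probability T R)
  (E : nat -> set T) : Prop :=
  forall e : R, 0 < e -> exists N, forall n, (N <= n)%N ->
    exists2 B, measurable B & (P B <= e%:E)%E /\ forall w, ~ B w -> E n w.

Lemma whp_and d (T : measurableType d) (R : realType) (P : probability T R)
    (E1 E2 : nat -> set T) :
  whp _ _ _ P E1 -> whp _ _ _ P E2 -> whp _ _ _ P (fun n => E1 n `&` E2 n).
Proof.
move=> h1 h2 e e0; have e2 : 0 < e / 2 by rewrite divr_gt0.
have [N1 N1P] := h1 _ e2; have [N2 N2P] := h2 _ e2.
exists (maxn N1 N2) => n; rewrite geq_max => /andP[/N1P[B1 mB1 [PB1 EB1]] /N2P[B2 mB2 [PB2 EB2]]].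
exists (B1 `|` B2); first exact: measurableU.
split; last by move=> w; rewrite not_orP => -[/EB1 ? /EB2 ?].
apply: (le_trans (measureU2 P mB1 mB2)); apply: (le_trans (leeD PB1 PB2)).
by rewrite -EFinD lee_fin; lra.
Qed.

Lemma whp_imp d (T : measurableType d) (R : realType) (P : probability T R)
    (E1 E2 : nat -> set T) (N0 : nat) :
  whp _ _ _ P E1 -> (forall n, (N0 <= n)%N -> E1 n `<=` E2 n) -> whp _ _ _ P E2.
Proof.
move=> h1 h12 e e0; have [N NP] := h1 _ e0.
exists (maxn N N0) => n; rewrite geq_max => /andP[/NP[B mB [PB EB]] nN0].
by exists B => //; split => // w /EB; exact: h12.
Qed.

Lemma whp_all d (T : measurableType d) (R : realType) (P : probability T R)
    (I : eqType) (s : seq I) (E : I -> nat -> set T) :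
  (forall i, i \in s -> whp _ _ _ P (E i)) ->
  whp _ _ _ P (fun n => [set w | forall i, i \in s -> E i n w]).
Proof.
elim: s => [_ e e0|i s IH h].
  by exists 0%N => n _; exists set0 => //; rewrite measure0 lee_fin (ltW e0).
have h1 := h i (mem_head _ _).
have h2 := IH (fun j js => h j (mem_behead (s := i :: s) js)).
apply: (@whp_imp _ _ _ P _ _ 0%N (whp_and _ _ _ _ _ _ h1 h2)) => n _ w [a1 a2] j.
by rewrite inE => /orP[/eqP ->//|]; exact: a2.
Qed.

Lemma whp_bound d (T : measurableType d) (R : realType) (P : probability T R)
    (E : nat -> set T) (f : nat -> R) (N0 : nat) :
  (forall e, 0 < e -> exists N, forall n, (N <= n)%N -> f n <= e) ->
  (forall n, (N0 <= n)%N -> exists2 B, measurable B &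
     (P B <= (f n)%:E)%E /\ forall w, ~ B w -> E n w) ->
  whp _ _ _ P E.
Proof.
move=> f0 h e e0; have [N NP] := f0 _ e0.
exists (maxn N N0) => n; rewrite geq_max => /andP[nN /h[B mB [PB EB]]].
by exists B => //; split => //; rewrite (le_trans PB)// lee_fin NP.
Qed.

Lemma whp_cvg0 d (T : measurableType d) (R : realType) (P : probability T R)
    (A : nat -> set T) (N0 : nat) :
  (forall n, (N0 <= n)%N -> measurable (A n)) -> whp _ _ _ P (fun n => ~` A n) ->
  P (A n) @[n --> \oo] --> 0%E.
Proof.
move=> mA h.
suff : fine (P (A n)) @[n --> \oo] --> (0 : R).
  move=> h2; apply/fine_cvgP; split; last exact: h2.
  near=> n; rewrite fin_num_measure//; apply: mA; near: n; exact: nbhs_infty_ge.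
apply/cvgrPdist_le => e e0; have [N NP] := h e e0.
near=> n.
have nN0 : (N0 <= n)%N by near: n; exact: nbhs_infty_ge.
have nN : (N <= n)%N by near: n; exact: nbhs_infty_ge.
have [B mB [PB EB]] := NP n nN; have mAn := mA n nN0.
rewrite sub0r normrN ger0_norm ?fine_ge0//.
rewrite -lee_fin fineK ?fin_num_measure// (le_trans _ PB)//.
apply: le_measure; rewrite ?inE// => w Aw; apply: contrapT => /EB; exact.
Unshelve. all: by end_near. Qed.

(** The moment bounds take coefficients indexed by [nat]; a finite family is padded with zeros. *)
Definition ord_ext (R : realType) (n : nat) (c : 'I_n -> R) (k : nat) : R :=
  oapp c 0 (insub k).

Lemma ord_extE (R : realType) (n : nat) (c : 'I_n -> R) (i : 'I_n) : ord_ext _ _ c i = c i.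
Proof. by rewrite /ord_ext valK. Qed.

Lemma union_tail d (T : measurableType d) (R : realType) (P : probability T R)
    (Y : nat -> T -> R) (q M : R) (n : nat) (I : finType) (a : I -> 'I_n -> R) (s t : R) :
  2 <= q -> (forall i, measurable_fun setT (Y i)) -> mutually_independent P Y ->
  (forall i, \int[P]_w (Y i w)%:E = 0)%E ->
  (forall i, \int[P]_w (`|Y i w| `^ q)%:E <= M%:E)%E ->
  0 < s -> 0 < t -> (forall i, \sum_l a i l ^+ 2 <= s ^+ 2) ->
  exists2 B, measurable B & (P B <= (#|I|%:R * (mz_const R q M * (s / t) `^ q))%:E)%E /\
    forall w, ~ B w -> forall i, `|\sum_l a i l * Y l w| <= t.
Proof.
move=> q2 mY iY EY EYq s0 t0 as1.
pose Bi i := [set w | t < `|\sum_l a i l * Y l w|].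
have mS i : measurable_fun setT (fun w => \sum_l a i l * Y l w).
  by apply: measurable_sum => l; apply: measurable_funM.
have mBi i : measurable (Bi i).
  apply: measurable_set_lt; first exact: measurable_cst.
  exact: (measurableT_comp (@normr_measurable R setT)).
have PBi i : (P (Bi i) <= (mz_const R q M * (s / t) `^ q)%:E)%E.
  have := @linear_form_tail _ _ _ P Y q M (ord_ext _ _ (a i)) n s t q2 mY iY EY EYq s0 t0.
  under eq_bigr do rewrite ord_extE.
  under eq_set do under eq_bigr do rewrite ord_extE.
  by apply; exact: as1.
exists (\big[setU/set0]_(i : I) Bi i); first exact: bigsetU_measurable.
split; last first.
  move=> w Bw i; rewrite leNgt; apply/negP => h; apply: Bw.
  by rewrite (bigD1 i)//=; left.
rewrite cardT -(size_map (fun x => x)) map_id /index_enum enumT.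
elim: (Finite.enum I) => [|i l IH]; first by rewrite big_nil measure0 mul0r.
rewrite big_cons; apply: (le_trans (measureU2 P _ _)) => //.
  exact: bigsetU_measurable.
by rewrite /= -natr1 mulrDl mul1r addrC EFinD leeD.
Qed.

Lemma lln_whp d (T : measurableType d) (R : realType) (P : probability T R)
    (Y : nat -> T -> R) (q M e : R) :
  2 <= q -> (forall i, measurable_fun setT (Y i)) -> mutually_independent P Y ->
  (forall i, \int[P]_w (Y i w)%:E = 0)%E ->
  (forall i, \int[P]_w (`|Y i w| `^ q)%:E <= M%:E)%E -> 0 < e ->
  whp _ _ _ P (fun n => [set w | `|n%:R^-1 * \sum_(i < n) Y i w| <= e]).
Proof.
move=> q2 mY iY EY EYq e0.
have q0 : 0 < q by lra.
apply: (@whp_bound _ _ _ P _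
  (fun n => mz_const R q M * (e^-1) `^ q * npow n (- (q / 2))) 1%N) => [e' e'0|n n0].
  by apply: npow_eventually_le => //; rewrite oppr_lt0 divr_gt0.
have s0 : 0 < npow n (- (1 / 2)) :> R by exact: npow_gt0.
have n0R : n%:R != 0 :> R by rewrite pnatr_eq0 -lt0n.
(* A single linear form, indexed by [unit], with coefficients 1/n and norm n^(-1/2); its tail is of
   order n^(-q/2). *)
have [] := @union_tail _ _ _ P Y q M n unit (fun _ _ => n%:R^-1) _ _ q2 mY iY EY EYq s0 e0.
  move=> _; rewrite sumr_const card_ord -[_ *+ n]mulr_natl.
  rewrite [n%:R^-1 ^+ 2]expr2 mulrA divff// [leLHS]mul1r expr2 -npowD//.
  have -> : - (1 / 2) + - (1 / 2) = - 1 :> R by lra.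
  by rewrite npowN /npow powRr1.
move=> B mB [PB hB]; exists B => //; split; last first.
  by move=> w /hB /(_ tt); rewrite -mulr_sumr.
rewrite (le_trans PB)// lee_fin card_unit [leLHS]mul1r.
have -> : (npow n (- (1 / 2)) / e) `^ q = npow n (- (q / 2)) * e^-1 `^ q.
  rewrite powRM ?npow_ge0 ?invr_ge0 ?(ltW e0)// -npowM; congr (npow n _ * _); lra.
by rewrite [npow _ _ * _]mulrC mulrA.
Qed.

(** Markov's inequality for the whole sum gives a probability of order #|N| s^2, whereas bounding
    every term by the largest would leave #|N| times a squared threshold. *)
Lemma sumsq_markov d (T : measurableType d) (R : realType) (P : probability T R)
    (Y : nat -> T -> R) (q M : R) (n : nat) (I : finType) (N : {set I})
    (a : I -> 'I_n -> R) (s e : R) :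
  2 <= q -> (forall i, measurable_fun setT (Y i)) -> mutually_independent P Y ->
  (forall i, \int[P]_w (Y i w)%:E = 0)%E ->
  (forall i, \int[P]_w (`|Y i w| `^ q)%:E <= M%:E)%E ->
  0 < s -> 0 < e -> (forall i, \sum_l a i l ^+ 2 <= s ^+ 2) ->
  exists2 B, measurable B & (P B <= (#|N|%:R * (mz_const R q M * s ^+ 2) / e)%:E)%E /\
    forall w, ~ B w -> \sum_(i in N) (\sum_l a i l * Y l w) ^+ 2 <= e.
Proof.
move=> q2 mY iY EY EYq s0 e0 as1.
have mS i : measurable_fun setT (fun w => \sum_l a i l * Y l w).
  by apply: measurable_sum => l; apply: measurable_funM.
have mS2 i : measurable_fun setT (fun w => (\sum_l a i l * Y l w) ^+ 2).
  exact: measurable_funX.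
have PS i : (\int[P]_w ((\sum_l a i l * Y l w) ^+ 2)%:E <= (mz_const R q M * s ^+ 2)%:E)%E.
  have := @linear_form_second_moment _ _ _ P Y q M (ord_ext _ _ (a i)) n s q2 mY iY EY EYq s0.
  under eq_bigr do rewrite ord_extE.
  under eq_integral do under eq_bigr do rewrite ord_extE.
  by apply; exact: as1.
pose S w := \sum_(i in N) (\sum_l a i l * Y l w) ^+ 2.
have mSS : measurable_fun setT S.
  rewrite /S; under eq_fun do rewrite -big_filter.
  exact: measurable_sum.
have mB : measurable [set w | e < S w].
  by apply: measurable_set_lt => //; exact: measurable_cst.
exists [set w | e < S w] => //; split; last by move=> w /negP; rewrite -leNgt.
have -> : P [set w | e < S w] = (\int[P]_w (\1_[set w | e < S w] w)%:E)%E.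
  by rewrite integral_indic// setIT.
apply: (@le_trans _ _ (\int[P]_w ((e^-1)%:E * (S w)%:E))%E).
  apply: ge0_le_integral => //.
  - by apply/measurable_EFinP; exact: measurable_indic.
  - by apply: measurable_funeM; exact/measurable_EFinP.
  - move=> w _; rewrite -EFinM lee_fin indicE.
    have S0 : 0 <= S w by apply: sumr_ge0 => i _; exact: sqr_ge0.
    have [|_] := boolP (w \in _); last by rewrite mulr_ge0 ?invr_ge0 ?(ltW e0).
    by rewrite inE /= => eS; rewrite mulrC ler_pdivlMr// mul1r ltW.
rewrite ge0_integralZl//;
  try by [exact/measurable_EFinP|rewrite lee_fin invr_ge0 ltW|
    move=> w _; rewrite lee_fin; apply: sumr_ge0 => i _; exact: sqr_ge0].
rewrite [X in (_ <= X%:E)%E]mulrC [X in (_ <= X)%E]EFinM; apply: lee_wpmul2l.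
  by rewrite lee_fin invr_ge0 ltW.
under eq_integral do rewrite -sumEFin -big_filter.
rewrite ge0_integral_sum//;
  try by [move=> i; exact/measurable_EFinP|move=> i w _; rewrite lee_fin sqr_ge0].
rewrite big_filter.
apply: (@le_trans _ _ (\sum_(i in N) (mz_const R q M * s ^+ 2)%:E)%E).
  by apply: lee_sum => i _; exact: PS.
by rewrite sumEFin lee_fin sumr_const mulr_natl.
Qed.

(** * Rates under the assumptions *)

(** rho / L^2 is O(n^-delta), and debiasing squares it. *)
Lemma bias_bigO (R : realType) (rho nt : nat -> R) (c eta delta at_ : R) :
  0 < c -> bigO_seq rho (fun n => npow n (2 * eta - delta)) ->
  bigO_seq nt (fun n => npow n at_) -> (forall n, 0 <= nt n) ->
  exists2 K : R, 0 < K & exists N, forall n, (N <= n)%N ->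
    (rho n / (c * npow n eta) ^+ 2) ^+ 2 * nt n <= K * npow n (at_ - 2 * delta).
Proof.
move=> c0 /bigO_npowP[Cr Cr0 [N1 h1]] /bigO_npowP[Ct Ct0 [N2 h2]] nt0.
exists ((Cr / c ^+ 2) ^+ 2 * Ct); first by rewrite mulr_gt0// exprn_gt0// divr_gt0// exprn_gt0.
exists (maxn 1 (maxn N1 N2)) => n; rewrite !geq_max => /and3P[n0 /h1 H1 /h2 H2].
have u0 : 0 < npow n eta by exact: npow_gt0.
have d0 : 0 < npow n (- delta) by exact: npow_gt0.
have cu : 0 < (c * npow n eta) ^+ 2 by rewrite exprn_gt0// mulr_gt0.
have E1 : npow n (2 * eta - delta) = npow n eta ^+ 2 * npow n (- delta).
  by rewrite [LHS]npowD// expr2 -[npow n eta * _]npowD//; congr (npow n _ * _); lra.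
have h3 : `|rho n / (c * npow n eta) ^+ 2| <= Cr / c ^+ 2 * npow n (- delta).
  rewrite normrM normfV (gtr0_norm cu) ler_pdivrMr//.
  apply: (le_trans H1); rewrite E1 exprMn le_eqVlt; apply/orP; left; apply/eqP.
  have : c != 0 by rewrite gt_eqF.
  by move: (npow n eta) (npow n (- delta)) => u dd cn0; field.
have E2 : npow n (at_ - 2 * delta) = npow n (- delta) ^+ 2 * npow n at_.
  by rewrite expr2 -!npowD//; congr (npow n _); lra.
rewrite E2 mulrACA; apply: ler_pM => //; first exact: sqr_ge0.
  rewrite -exprMn -real_normK ?num_real//; apply: lerXn2r => //.
  by rewrite nnegrE (le_trans _ h3).
by rewrite (le_trans (ler_norm _)).
Qed.

Lemma coord_tail_small (R : realType) (p : nat -> nat) (C c g Cb alpha nu eta m e : R) :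
  bigO_seq (fun n => (p n)%:R : R) (fun n => npow n alpha) -> 0 <= C ->
  0 < c -> 0 < g -> 0 < Cb -> 0 < m -> nu + alpha / m - eta < 0 -> 0 < e ->
  exists N, forall n, (N <= n)%N ->
    (p n)%:R * (C * ((c * npow n eta)^-1 / (g * (Cb * npow n (- nu)))) `^ m) <= e.
Proof.
move=> /bigO_npowP[Cp Cp0 [N1 h1]] C0 c0 g0 Cb0 m0 neg e0.
pose K := Cp * (C * ((c * (g * Cb))^-1) `^ m).
(* The union over [p] coordinates costs n^alpha and each tail is of order n^((nu - eta) m); the sum
   of the exponents is [m] times the assumed negative quantity. *)
have neg' : alpha + (nu - eta) * m < 0.
  have -> : alpha + (nu - eta) * m = (nu + alpha / m - eta) * m.
    by rewrite !mulrDl divfK ?gt_eqF//; ring.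
  by rewrite pmulr_llt0.
have [N2 h2] := npow_eventually_le _ _ K e neg' e0.
exists (maxn 1 (maxn N1 N2)) => n; rewrite !geq_max => /and3P[n0 /h1 H1 /h2 H2].
apply: le_trans H2.
have u0 : 0 < npow n eta by exact: npow_gt0.
have v0 : 0 < npow n (- nu) by exact: npow_gt0.
have -> : (c * npow n eta)^-1 / (g * (Cb * npow n (- nu))) =
    (c * (g * Cb))^-1 * npow n (nu - eta).
  have -> : npow n (nu - eta) = (npow n (- nu))^-1 * (npow n eta)^-1.
    by rewrite npowD// !npowN invrK.
  have [a1 a2 a3 a4 a5] : [/\ c != 0, g != 0, Cb != 0, npow n eta != 0 & npow n (- nu) != 0].
    by split; rewrite gt_eqF.
  by move: (npow n eta) (npow n (- nu)) a4 a5 => u v a4 a5; field; rewrite a1 a2 a3 a4 a5.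
have k0 : 0 <= (c * (g * Cb))^-1 by rewrite invr_ge0 !mulr_ge0 ?ltW.
rewrite powRM ?npow_ge0// -npowM /K.
have -> : npow n (alpha + (nu - eta) * m) = npow n alpha * npow n ((nu - eta) * m) by rewrite npowD.
have H1' : (p n)%:R <= Cp * npow n alpha by rewrite (le_trans (ler_norm _)).
set a := _ `^ m; have a0 : 0 <= a by exact: powR_ge0.
have w0 : 0 <= npow n ((nu - eta) * m) :> R by exact: npow_ge0.
apply: (@le_trans _ _ ((Cp * npow n alpha) * (C * (a * npow n ((nu - eta) * m))))).
  by rewrite ler_wpM2r// !mulr_ge0.
rewrite le_eqVlt; apply/orP; left; apply/eqP; ring.
Qed.

Lemma form_tail_small (R : realType) (p1 : nat -> nat) (C C1 CM c g eta m e : R) :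
  (exists N, forall n, (N <= n)%N -> (p1 n)%:R <= C1) -> 0 <= C -> 0 < CM ->
  0 < c -> 0 < g -> 0 < m -> 0 < eta -> 0 < e ->
  exists N, forall n, (N <= n)%N ->
    (p1 n)%:R * (C * (CM / (c * npow n eta) / g) `^ m) <= e.
Proof.
move=> [N1 h1] C0 CM0 c0 g0 m0 eta0 e0.
pose K := C1 * (C * (CM / c / g) `^ m).
have neg' : - eta * m < 0 by rewrite mulNr oppr_lt0 mulr_gt0.
have [N2 h2] := npow_eventually_le _ _ K e neg' e0.
exists (maxn 1 (maxn N1 N2)) => n; rewrite !geq_max => /and3P[n0 /h1 H1 /h2 H2].
apply: le_trans H2.
have u0 : 0 < npow n eta by exact: npow_gt0.
have -> : CM / (c * npow n eta) / g = CM / c / g * npow n (- eta).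
  rewrite npowN; have [a1 a2 a4] : [/\ c != 0, g != 0 & npow n eta != 0].
    by split; rewrite gt_eqF.
  by move: (npow n eta) a4 => u a4; field; rewrite a1 a2 a4.
have k0 : 0 <= CM / c / g by rewrite !divr_ge0 ?ltW.
rewrite powRM ?npow_ge0// -npowM /K.
set a := _ `^ m; have a0 : 0 <= a by exact: powR_ge0.
have w0 : 0 <= npow n (- eta * m) :> R by exact: npow_ge0.
apply: (@le_trans _ _ (C1 * (C * (a * npow n (- eta * m))))).
  by rewrite ler_wpM2r// !mulr_ge0.
rewrite le_eqVlt; apply/orP; left; apply/eqP; ring.
Qed.

Lemma card_bigO (R : realType) (k : nat -> nat) (eta a : R) :
  bigO_seq (fun n => Num.sqrt (k n)%:R / npow n eta : R) (fun n => npow n (- a)) ->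
  exists2 K : R, 0 < K & exists N, forall n, (N <= n)%N ->
    (k n)%:R <= K * npow n (2 * eta - 2 * a).
Proof.
move=> /bigO_npowP[C C0 [N h]].
exists (C ^+ 2); first exact: exprn_gt0.
exists (maxn 1 N) => n; rewrite geq_max => /andP[n0 /h H].
have u0 : 0 < npow n eta by exact: npow_gt0.
rewrite normrM normfV (gtr0_norm u0) ler_pdivrMr// ger0_norm ?sqrtr_ge0// in H.
rewrite -[leLHS]sqr_sqrtr ?ler0n//.
have -> : C ^+ 2 * npow n (2 * eta - 2 * a) = (C * npow n (- a) * npow n eta) ^+ 2.
  rewrite !exprMn -mulrA; congr (_ * _); rewrite !expr2 -!npowD//; congr (npow n _); lra.
by apply: lerXn2r => //; rewrite nnegrE ?sqrtr_ge0// !mulr_ge0 ?npow_ge0 ?ltW.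
Qed.

(** The bound on the size of the active set pays for any sequence of order n^(-eta), with n^(-2a) to
    spare; it serves both the bias and the noise scale. *)
Lemma card_sumsq_small (R : realType) (k : nat -> nat) (B : nat -> R) (eta a Kb x e : R) :
  (exists2 K : R, 0 < K & exists N, forall n, (N <= n)%N ->
    (k n)%:R <= K * npow n (2 * eta - 2 * a)) ->
  (exists N, forall n, (N <= n)%N -> 0 <= B n /\ B n <= Kb * npow n x) ->
  0 < a -> x <= - eta -> 0 < e ->
  exists N, forall n, (N <= n)%N -> (k n)%:R * B n ^+ 2 <= e.
Proof.
move=> [K K0 [N1 h1]] [N2 h2] a0 xe e0.
have neg' : - (2 * a) < 0 by rewrite oppr_lt0 mulr_gt0.
have [N3 h3] := npow_eventually_le _ _ (K * Kb ^+ 2) e neg' e0.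
exists (maxn 1 (maxn N1 (maxn N2 N3))) => n.
rewrite !geq_max => /and4P[n0 /h1 H1 /h2[B0 H2] /h3 H3].
apply: le_trans H3.
apply: (@le_trans _ _ (K * npow n (2 * eta - 2 * a) * (Kb * npow n x) ^+ 2)).
  apply: ler_pM => //; first exact: sqr_ge0.
  by apply: lerXn2r => //; rewrite nnegrE// (le_trans B0).
have -> : K * npow n (2 * eta - 2 * a) * (Kb * npow n x) ^+ 2 =
    K * Kb ^+ 2 * (npow n (2 * eta - 2 * a) * npow n x ^+ 2) by rewrite exprMn; ring.
apply: ler_wpM2l; first by apply: mulr_ge0; [exact: ltW|exact: sqr_ge0].
by rewrite expr2 -!npowD//; apply: npow_le => //; lra.
Qed.

Lemma littleo_inv_sqrt_small (R : realType) (u : nat -> R) (e : R) :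
  littleo_seq u (fun n => (Num.sqrt (n%:R * ln n%:R))^-1) -> 0 < e ->
  exists N, forall n, (N <= n)%N -> `|u n| <= e.
Proof.
move=> h e0; have [N hN] := h e e0.
exists (maxn 2 N) => n; rewrite geq_max => /andP[n2 /hN] H.
apply: (le_trans H); rewrite ler_piMr ?(ltW e0)//.
have n2R : 2 <= n%:R :> R by rewrite ler_nat.
have n0 : 0 < n%:R :> R by lra.
(* [ln x <= x - 1] at x = 1/n gives n ln n >= n - 1 >= 1, so the rate is at most 1. *)
have lnn : 1 <= n%:R * ln n%:R :> R.
  have k1 : - ln n%:R <= n%:R^-1 - 1 :> R.
    have : ln (1 + (n%:R^-1 - 1)) <= n%:R^-1 - 1 :> R.
      by apply: le_ln1Dx; have : 0 < n%:R^-1 :> R; [rewrite invr_gt0|lra].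
    by rewrite addrCA subrr addr0 lnV ?posrE.
  have k2 : n%:R * (1 - n%:R^-1) <= n%:R * ln n%:R :> R by rewrite ler_pM2l//; lra.
  rewrite mulrBr mulr1 divff ?gt_eqF// in k2; lra.
have s1 : 1 <= Num.sqrt (n%:R * ln n%:R) :> R.
  by rewrite -[leLHS]sqrtr1; apply: ler_wsqrtr.
by rewrite ger0_norm ?invr_ge0 ?sqrtr_ge0// invf_le1// (lt_le_trans ltr01).
Qed.

Lemma mulmx_row_form (R : realType) (p r : nat) (Q : 'M[R]_(p, r)) (w : 'cV[R]_r) (j : 'I_p) :
  (Q *m w) j 0 = (row j Q *m w) 0 0.
Proof.
by rewrite [LHS]mxE [RHS]mxE; apply: eq_bigr => k _; congr (_ * _); rewrite mxE.
Qed.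

Lemma phi_exp_modulus (R : realType) (F : R -> R) (e t x y : R) (k : nat) :
  (forall x, 0 <= F x <= 1) -> (forall x y, `|x - y| <= t -> `|F x - F y| <= e) ->
  `|x - y| <= t ->
  `|(Num.max 0 (F x - F (- x))) ^+ k - (Num.max 0 (F y - F (- y))) ^+ k| <= k%:R * (2 * e).
Proof.
move=> F01 Ft xy; set a := Num.max 0 (F x - _); set b := Num.max 0 _.
have Phi01 z : 0 <= Num.max 0 (F z - F (- z)) <= 1.
  rewrite le_max lexx/= ge_max ler01/=.
  by have /andP[? ?] := F01 z; have /andP[? ?] := F01 (- z); lra.
have -> : a ^+ k = \prod_(i < k) a by rewrite prodr_const card_ord.
apply: prod_sub_exp_le => [|_|_]; [exact: Phi01|exact: Phi01|].
have := Ft _ _ xy; have := Ft (- x) (- y); rewrite -opprD normrN => /(_ xy).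
rewrite /a /b !ler_norml => /andP[a1 a2] /andP[b1 b2].
rewrite /Num.max; case: ifPn => c1; case: ifPn => c2; apply/andP; split; lra.
Qed.

(** * Laws of large numbers for squares and indicators *)

Lemma integrable_of_moment d (T : measurableType d) (R : realType) (P : probability T R)
    (f g : T -> R) (q M : R) :
  measurable_fun setT f -> measurable_fun setT g ->
  (\int[P]_w (`|f w| `^ q)%:E <= M%:E)%E -> (forall w, `|g w| <= 1 + `|f w| `^ q) ->
  P.-integrable setT (EFin \o g).
Proof.
move=> mf mg fM gf.
have mfq : measurable_fun setT (fun w => `|f w| `^ q) by exact: measurable_normpow.
have i1 : P.-integrable setT (EFin \o (fun _ : T => 1 : R)).
  exact: finite_measure_integrable_cst.
have ifq : P.-integrable setT (EFin \o (fun w => `|f w| `^ q)).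
  apply/integrableP; split; first exact/measurable_EFinP.
  under eq_integral do rewrite /= ger0_norm ?powR_ge0//.
  by rewrite (le_lt_trans fM)// ltry.
apply: (@le_integrable _ _ _ P _ measurableT _ (fun w => (1 + `|f w| `^ q)%:E)) => //.
- exact/measurable_EFinP.
- by move=> w _ /=; rewrite lee_fin (ger0_norm (addr_ge0 _ _)) ?powR_ge0.
- exact: (integrableD measurableT i1 ifq).
Qed.

(** The centered squares have a moment of order [m / 2], and [4 < m] makes this order at least 2, as
    [lln_whp] requires. *)
Lemma lln_square d (T : measurableType d) (R : realType) (P : probability T R)
    (Y : nat -> T -> R) (m M : R) :
  4 < m -> (forall i, measurable_fun setT (Y i)) -> mutually_independent P Y ->
  (forall k B, measurable B -> P (Y k @^-1` B) = P (Y 0%N @^-1` B)) ->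
  (\int[P]_w (`|Y 0%N w| `^ m)%:E <= M%:E)%E ->
  exists2 S : R, 0 <= S &
    whp _ _ _ P (fun n => [set w | n%:R^-1 * \sum_(i < n) Y i w ^+ 2 <= S + 1]).
Proof.
move=> m4 mY iY law YM.
have mY2 : measurable_fun setT (fun w => Y 0%N w ^+ 2) by exact: measurable_funX.
have iY2 : P.-integrable setT (EFin \o (fun w => Y 0%N w ^+ 2)).
  apply: (@integrable_of_moment _ _ _ P (Y 0%N) _ m M) => // w.
  rewrite ger0_norm ?sqr_ge0// -real_normK ?num_real// -powR_mulrn//.
  by apply: powR_le1D => //; lra.
have fY2 := integrable_fin_num measurableT iY2.
pose S := fine (\int[P]_w (Y 0%N w ^+ 2)%:E).
have S0 : 0 <= S.
  by apply: fine_ge0; apply: integral_ge0 => w _; rewrite lee_fin sqr_ge0.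
have SE : (\int[P]_w (Y 0%N w ^+ 2)%:E = S%:E)%E by rewrite /S fineK.
exists S => //.
pose g (x : R) := x ^+ 2 - S.
have mg : measurable_fun setT g.
  by apply: measurable_funB => //; exact: measurable_funX.
pose W i := g \o Y i.
have mW i : measurable_fun setT (W i) by exact: measurableT_comp.
have iW : mutually_independent P W by exact: (@mutually_independent_comp _ _ _ _ P Y (fun=> g)).
have EW i : (\int[P]_w (W i w)%:E = 0)%E.
  rewrite (@integral_eq_law _ _ _ _ _ P P (Y i) (Y 0%N) g)//; last exact: law.
  rewrite /g; under eq_integral do rewrite EFinB.
  rewrite integralB//; last exact: finite_measure_integrable_cst.
  by rewrite SE integral_cst_prob subee.
(* |x^2 - S| is at most twice the larger of x^2 and S; adding both powers covers the two cases. *)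
pose M2 := 2 `^ (m / 2) * (M + S `^ (m / 2)).
have m2 : 0 <= m / 2 by lra.
have key (x : R) : `|g x| `^ (m / 2) <= 2 `^ (m / 2) * (`|x| `^ m + S `^ (m / 2)).
  have x20 : 0 <= x ^+ 2 by exact: sqr_ge0.
  have xm : (x ^+ 2) `^ (m / 2) = `|x| `^ m.
    rewrite -real_normK ?num_real// -powR_mulrn// -powRrM.
    by congr (_ `^ _); lra.
  have h (u v : R) : 0 <= u -> u <= v -> (2 * v) `^ (m / 2) = 2 `^ (m / 2) * v `^ (m / 2) ->
      `|g x| <= 2 * v -> `|g x| `^ (m / 2) <= 2 `^ (m / 2) * v `^ (m / 2).
    move=> u0 uv <- gv; apply: ge0_ler_powR => //; rewrite nnegrE//.
    by rewrite mulr_ge0// (le_trans u0).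
  have p2 : 0 <= 2 `^ (m / 2) :> R by exact: powR_ge0.
  have gb : `|g x| <= x ^+ 2 + S.
    by rewrite /g (le_trans (ler_normB _ _))// !ger0_norm.
  have [xS|Sx] := leP (x ^+ 2) S.
    apply: (le_trans (h _ _ x20 xS _ _)); [by rewrite powRM|lra|].
    by rewrite ler_wpM2l// lerDr powR_ge0.
  apply: (le_trans (h _ _ S0 (ltW Sx) _ _)); [by rewrite powRM|lra|].
  by rewrite xm ler_wpM2l// lerDl powR_ge0.
have W2 i : (\int[P]_w (`|W i w| `^ (m / 2))%:E <= M2%:E)%E.
  rewrite (@integral_eq_law _ _ _ _ _ P P (Y i) (Y 0%N) (fun x => `|g x| `^ (m / 2)))//;
    [|exact: measurable_normpow|exact: law].
  have mYm : measurable_fun setT (fun w => `|Y 0%N w| `^ m) by exact: measurable_normpow.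
  apply: (@le_trans _ _ (\int[P]_w ((2 `^ (m / 2))%:E *
     ((`|Y 0%N w| `^ m)%:E + (S `^ (m / 2))%:E)))%E).
    apply: ge0_le_integral => //.
    - apply/measurable_EFinP; apply: measurable_normpow.
      exact: (measurableT_comp mg (mY 0%N)).
    - apply: measurable_funeM; apply: emeasurable_funD; apply/measurable_EFinP => //.
    - by move=> w _; rewrite -EFinD -EFinM lee_fin key.
  rewrite ge0_integralZl//;
    try by [move=> w _; rewrite -EFinD lee_fin addr_ge0// powR_ge0|rewrite lee_fin powR_ge0|
            apply: emeasurable_funD; apply/measurable_EFinP].
  rewrite /M2 EFinM; apply: lee_wpmul2l; first by rewrite lee_fin powR_ge0.
  rewrite ge0_integralD//;
    try by [move=> w _; rewrite lee_fin powR_ge0|apply/measurable_EFinP].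
  by rewrite integral_cst_prob EFinD leeD2r.
have q2 : 2 <= m / 2 by lra.
have := @lln_whp _ _ _ P W (m / 2) M2 1 q2 mW iW EW W2 ltr01.
move=> h; apply: (@whp_imp _ _ _ P _ _ 1%N h) => n n0 w /=.
have n0R : n%:R != 0 :> R by rewrite pnatr_eq0 -lt0n.
rewrite /W /g /= sumrB sumr_const card_ord -[S *+ n]mulr_natl mulrBr mulKf//.
by rewrite ler_norml => /andP[_]; rewrite lerBlDl.
Qed.

(** Centered indicators are bounded by 1, so the moment bound holds with [q = 2] and [M = 1]. *)
Lemma lln_indicator d (T : measurableType d) (R : realType) (P : probability T R)
    (Y : nat -> T -> R) (u e : R) :
  (forall i, measurable_fun setT (Y i)) -> mutually_independent P Y ->
  (forall k B, measurable B -> P (Y k @^-1` B) = P (Y 0%N @^-1` B)) -> 0 < e ->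
  whp _ _ _ P (fun n => [set w |
    `|Fhat (\col_(i < n) Y i w) u - fine (P [set w | Y 0%N w <= u])| <= e]).
Proof.
move=> mY iY law e0.
set p := fine (P [set w | Y 0%N w <= u]).
have mle : measurable [set w | Y 0%N w <= u].
  by apply: measurable_set_le => //; exact: measurable_cst.
have p01 : 0 <= p <= 1 by rewrite /p fine_prob_ge0 fine_prob_le1.
pose g (x : R) := \1_[set x | x <= u] x - p.
have mI : measurable [set x : R | x <= u].
  by apply: measurable_set_le => //; exact: measurable_cst.
have mg : measurable_fun setT g.
  by apply: measurable_funB => //; exact: measurable_indic.
pose W i := g \o Y i.
have mW i : measurable_fun setT (W i) by exact: measurableT_comp.
have iW : mutually_independent P W by exact: (@mutually_independent_comp _ _ _ _ P Y (fun=> g)).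
have iI : P.-integrable setT (EFin \o (\1_[set w | Y 0%N w <= u] : T -> R)).
  exact: integrable_indic.
have EW i : (\int[P]_w (W i w)%:E = 0)%E.
  rewrite (@integral_eq_law _ _ _ _ _ P P (Y i) (Y 0%N) g)//; last exact: law.
  transitivity (\int[P]_w ((\1_[set w | Y 0%N w <= u] w)%:E - p%:E))%E.
    by apply: eq_integral => w _; rewrite -EFinB.
  rewrite integralB//; last exact: finite_measure_integrable_cst.
  rewrite integral_cst_prob integral_indic// setIT /p fineK ?fin_num_measure//.
  by rewrite subee// fin_num_measure.
have W2 i : (\int[P]_w (`|W i w| `^ 2)%:E <= 1%:E)%E.
  rewrite -[leRHS](integral_cst_prob _ _ _ P 1); apply: ge0_le_integral => //.
  - apply/measurable_EFinP; exact: measurable_normpow.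
  - move=> w _; rewrite lee_fin powR_mulrn// expr_le1// /W /g /= indicE ler_norml.
    have /andP[? ?] := p01; case: (_ \in _); rewrite /=; apply/andP; split; lra.
have := @lln_whp _ _ _ P W 2 1 e (lexx 2) mW iW EW W2 e0.
move=> h; apply: (@whp_imp _ _ _ P _ _ 1%N h) => n n0 w /=.
have n0R : n%:R != 0 :> R by rewrite pnatr_eq0 -lt0n.
rewrite /W /g /= sumrB sumr_const card_ord -[p *+ n]mulr_natl mulrBr mulKf//.
rewrite /Fhat; congr (`|_ * _ - _| <= _); apply: eq_bigr => i _.
by rewrite mxE indicE mem_setE.
Qed.

(** * Conditional laws given the sample *)

(** Given the sample, the shift [Xf *m beta - Xf *m theta_hat] is a constant, so the exceptional
    event is empty. *)
Lemma true_prob_close d (T : measurableType d) (R : realType) (P : probability T R)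
    (n p p1 r : nat) (X : 'M[R]_(n, p)) (Xf : 'M[R]_(p1, p)) (Q : 'M[R]_(p, r))
    (lam : 'rV[R]_r) (rho b : R) (beta : 'cV[R]_p) (y : 'cV[R]_n)
    (Y : nat -> T -> R) (F : R -> R) (e t : R) :
  (0 < p1)%N -> (forall i, measurable_fun setT (Y i)) -> mutually_independent P Y ->
  {homo F : x y / x <= y} -> (forall x, 0 <= F x <= 1) -> 0 < t ->
  (forall x y, `|x - y| <= t -> `|F x - F y| <= e) ->
  (forall i x, fine (P [set w | Y i w <= x]) = F x) ->
  (forall i, `|(Xf *m beta - Xf *m theta_hat X Q lam rho b y) i 0| <= t) ->
  forall x, `|fine (P [set w | colmaxabs (pred_err X Xf Q lam rho b beta y
                                  (\col_(i < p1) Y i w)) <= x]) -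
              (Num.max 0 (F x - F (- x))) ^+ p1| <= (5 * p1%:R + 1) * e.
Proof.
move=> p10 mY iY Fm F01 t0 Ft YF sh x.
have e0 : 0 <= e.
  by apply: (le_trans (normr_ge0 (F 0 - F 0))); apply: Ft; rewrite subrr normr0 ltW.
pose D (i : 'I_p1) (w : T) := (Xf *m beta - Xf *m theta_hat X Q lam rho b y) i 0.
have := @max_abs_prob_close _ _ _ P Y F e t p1 D set0 mY iY Fm F01 t0 Ft.
have -> : [set w | colmaxabs (pred_err X Xf Q lam rho b beta y (\col_(i < p1) Y i w)) <= x] =
    [set w | forall i : 'I_p1, `|Y i w + D i w| <= x].
  have E w (i : 'I_p1) : pred_err X Xf Q lam rho b beta y (\col_(i < p1) Y i w) i 0 =
      Y i w + D i w.
    rewrite /pred_err /D !col_subE col_addE [X in _ + X - _]mxE; ring.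
  apply/seteqP; split => w /=; rewrite (colmaxabs_leP _ _ _ _ p10) => h i;
    by have := h i; rewrite E.
apply => //.
- by move=> i z; rewrite YF subrr normr0.
- by move=> i; exact: measurable_cst.
- by rewrite measure0.
- by move=> w i _; exact: sh.
Qed.

(** Off [B1] bootstrap selection returns [N]; off [B2] the linear form in the prediction is at most
    [t]. Each budget is halved between noise and bias, and the noise half is divided by [K] because
    the errors are [z] times a standard deviation of at most [K]. *)
Lemma boot_prob_close d (T : measurableType d) (R : realType) (P : probability T R)
    (n p p1 r : nat) (X : 'M[R]_(n, p)) (Xf : 'M[R]_(p1, p)) (Pm : 'M[R]_(n, r))
    (Q : 'M[R]_(p, r)) (lam : 'rV[R]_r) (Qp : 'M[R]_(p, p - r)) (rho b : R) (y : 'cV[R]_n)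
    (N : {set 'I_p}) (Z V : nat -> T -> R) (F : R -> R) (q MZ L k M CM K e t : R) :
  let th := theta_hat X Q lam rho b y in
  let bias := (rho / L ^+ 2) ^+ 2 * M in
  X = Pm *m diag_mx lam *m Q^T -> Pm^T *m Pm = 1%:M -> Q^T *m Q = 1%:M ->
  Qp^T *m Qp = 1%:M -> Q^T *m Qp = 0 -> Q *m Q^T + Qp *m Qp^T = 1%:M ->
  0 < rho -> 0 < L -> (forall i, L <= lam 0 i) -> (0 < n)%N -> (0 < p1)%N -> 0 < b ->
  2 <= q -> (forall i, measurable_fun setT (Z i)) -> mutually_independent P Z ->
  (forall i, \int[P]_w (Z i w)%:E = 0)%E ->
  (forall i, \int[P]_w (`|Z i w| `^ q)%:E <= MZ%:E)%E ->
  (forall i, measurable_fun setT (V i)) -> mutually_independent P V ->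
  (forall i B, measurable B -> P (V i @^-1` B) = uniform_prob (@ltr01 R) B) ->
  {homo F : x y / x <= y} -> (forall x, 0 <= F x <= 1) -> 0 < t ->
  (forall x y, `|x - y| <= t -> `|F x - F y| <= e) ->
  (forall x, `|Fhat (centered_resid X th y) x - F x| <= e) ->
  0 < k -> k <= 1 ->
  (forall j, j \notin N -> th j 0 = 0) ->
  (forall j, j \in N -> b + k * b < `|th j 0|) ->
  0 <= M -> \sum_i (Q^T *m th) i 0 ^+ 2 <= M ^+ 2 -> bias <= k * b / 2 ->
  0 < CM -> (forall i, \sum_l cmat Xf Q N i l ^+ 2 <= CM ^+ 2) -> CM * bias <= t / 2 ->
  0 < K -> Num.sqrt (sigma_hat2 X th y) <= K ->
  p%:R * (mz_const R q MZ * (L^-1 / (k * b / 2 / K)) `^ q) +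
  p1%:R * (mz_const R q MZ * (CM / L / (t / 2 / K)) `^ q) <= e ->
  forall x, `|fine (P [set w | colmaxabs (boot_pred_err X Xf Q lam Qp rho b y
                      (\col_(i < n) Z i w) (\col_(i < p1) V i w)) <= x]) -
              (Num.max 0 (F x - F (- x))) ^+ p1| <= (5 * p1%:R + 1) * e.
Proof.
move=> th bias XE PP QQ QpQp QQp one rho0 L0 Ll n0 p10 b0 q2 mZ iZ EZ EZq mV iV lawV.
move=> Fm F01 t0 Ft FhF k0 k1 thN thk M0 thM biask CM0 cCM CMbias K0 sK tails x.
set ssig := Num.sqrt _ in sK.
have ssig0 : 0 <= ssig by exact: sqrtr_ge0.
have s10 : 0 < L^-1 by rewrite invr_gt0.
have s20 : 0 < CM / L by rewrite divr_gt0.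
have t10 : 0 < k * b / 2 / K by rewrite !divr_gt0// mulr_gt0.
have t20 : 0 < t / 2 / K by rewrite !divr_gt0.
have [j|B1 mB1 [PB1 hB1]] := @union_tail _ _ _ P Z q MZ n 'I_p
  (fun j l => noise_form _ _ _ Pm lam rho (row j Q) 0 l) _ _ q2 mZ iZ EZ EZq s10 t10.
  apply: (le_trans (@noise_form_sumsq _ _ _ Pm lam rho L (row j Q) PP rho0 L0 Ll)).
  rewrite exprVn -[leRHS]mul1r ler_wpM2r ?invr_ge0 ?sqr_ge0//.
  under eq_bigr do rewrite mxE; exact: (@row_sumsq_le1 _ _ _ Q Qp).
have [i|B2 mB2 [PB2 hB2]] := @union_tail _ _ _ P Z q MZ n 'I_p1
  (fun i l => noise_form _ _ _ Pm lam rho (row i (cmat Xf Q N)) 0 l) _ _ q2 mZ iZ EZ EZq s20 t20.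
  apply: (le_trans (@noise_form_sumsq _ _ _ Pm lam rho L (row i (cmat Xf Q N)) PP rho0 L0 Ll)).
  rewrite exprMn exprVn ler_wpM2r ?invr_ge0 ?sqr_ge0//.
  by under eq_bigr do rewrite mxE; exact: cCM.
pose zc w : 'cV[R]_n := \col_(i < n) Z i w.
pose wv w := coord_err _ _ _ _ Pm Q lam rho th (ssig *: zc w).
have noiseK (c : 'rV[R]_r) w u : 0 <= u ->
    `|\sum_l noise_form _ _ _ Pm lam rho c 0 l * Z l w| <= u / K ->
    `|\sum_l noise_form _ _ _ Pm lam rho c 0 l * (ssig *: zc w) l 0| <= u.
  move=> u0 h.
  have -> : \sum_l noise_form _ _ _ Pm lam rho c 0 l * (ssig *: zc w) l 0 =
     ssig * \sum_l noise_form _ _ _ Pm lam rho c 0 l * Z l w.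
    by rewrite mulr_sumr; apply: eq_bigr => l _; rewrite !mxE mulrCA.
  rewrite normrM (ger0_norm ssig0) (@le_trans _ _ (K * (u / K)))//; last first.
    by rewrite mulrC divfK// gt_eqF.
  by apply: ler_pM.
have bias0 : 0 <= bias by rewrite /bias mulr_ge0// sqr_ge0.
have QW w j : ~ B1 w -> `|(Q *m wv w) j 0| <= k * b.
  move=> Bw.
  rewrite mulmx_row_form.
  have r1 : \sum_i row j Q 0 i ^+ 2 <= 1 ^+ 2.
    by rewrite expr1n; under eq_bigr do rewrite mxE; exact: (@row_sumsq_le1 _ _ _ Q Qp).
  apply: (le_trans (@coord_err_form_le _ _ _ _ Pm Q lam rho L 1 M th _ _ rho0 L0 Ll ler01 M0 r1 thM)).
  rewrite mul1r -/bias.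
  have kb2 : 0 <= k * b / 2 by rewrite divr_ge0// mulr_ge0 ?ltW.
  have := noiseK (row j Q) w _ kb2 (hB1 w Bw j); move: biask; lra.
have CW w i : ~ B2 w -> `|(row i (cmat Xf Q N) *m wv w) 0 0| <= t.
  move=> Bw.
  have r1 : \sum_l row i (cmat Xf Q N) 0 l ^+ 2 <= CM ^+ 2.
    by under eq_bigr do rewrite mxE; exact: cCM.
  apply: (le_trans (@coord_err_form_le _ _ _ _ Pm Q lam rho L CM M th _ _ rho0 L0 Ll (ltW CM0) M0 r1 thM)).
  rewrite -/bias.
  have t2 : 0 <= t / 2 by rewrite divr_ge0// ltW.
  have := noiseK (row i (cmat Xf Q N)) w _ t2 (hB2 w Bw i); move: CMbias; lra.
have kb : k * b <= b by rewrite ler_piMl// ltW.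
have shift w i : ~ (B1 `|` B2) w ->
    boot_pred_err X Xf Q lam Qp rho b y (zc w) (\col_(i < p1) V i w) i 0 =
    Fhat_quantile (centered_resid X th y) (V i w) - (row i (cmat Xf Q N) *m wv w) 0 0.
  rewrite not_orP => -[nB1 nB2].
  rewrite (@boot_shift _ _ _ _ _ X Xf Pm Q lam Qp rho b y (zc w) _ N i)//.
  - by rewrite mxE.
  - move=> j jN; rewrite col_addE -/th thN// add0r.
    by apply: le_trans kb; exact: QW.
  - move=> j jN; rewrite col_addE -/th -/ssig -/(wv w).
    have := QW w j nB1; have := thk j jN.
    have := ler_normB (th j 0 + (Q *m wv w) j 0) ((Q *m wv w) j 0).
    rewrite addrK; lra.
pose Y i w := Fhat_quantile (centered_resid X th y) (V i w).
have mq : measurable_fun setT (Fhat_quantile (centered_resid X th y)).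
  apply: (@measurable_Fhat_quantile _ _ _ _ (fun=> centered_resid X th y)) => //.
have mY i : measurable_fun setT (Y i) by exact: (measurableT_comp mq (mV i)).
have iY : mutually_independent P Y.
  exact: (@mutually_independent_comp _ _ _ _ P V (fun=> Fhat_quantile (centered_resid X th y))).
have mboot i : measurable_fun setT (fun w =>
    boot_pred_err X Xf Q lam Qp rho b y (zc w) (\col_(i < p1) V i w) i 0).
  apply: entrywise_boot_pred_err => //.
  - by apply: entrywise_col => l; exact: mZ.
  - by apply: entrywise_col => l; exact: mV.
(* Taken as a difference everywhere, which keeps it measurable; its explicit form is used only off
   the bad events. *)
pose D (i : 'I_p1) w := boot_pred_err X Xf Q lam Qp rho b y (zc w) (\col_(i < p1) V i w) i 0 - Y i w.
have := @max_abs_prob_close _ _ _ P Y F e t p1 D (B1 `|` B2) mY iY Fm F01 t0 Ft.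
have -> : [set w | colmaxabs (boot_pred_err X Xf Q lam Qp rho b y
     (\col_(i < n) Z i w) (\col_(i < p1) V i w)) <= x] =
    [set w | forall i : 'I_p1, `|Y i w + D i w| <= x].
  apply/seteqP; split => w /=; rewrite (colmaxabs_leP _ _ _ _ p10) => h i;
    by have := h i; rewrite /D addrCA subrr addr0.
apply => //.
- by move=> i z; rewrite /Y (@Fhat_quantile_cdf _ _ _ P (V i))//; exact: lawV.
- by move=> i; apply: measurable_funB.
- exact: measurableU.
- apply: le_trans tails.
  rewrite -lee_fin fineK ?fin_num_measure//; last exact: measurableU.
  apply: (le_trans (measureU2 P mB1 mB2)); rewrite EFinD.
  by rewrite !card_ord in PB1 PB2; exact: leeD.
- by move=> w i Bw; rewrite /D shift// /Y addrAC subrr add0r normrN CW// => h; apply: Bw; right.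
Qed.

(* Here n and the realisation ev of the errors are fixed, and P plays the role of
   Prob^*; [K] bounds the estimated standard deviation. *)
Lemma fixed_n_close d (T : measurableType d) (R : realType) (P : probability T R)
    (n p p1 r : nat) (X : 'M[R]_(n, p)) (Xf : 'M[R]_(p1, p)) (Pm : 'M[R]_(n, r))
    (Q : 'M[R]_(p, r)) (lam : 'rV[R]_r) (Qp : 'M[R]_(p, p - r)) (rho b : R)
    (beta : 'cV[R]_p) (ev : 'cV[R]_n) (Ef Z V : nat -> T -> R) (F : R -> R)
    (q MZ L CU cb CM S K e t e3 e5 : R) :
  let th0 := theta_of Q beta in
  let N := activeN b th0 in
  let k := (1 - cb) / 2 in
  let bias := (rho / L ^+ 2) ^+ 2 * norm2 th0 in
  let y := X *m beta + ev in
  X = Pm *m diag_mx lam *m Q^T -> Pm^T *m Pm = 1%:M -> Q^T *m Q = 1%:M ->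
  Qp^T *m Qp = 1%:M -> Q^T *m Qp = 0 -> Q *m Q^T + Qp *m Qp^T = 1%:M ->
  0 < rho -> 0 < L -> (forall i, L <= lam 0 i) -> 0 < CU ->
  (forall i, lam 0 i <= CU * Num.sqrt n%:R) ->
  (0 < n)%N -> (0 < p1)%N -> 0 < b -> 0 < cb -> cb < 1 ->
  (forall j, j \notin N -> `|th0 j 0| <= cb * b) ->
  (forall j, j \in N -> b / cb <= `|th0 j 0|) ->
  2 <= q -> (forall i, measurable_fun setT (Z i)) -> mutually_independent P Z ->
  (forall i, \int[P]_w (Z i w)%:E = 0)%E ->
  (forall i, \int[P]_w (`|Z i w| `^ q)%:E <= MZ%:E)%E ->
  (forall i, measurable_fun setT (V i)) -> mutually_independent P V ->
  (forall i B, measurable B -> P (V i @^-1` B) = uniform_prob (@ltr01 R) B) ->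
  (forall i, measurable_fun setT (Ef i)) -> mutually_independent P Ef ->
  (forall i x, fine (P [set w | Ef i w <= x]) = F x) ->
  {homo F : x y / x <= y} -> (forall x, 0 <= F x <= 1) -> 0 < t -> 0 < e ->
  (forall x y, `|x - y| <= t -> `|F x - F y| <= e / 4) ->
  (forall x, `|Fhat ev x - F x| <= 2 * (e / 4)) ->
  (forall j, `|\sum_l noise_form _ _ _ Pm lam rho (row j Q) 0 l * ev l 0| <= k * b / 2) ->
  (forall i, `|\sum_l noise_form _ _ _ Pm lam rho (row i (cmat Xf Q N)) 0 l * ev l 0| <= t / 4) ->
  \sum_(j in N) (\sum_l noise_form _ _ _ Pm lam rho (row j Q) 0 l * ev l 0) ^+ 2 <= e3 ->
  n%:R^-1 * \sum_i ev i 0 ^+ 2 <= S + 1 -> `|n%:R^-1 * \sum_i ev i 0| <= e5 ->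
  bias <= k / 4 * b -> 0 < CM -> CM * bias <= t / 4 ->
  (forall i, \sum_l cmat Xf Q N i l ^+ 2 <= CM ^+ 2) ->
  #|N|%:R * bias ^+ 2 <= e3 -> cb * (b * \sum_(j in ~: N) `|th0 j 0|) <= e3 ->
  colmaxabs (\col_(i < p1) \sum_(j in ~: N) Xf i j * th0 j 0) <= t / 4 ->
  colmaxabs (Xf *m theta_perp_of Qp beta) <= t / 4 ->
  10 * CU ^+ 2 * e3 + 2 * e5 ^+ 2 <= t ^+ 2 * (e / 4) ->
  1 <= K -> 2 * (S + 1) + 10 * CU ^+ 2 * e3 <= K ->
  p%:R * (mz_const R q MZ * (L^-1 / (k * b / 2 / K)) `^ q) +
  p1%:R * (mz_const R q MZ * (CM / L / (t / 2 / K)) `^ q) <= e ->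
  (forall x, `|fine (P [set w | colmaxabs (boot_pred_err X Xf Q lam Qp rho b y
                      (\col_(i < n) Z i w) (\col_(i < p1) V i w)) <= x]) -
              (Num.max 0 (F x - F (- x))) ^+ p1| <= (5 * p1%:R + 1) * e) /\
  (forall x, `|fine (P [set w | colmaxabs (pred_err X Xf Q lam rho b beta y
                                  (\col_(i < p1) Ef i w)) <= x]) -
              (Num.max 0 (F x - F (- x))) ^+ p1| <= (5 * p1%:R + 1) * e).
Proof.
move=> th0 N k bias y XE PP QQ QpQp QQp one rho0 L0 Ll CU0 lU n0 p10 b0 cb0 cb1 thout thin.
move=> q2 mZ iZ EZ EZq mV iV lawV mE iE lawE Fm F01 t0 e0 Ft4 FhF nz1 nz2 nz3 ev2 ev1.
move=> bk CM0 CMb cCM Nb offb cm1 cm2 small K1 KS tails.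
have k0 : 0 < k by rewrite /k; move: cb1; clear; lra.
have k1 : k <= 1 by rewrite /k; move: cb0; clear; lra.
have n20 : 0 <= norm2 th0 by exact: sqrtr_ge0.
have bias0 : 0 <= bias by rewrite /bias mulr_ge0// sqr_ge0.
have sq_th0 : norm2 th0 ^+ 2 = \sum_i th0 i 0 ^+ 2.
  by rewrite sqr_sqrtr//; apply: sumr_ge0 => i _; exact: sqr_ge0.
have bM : \sum_i (Q^T *m beta) i 0 ^+ 2 <= norm2 th0 ^+ 2.
  by rewrite sq_th0 /th0 /theta_of -mulmxA (@sumsq_isometry _ _ _ Q _ QQ).
pose wv := coord_err _ _ _ _ Pm Q lam rho beta ev.
have QW j : `|(Q *m wv) j 0| <=
    `|\sum_l noise_form _ _ _ Pm lam rho (row j Q) 0 l * ev l 0| + bias.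
  rewrite mulmx_row_form.
  have r1 : \sum_i row j Q 0 i ^+ 2 <= 1 ^+ 2.
    by rewrite expr1n; under eq_bigr do rewrite mxE; exact: (@row_sumsq_le1 _ _ _ Q Qp).
  have := @coord_err_form_le _ _ _ _ Pm Q lam rho L 1 _ beta ev _ rho0 L0 Ll ler01 n20 r1 bM.
  by rewrite mul1r.
have kb0 : 0 < k * b by rewrite mulr_gt0.
have QWk j : `|(Q *m wv) j 0| <= k * b.
  have := nz1 j; have := QW j; move: bk kb0; clear; lra.
have tsE : ridge_debiased X Q lam rho y = th0 + Q *m wv.
  exact: (@ridge_debiased_err _ _ _ _ X Pm Q lam Qp).
(* The same [k] fits both sides of the gap: [cb * b] equals [b - 2 k b], and [b / cb] is at least
   [b + 2 k b] since (1 + 2 k) cb = 1 - (1 - cb)^2. *)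
have cbk : 1 + 2 * k <= cb^-1.
  rewrite -[cb^-1]mul1r ler_pdivlMr// /k.
  have -> : (1 + 2 * ((1 - cb) / 2)) * cb = 1 - (1 - cb) ^+ 2 by field.
  by rewrite gerBl sqr_ge0.
have bcb : b + 2 * (k * b) <= b / cb.
  by have := ler_wpM2l (ltW b0) cbk; rewrite mulrDr mulr1 mulrCA [b * k]mulrC.
have thE : theta_hat X Q lam rho b y =
    \col_j (if j \in N then (th0 + Q *m wv) j 0 else 0).
  rewrite /theta_hat tsE; apply: hard_threshold_active => j jN; rewrite col_addE.
    have := ler_normD (th0 j 0) ((Q *m wv) j 0); have := QWk j; have := thout j jN.
    have -> : cb * b = b - 2 * (k * b) by rewrite /k; field.
    by move: kb0; clear; lra.
  have := ler_normB (th0 j 0 + (Q *m wv) j 0) ((Q *m wv) j 0); rewrite addrK.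
  by have := QWk j; have := thin j jN; move: kb0 bcb; clear; lra.
set th := theta_hat X Q lam rho b y in thE *.
have thN j : j \notin N -> th j 0 = 0 by move=> jN; rewrite thE mxE (negbTE jN).
have CW i : `|(row i (cmat Xf Q N) *m wv) 0 0| <= t / 2.
  have r1 : \sum_l row i (cmat Xf Q N) 0 l ^+ 2 <= CM ^+ 2.
    by under eq_bigr do rewrite mxE; exact: cCM.
  have := @coord_err_form_le _ _ _ _ Pm Q lam rho L CM _ beta ev _ rho0 L0 Ll (ltW CM0) n20 r1 bM.
  by rewrite -/bias -/wv; have := nz2 i; move: CMb; clear; lra.
have Ft x z : `|x - z| <= t -> `|F x - F z| <= e.
  by move=> /Ft4; move: e0; clear; lra.
split; last first.
  apply: (@true_prob_close _ _ _ P _ _ _ _ X Xf Q lam rho b beta y Ef F e t) => // i.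
  rewrite -/th thE; apply: (le_trans (@pred_shift_le _ _ _ _ Xf Q Qp beta wv N i one)).
  by have := CW i; move: cm1 cm2; clear; lra.
pose dv := X *m (th - th0).
have yE : y - X *m th = ev - dv by exact: (@resid_err _ _ _ _ X Pm Q lam).
have e30 : 0 <= e3 by apply: le_trans nz3; apply: sumr_ge0 => j _; exact: sqr_ge0.
have n0R : 0 < n%:R :> R by rewrite ltr0n.
have dvP : n%:R^-1 * \sum_i dv i 0 ^+ 2 <= 5 * CU ^+ 2 * e3.
  have lam0 i : 0 < lam 0 i by exact: lt_le_trans (Ll i).
  have h1 := @design_sumsq_le _ _ _ _ X Pm Q lam _ (th - th0) XE PP QQ lam0 lU.
  have h2 := @active_err_sumsq _ _ _ Q th0 wv N cb b bias
    (fun j => \sum_l noise_form _ _ _ Pm lam rho (row j Q) 0 l * ev l 0) bias0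
    (fun j _ => QW j) thout.
  rewrite -thE in h2.
  (* 5 = 2 + 2 + 1: noise, bias and left-out coordinates, each controlled by [e3]. *)
  have h3 : \sum_j (th - th0) j 0 ^+ 2 <= 5 * e3 by move: h2 nz3 Nb offb; clear; lra.
  rewrite mulrC ler_pdivrMr//; apply: (le_trans h1).
  rewrite exprMn sqr_sqrtr ?ler0n// -mulrA [_ * n%:R]mulrC [n%:R * _]mulrC.
  have c2 : 0 <= CU ^+ 2 * n%:R by rewrite mulr_ge0 ?sqr_ge0.
  have := ler_wpM2l c2 h3; clear; lra.
have FhatF x : `|Fhat (centered_resid X th y) x - F x| <= e.
  have h := @centered_resid_close _ _ _ X th y ev dv n0 yE.
  have e52 : (n%:R^-1 * \sum_i ev i 0) ^+ 2 <= e5 ^+ 2.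
    rewrite -real_normK ?num_real//; apply: lerXn2r => //.
    by rewrite nnegrE (le_trans _ ev1).
  have kk : n%:R^-1 * \sum_i (centered_resid X th y i 0 - ev i 0) ^+ 2 <= t ^+ 2 * (e / 4).
    apply: (le_trans h); move: small dvP e52; clear; lra.
  have := @Fhat_perturb _ _ ev (centered_resid X th y) F t (e / 4) _ t0 Ft4 FhF kk x.
  rewrite mulrAC divff ?mul1r; last by rewrite gt_eqF// exprn_gt0.
  by move=> /le_trans; apply; move: e0; clear; lra.
have sK : Num.sqrt (sigma_hat2 X th y) <= K.
  have h := @sigma_hat2_le _ _ _ X th y ev dv yE.
  have hK : sigma_hat2 X th y <= K by move: h ev2 dvP KS; clear; lra.
  have K0 : 0 <= K by rewrite (le_trans ler01).
  (* [1 <= K], so the bound on the variance also bounds its root. *)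
  rewrite -[leRHS]ger0_norm// -sqrtr_sqr; apply: ler_wsqrtr.
  by rewrite (le_trans hK)// expr2 ler_peMr.
(* Noise takes at most [k b / 2] and bias at most [k b / 4], so more than [k b] of the margin
   [2 k b] is left for the bootstrap. *)
have thk j : j \in N -> b + k * b < `|th j 0|.
  move=> jN; rewrite thE mxE jN col_addE.
  have := ler_normB (th0 j 0 + (Q *m wv) j 0) ((Q *m wv) j 0); rewrite addrK.
  have := thin j jN; have := nz1 j; have := QW j; move: bk kb0 bcb; clear; lra.
(* On [N] the error is at most [b], hence at most |th0 j|, and the estimator at most doubles each
   coordinate. The bootstrap bias is then bounded by [2 * bias], which is why quarters and not
   halves were required of [bias]. *)
have thM : \sum_i (Q^T *m th) i 0 ^+ 2 <= (2 * norm2 th0) ^+ 2.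
  apply: (le_trans (sumsq_contraction _ _ _ Q th QQ)).
  rewrite exprMn sq_th0 mulr_sumr; apply: ler_sum => j _.
  have [jN|jN] := boolP (j \in N); last by rewrite thN// expr0n/= mulr_ge0// sqr_ge0.
  rewrite -exprMn -real_normK ?num_real// -[leRHS]real_normK ?num_real//.
  apply: lerXn2r; rewrite ?nnegrE// thE mxE jN col_addE normrM (ger0_norm (ler0n _ 2)).
  have := ler_normD (th0 j 0) ((Q *m wv) j 0); have := QWk j; have := thin j jN.
  have : k * b <= b by rewrite ler_piMl// ltW.
  by move: bcb kb0; clear; lra.
have bias2 : (rho / L ^+ 2) ^+ 2 * (2 * norm2 th0) = 2 * bias by rewrite mulrCA.
apply: (@boot_prob_close _ _ _ P _ _ _ _ X Xf Pm Q lam Qp rho b y N Z V F q MZ L k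
  (2 * norm2 th0) CM K e t) => //.
- by rewrite mulr_ge0.
- by rewrite bias2; move: bk; clear; lra.
- by rewrite bias2; move: CMb; clear; lra.
- exact: lt_le_trans K1.
Qed.

(** * Choice of constants and proof of the limit theorem *)

Theorem theorem4
  (R : realType)
  (* dimensions, design, SVD, tuning sequences (all indexed by n) *)
  (p p1 r : nat -> nat)
  (X : forall n, 'M[R]_(n, p n)) (Xf : forall n, 'M[R]_(p1 n, p n))
  (beta : forall n, 'cV[R]_(p n))
  (Pm : forall n, 'M[R]_(n, r n)) (Qm : forall n, 'M[R]_(p n, r n))
  (lam : forall n, 'rV[R]_(r n)) (Qperp : forall n, 'M[R]_(p n, p n - r n))
  (rho b : nat -> R)
  (* data probability space: errors eps_0, eps_1, ... *)
  (d : measure_display) (Omega : measurableType d) (P : probability Omega R)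
  (eps : nat -> {RV P >-> R})
  (* auxiliary probability space: future errors, N(0,1) and U(0,1) variables *)
  (d' : measure_display) (Omega' : measurableType d') (P' : probability Omega' R)
  (epsf Z V : nat -> {RV P' >-> R})
  (* constants *)
  (eta c_lam C_lam alpha_theta delta m alpha_p C_b nu_b c_b
   alpha_M c_M C_M alpha_sigma : R) :
  (* thin SVD X = P Lambda Q^T and Q_perp *)
  (forall n, X n = Pm n *m diag_mx (lam n) *m (Qm n)^T) ->
  (forall n, (Pm n)^T *m Pm n = 1%:M) ->
  (forall n, (Qm n)^T *m Qm n = 1%:M) ->
  (forall n, (Qperp n)^T *m Qperp n = 1%:M) ->
  (forall n, (Qm n)^T *m Qperp n = 0) ->
  (forall n, Qm n *m (Qm n)^T + Qperp n *m (Qperp n)^T = 1%:M) ->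
  (forall n, \rank (X n) = r n) ->
  (forall n (k l : 'I_(r n)), (k <= l)%N -> lam n 0 l <= lam n 0 k) ->
  (forall n (k : 'I_(r n)), 0 < lam n 0 k) ->
  (* Assumption 1 *)
  0 < c_lam -> 0 < C_lam -> 0 < eta -> eta <= 1 / 2 ->
  (forall n (k : 'I_(r n)),
      c_lam * npow n eta <= lam n 0 k /\ lam n 0 k <= C_lam * Num.sqrt n%:R) ->
  bigO_seq (fun n => norm2 (theta_of (Qm n) (beta n))) (fun n => npow n alpha_theta) ->
  0 < alpha_theta -> alpha_theta < 3 * eta ->
  (* Assumption 2 *)
  (forall n, (0 < n)%N -> 0 < rho n) ->
  bigO_seq rho (fun n => npow n (2 * eta - delta)) ->
  (eta + alpha_theta) / 2 < delta -> delta < 2 * eta ->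
  (* Assumption 3: eps_i i.i.d., mean 0, finite m-th absolute moment, m > 4 *)
  mutually_independent P (fun k => (eps k : Omega -> R)) ->
  (forall k (B : set R), measurable B -> P (eps k @^-1` B) = P (eps 0%N @^-1` B)) ->
  ('E_P[eps 0%N] = 0)%E ->
  4 < m ->
  (\int[P]_w ((`|eps 0%N w| `^ m)%:E) < +oo)%E ->
  (* Assumption 4 *)
  bigO_seq (fun n => (p n)%:R) (fun n => npow n alpha_p) ->
  0 <= alpha_p -> alpha_p < m * eta ->
  0 < C_b -> 0 < nu_b ->
  (forall n, (0 < n)%N -> b n = C_b * npow n (- nu_b)) ->
  nu_b + alpha_p / m - eta < 0 ->
  0 < c_b -> c_b < 1 ->
  (forall n, (0 < n)%N -> forall j : 'I_(p n),
      j \notin activeN (b n) (theta_of (Qm n) (beta n)) ->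
      `|theta_of (Qm n) (beta n) j 0| <= c_b * b n) ->
  (forall n, (0 < n)%N -> forall j : 'I_(p n),
      j \in activeN (b n) (theta_of (Qm n) (beta n)) ->
      b n / c_b <= `|theta_of (Qm n) (beta n) j 0|) ->
  (* Assumption 5 (with M = X_f) *)
  (forall n, (0 < n)%N ->
      setM (cmat (Xf n) (Qm n) (activeN (b n) (theta_of (Qm n) (beta n)))) != finset.set0) ->
  bigO_seq (fun n => #|setM (cmat (Xf n) (Qm n)
                        (activeN (b n) (theta_of (Qm n) (beta n))))|%:R)
           (fun n => npow n alpha_M) ->
  alpha_M < m * eta ->
  0 < c_M ->
  (forall n, (0 < n)%N -> forall i : 'I_(p1 n),
      i \in setM (cmat (Xf n) (Qm n) (activeN (b n) (theta_of (Qm n) (beta n)))) ->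
      c_M < \sum_(k < r n) cmat (Xf n) (Qm n)
                 (activeN (b n) (theta_of (Qm n) (beta n))) i k ^+ 2 /\
      \sum_(k < r n) cmat (Xf n) (Qm n)
                 (activeN (b n) (theta_of (Qm n) (beta n))) i k ^+ 2 <= C_M) ->
  littleo_seq
    (fun n => colmaxabs (\col_(i < p1 n)
        \sum_(j in ~: activeN (b n) (theta_of (Qm n) (beta n)))
           Xf n i j * theta_of (Qm n) (beta n) j 0))
    (fun n => (Num.sqrt (n%:R * ln n%:R))^-1) ->
  littleo_seq
    (fun n => colmaxabs (Xf n *m theta_perp_of (Qperp n) (beta n)))
    (fun n => (Num.sqrt (n%:R * ln n%:R))^-1) ->
  (* Assumption 6 *)
  0 < alpha_sigma -> alpha_sigma <= eta ->
  bigO_seq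
    (fun n => npow n (- nu_b) *
       \sum_(j in ~: activeN (b n) (theta_of (Qm n) (beta n)))
          `|theta_of (Qm n) (beta n) j 0|)
    (fun n => npow n (- alpha_sigma)) ->
  bigO_seq
    (fun n => Num.sqrt (#|activeN (b n) (theta_of (Qm n) (beta n))|%:R) / npow n eta)
    (fun n => npow n (- alpha_sigma)) ->
  (* Assumption 8: F continuous *)
  continuous (fun x : R => fine (cdf (eps 0%N) x)) ->
  (* Assumption 9 *)
  bigO_seq (fun n => (p1 n)%:R : R) (fun=> 1) ->
  (* auxiliary space: all variables mutually independent; epsf_k ~ F,
     Z_k ~ N(0,1), V_k ~ Uniform(0,1) *)
  mutually_independent P'
    (fun k : (nat + nat + nat)%type => match k with
       | inl (inl i) => (epsf i : Omega' -> R)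
       | inl (inr i) => (Z i : Omega' -> R)
       | inr i => (V i : Omega' -> R) end) ->
  (forall k (B : set R), measurable B -> P' (epsf k @^-1` B) = P (eps 0%N @^-1` B)) ->
  (forall k (B : set R), measurable B -> P' (Z k @^-1` B) = normal_prob 0 1 B) ->
  (forall k (B : set R), measurable B ->
      P' (V k @^-1` B) = uniform_prob (@ltr01 R) B) ->
  let y n (w : Omega) : 'cV[R]_n := X n *m beta n + \col_(i < n) eps i w in
  (* Prob^*( max_i |y^*_{f,i} - hat y^*_{f,i}| <= x ) *)
  let Aboot n (w : Omega) (x : R) : R :=
    fine (P' [set w' | colmaxabs (boot_pred_err (X n) (Xf n) (Qm n) (lam n)
              (Qperp n) (rho n) (b n) (y n w)
              (\col_(i < n) Z i w') (\col_(i < p1 n) V i w')) <= x]) in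
  (* Prob^*( max_i |y_{f,i} - hat y_{f,i}| <= x ) *)
  let Btrue n (w : Omega) (x : R) : R :=
    fine (P' [set w' | colmaxabs (pred_err (X n) (Xf n) (Qm n) (lam n) (rho n) (b n)
              (beta n) (y n w) (\col_(i < p1 n) epsf i w')) <= x]) in
  let cstar n (w : Omega) (alpha : R) : R :=
    inf [set x : R | 1 - alpha <= Aboot n w x] in
  (* sup_{x >= 0} |Aboot - Btrue| = o_p(1) *)
  (forall e : R, 0 < e ->
     P [set w | exists x : R, 0 <= x /\ e < `|Aboot n w x - Btrue n w x|]
       @[n --> \oo] --> 0%E)
  /\
  (* Prob^*(max_i |y_{f,i} - hat y_{f,i}| <= c^*_{1-alpha}) -> 1 - alpha in probability *)
  (forall alpha : R, 0 < alpha -> alpha < 1 ->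
   forall e : R, 0 < e ->
     P [set w | e < `|Btrue n w (cstar n w alpha) - (1 - alpha)|]
       @[n --> \oo] --> 0%E).
Proof.
move=> XE PP QQ QpQp QQp one rk lamdec lam0 c0 C0 eta0 eta1 lamb thO at0 at1 rho0 rhoO.
move=> del1 del2 iE lawE EE m4 Em pO ap0 ap1 Cb0 nu0 bE nub cb0 cb1 thout thin Mne MO aM.
move=> cM0 cMb lo1 lo2 as0 as1 A6a A6b Fc p1O iAll lawF lawZ lawV y Aboot Btrue cstar.
pose th0 n := theta_of (Qm n) (beta n).
pose N n := activeN (b n) (th0 n).
pose F x := fine (P [set w | eps 0%N w <= x]).
pose G n x := (Num.max 0 (F x - F (- x))) ^+ p1 n.
have m0 : 0 < m by move: m4; clear; lra.
have m2 : 2 <= m by move: m4; clear; lra.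
have meps i : measurable_fun setT (eps i : Omega -> R) by [].
have mZ i : measurable_fun setT (Z i : Omega' -> R) by [].
have mV i : measurable_fun setT (V i : Omega' -> R) by [].
have mEf i : measurable_fun setT (epsf i : Omega' -> R) by [].
have Fm : {homo F : x y / x <= y} by exact: prob_le_homo.
have F01 x : 0 <= F x <= 1.
  rewrite /F fine_prob_ge0 fine_prob_le1//.
  by apply: measurable_set_le => //; exact: measurable_cst.
have Fcont : continuous F.
  have -> // : F = (fun x => fine (cdf (eps 0%N) x)).
  by apply/funext => x; rewrite fine_cdfE.
have Flo u : 0 < u -> exists x, F x <= u by move=> u0; exact: prob_le_lim0.
have Fhi u : 0 < u -> exists x, 1 - u <= F x by move=> u0; exact: prob_le_lim1.
have iEf : mutually_independent P' (fun i => (epsf i : Omega' -> R)).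
  by apply: (@mutually_independent_inj _ _ nat _ _ P' _ (fun i => inl (inl i)) _ iAll) => i j [].
have iZ : mutually_independent P' (fun i => (Z i : Omega' -> R)).
  by apply: (@mutually_independent_inj _ _ nat _ _ P' _ (fun i => inl (inr i)) _ iAll) => i j [].
have iV : mutually_independent P' (fun i => (V i : Omega' -> R)).
  by apply: (@mutually_independent_inj _ _ nat _ _ P' _ (fun i => inr i) _ iAll) => i j [].
have lawFF i x : fine (P' [set w | epsf i w <= x]) = F x.
  have mB : measurable [set u : R | u <= x].
    by apply: (measurable_set_le _ _ _ idfun (cst x)); [exact: measurable_id|exact: measurable_cst].
  by rewrite /F; congr fine; exact: (lawF i _ mB).
have EZ i : (\int[P']_w (Z i w)%:E = 0)%E.
  rewrite -(@normal_prob_mean R).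
  by apply: (@integral_eq_law _ _ _ _ R P' (normal_prob 0 1) (Z i) (fun x => x) (fun x => x)) => //; exact: lawZ.
pose MZ := m `^ m * (2 * expR 1).
have EZq i : (\int[P']_w (`|Z i w| `^ m)%:E <= MZ%:E)%E.
  rewrite (@integral_eq_law _ _ _ _ R P' (normal_prob 0 1) (Z i) (fun x => x)
    (fun x => `|x| `^ m))//; first exact: normal_prob_moment.
    exact: measurable_normpow.
  exact: lawZ.
have Ee i : (\int[P]_w (eps i w)%:E = 0)%E.
  rewrite (@integral_eq_law _ _ _ _ R P P (eps i) (eps 0%N) (fun x => x))//; last exact: lawE.
  by move: EE; rewrite unlock.
have [ME hM0] : exists M : R, (\int[P]_w (`|eps 0%N w| `^ m)%:E <= M%:E)%E.
  exists (fine (\int[P]_w (`|eps 0%N w| `^ m)%:E)); rewrite fineK// ge0_fin_numE//.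
  by apply: integral_ge0 => w _; rewrite lee_fin powR_ge0.
have hME i : (\int[P]_w (`|eps i w| `^ m)%:E <= ME%:E)%E.
  rewrite (@integral_eq_law _ _ _ _ R P P (eps i) (eps 0%N) (fun x => `|x| `^ m))//.
    exact: measurable_normpow.
  exact: lawE.
have p1gt n : (0 < n)%N -> (0 < p1 n)%N.
  by move=> n0; have /set0Pn[i _] := Mne n n0; exact: leq_ltn_trans (ltn_ord i).
have [C1 C10 [N1 p1le]] : exists2 C1 : R, 0 <= C1 &
    exists N1, forall n, (N1 <= n)%N -> (p1 n)%:R <= C1.
  have [C [N1 h]] := p1O; exists `|C| => //; exists N1 => n /h.
  by rewrite normr1 mulr1 ger0_norm// => /le_trans; apply; exact: ler_norm.
(* [CM ^+ 2] dominates [C_M]; rows outside [setM] have a sum of squares equal to 0. *)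
pose CM := 1 + `|C_M|.
have CM0 : 0 < CM by rewrite ltr_wpDr.
have cCM n i : (0 < n)%N -> \sum_l cmat (Xf n) (Qm n) (N n) i l ^+ 2 <= CM ^+ 2.
  move=> n0; have [iM|] := boolP (i \in setM (cmat (Xf n) (Qm n) (N n))).
    have [_ /le_trans] := cMb n n0 i iM; apply; apply: (le_trans (ler_norm _)).
    by rewrite /CM; have : 0 <= `|C_M| by []; clear; nra.
  by rewrite inE -leNgt => /le_trans; apply; exact: sqr_ge0.
pose k := (1 - c_b) / 2.
have k0 : 0 < k by rewrite /k; move: cb1; clear; lra.
pose L n := c_lam * npow n eta.
have L0 n : (0 < n)%N -> 0 < L n by move=> n0; rewrite /L mulr_gt0// npow_gt0.
have Ll n i : L n <= lam n 0 i by have [] := lamb n i.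
have lU n i : lam n 0 i <= C_lam * Num.sqrt n%:R by have [] := lamb n i.
have b0 n : (0 < n)%N -> 0 < b n by move=> n0; rewrite bE// mulr_gt0// npow_gt0.
pose bias n := (rho n / L n ^+ 2) ^+ 2 * norm2 (th0 n).
have bias0 n : 0 <= bias n by rewrite /bias mulr_ge0 ?sqr_ge0// sqrtr_ge0.
have [KB KB0 [NB biasle]] : exists2 K : R, 0 < K & exists N0, forall n, (N0 <= n)%N ->
    bias n <= K * npow n (alpha_theta - 2 * delta).
  exact: (bias_bigO _ _ _ _ _ _ _ c0 rhoO thO (fun n => sqrtr_ge0 _)).
have mzg M : 0 < mz_const R m M by exact: expR_gt0.
have apm : 0 <= alpha_p / m by rewrite divr_ge0// ltW.
have hcard := card_bigO _ (fun n => #|N n|) _ _ A6b.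
have rowQ n j : (0 < n)%N ->
    \sum_l noise_form _ _ _ (Pm n) (lam n) (rho n) (row j (Qm n)) 0 l ^+ 2 <= (L n)^-1 ^+ 2.
  move=> n0; apply: (le_trans (noise_form_sumsq _ _ _ _ _ _ _ _ (PP n) (rho0 n n0) (L0 n n0) (Ll n))).
  rewrite exprVn ler_piMl ?invr_ge0 ?sqr_ge0//.
  by under eq_bigr do rewrite mxE; exact: (row_sumsq_le1 _ _ _ _ (Qperp n)).
have rowC n i : (0 < n)%N ->
    \sum_l noise_form _ _ _ (Pm n) (lam n) (rho n) (row i (cmat (Xf n) (Qm n) (N n))) 0 l ^+ 2
      <= (CM / L n) ^+ 2.
  move=> n0; apply: (le_trans (noise_form_sumsq _ _ _ _ _ _ _ _ (PP n) (rho0 n n0) (L0 n n0) (Ll n))).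
  rewrite expr_div_n ler_wpM2r ?invr_ge0 ?sqr_ge0//.
  by under eq_bigr do rewrite mxE; exact: cCM.
(* Both conclusions follow from closeness to [G n]. The radius [t] is chosen before [n], and all
   [G n] with large [n] share it as a modulus because [p1 n] is bounded. *)
have core e1 : 0 < e1 -> exists2 t : R, 0 < t &
    (exists N0, forall n, (N0 <= n)%N ->
       forall x z, `|x - z| <= t -> `|G n x - G n z| <= e1) /\
    whp _ _ _ P (fun n => [set w | (forall x, `|Aboot n w x - G n x| <= e1) /\
                                   (forall x, `|Btrue n w x - G n x| <= e1)]).
  (* Absorbs the factor [5 * p1 + 1] of the comparison lemmas, for all large [n] at once. *)
  move=> e10; pose e := e1 / (5 * C1 + 1).
  have D0 : 0 < 5 * C1 + 1 by rewrite ltr_wpDl// mulr_ge0.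
  have e0 : 0 < e by rewrite divr_gt0.
  have e40 : 0 < e / 4 by rewrite divr_gt0.
  have pe n : (N1 <= n)%N -> (5 * (p1 n)%:R + 1) * e <= e1.
    move=> /p1le H; rewrite -[leRHS](@divfK _ (5 * C1 + 1)) ?gt_eqF// -/e mulrC.
    by rewrite ler_pM2l// lerD2r ler_pM2l.
  have [t t0 Ft4] := cdf_unif_continuous _ F _ Fm Fcont F01 Flo Fhi e40.
  have [s sP] := cdf_grid _ F _ Fm Fcont F01 Flo Fhi e40.
  pose T2 := t ^+ 2 * e.
  have T20 : 0 < T2 by rewrite mulr_gt0// exprn_gt0.
  (* Makes [10 * C_lam ^+ 2 * e3] equal to [T2 / 8]; [2 * e5 ^+ 2] takes another [T2 / 8], and
     together they fill the allowed [t ^+ 2 * (e / 4)]. *)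
  pose e3 := T2 / (80 * C_lam ^+ 2).
  have e30 : 0 < e3 by rewrite divr_gt0// mulr_gt0// exprn_gt0.
  have e3E : 10 * C_lam ^+ 2 * e3 = T2 / 8 by rewrite /e3; field; rewrite gt_eqF.
  pose e5 := Num.min 1 (T2 / 16).
  have e50 : 0 < e5 by rewrite lt_min ltr01 divr_gt0.
  have small : 10 * C_lam ^+ 2 * e3 + 2 * e5 ^+ 2 <= t ^+ 2 * (e / 4).
    have h1 : e5 <= 1 by rewrite ge_min lexx.
    have h2 : e5 <= T2 / 16 by rewrite ge_min lexx orbT.
    have h3 : e5 ^+ 2 <= e5 by rewrite expr2 ler_piMl// ltW.
    have -> : t ^+ 2 * (e / 4) = T2 / 4 by rewrite /T2 mulrA.
    by rewrite e3E; move: h1 h2 h3; clear; lra.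
  have [S S0 W4] := lln_square _ _ _ P (fun i => eps i) m ME m4 meps iE lawE hM0.
  pose K := 2 * (S + 1) + T2 + 1.
  have K1 : 1 <= K by rewrite /K; move: S0 T20; clear; lra.
  have K0 : 0 < K by exact: lt_le_trans K1.
  have KS : 2 * (S + 1) + 10 * C_lam ^+ 2 * e3 <= K by rewrite e3E /K; move: T20; clear; lra.
  have t40 : 0 < t / 4 by rewrite divr_gt0.
  have [D1 dbk] : exists D1, forall n, (D1 <= n)%N -> bias n <= k / 4 * b n.
    (* 2 delta > eta + alpha_theta and nu_b < eta: the bias is of smaller order than the
       threshold. *)
    have a0 : alpha_theta - 2 * delta + nu_b < 0 by move: del1 nub apm; clear; lra.
    have kc0 : 0 < k / 4 * C_b by rewrite mulr_gt0// divr_gt0.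
    have [D1 h] := npow_eventually_le _ _ KB _ a0 kc0.
    exists (maxn 1 (maxn NB D1)) => n; rewrite !geq_max => /and3P[n0 /biasle H1 /h H2].
    apply: (le_trans H1); rewrite bE// mulrA.
    have -> : npow n (alpha_theta - 2 * delta) =
        npow n (alpha_theta - 2 * delta + nu_b) * npow n (- nu_b).
      by rewrite -npowD// addrK.
    by rewrite mulrA ler_wpM2r// npow_ge0.
  have [D2 dCb] : exists D2, forall n, (D2 <= n)%N -> CM * bias n <= t / 4.
    have a0 : alpha_theta - 2 * delta < 0 by move: del1 eta0; clear; lra.
    have [D2 h] := npow_eventually_le _ _ (CM * KB) _ a0 t40.
    exists (maxn NB D2) => n; rewrite geq_max => /andP[/biasle H1 /h H2].
    by apply: le_trans H2; rewrite -mulrA ler_pM2l.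
  have [D3 dN] : exists D3, forall n, (D3 <= n)%N -> #|N n|%:R * bias n ^+ 2 <= e3.
    apply: (card_sumsq_small _ _ _ _ _ KB (alpha_theta - 2 * delta) _ hcard) => //.
      by exists NB => n /biasle H.
    (* The lower bound on [delta] places the bias below the noise rate n^(-eta). *)
    by move: del1; clear; lra.
  have [D4 doff] : exists D4, forall n, (D4 <= n)%N ->
      c_b * (b n * \sum_(j in ~: N n) `|th0 n j 0|) <= e3.
    have [C Cp [D h]] := bigO_npowP _ _ _ A6a.
    have a0 : - alpha_sigma < 0 by rewrite oppr_lt0.
    have [D' h'] := npow_eventually_le _ _ (c_b * C_b * C) _ a0 e30.
    exists (maxn 1 (maxn D D')) => n; rewrite !geq_max => /and3P[n0 /h H /h' H'].
    apply: le_trans H'; rewrite bE// -!mulrA ler_pM2l// ler_pM2l//.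
    by apply: le_trans H; exact: ler_norm.
  have [D5 dlo1] := littleo_inv_sqrt_small _ _ _ lo1 t40.
  have [D6 dlo2] := littleo_inv_sqrt_small _ _ _ lo2 t40.
  have e20 : 0 < e / 2 by rewrite divr_gt0.
  (* Bootstrap thresholds carry the factor 1/K, since [K] bounds the estimated standard
     deviation. *)
  have k2K : 0 < k / 2 / K by apply: divr_gt0 => //; exact: divr_gt0.
  have t2K : 0 < t / 2 / K by apply: divr_gt0 => //; exact: divr_gt0.
  have [D7 tail1] := coord_tail_small _ _ _ _ _ _ _ _ _ _ _ pO (ltW (mzg MZ)) c0 k2K Cb0 m0 nub e20.
  have [D8 tail2] := form_tail_small _ _ _ _ _ _ _ _ _ _
    (ex_intro _ N1 p1le) (ltW (mzg MZ)) CM0 c0 t2K m0 eta0 e20.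
  have W1 : whp _ _ _ P (fun n => [set w | forall j, `|\sum_l noise_form _ _ _ (Pm n) (lam n)
      (rho n) (row j (Qm n)) 0 l * eps l w| <= k * b n / 2]).
    apply: (whp_bound _ _ _ _ _ _ 1%N) => [u u0|n n0].
      have k20 : 0 < k / 2 by rewrite divr_gt0.
      exact: (coord_tail_small _ _ _ _ _ _ _ _ _ _ _ pO (ltW (mzg ME)) c0 k20 Cb0 m0 nub u0).
    have kb0 : 0 < k * b n / 2 by rewrite divr_gt0// mulr_gt0// b0.
    have iL0 : 0 < (L n)^-1 by rewrite invr_gt0 L0.
    have [B mB [PB hB]] := union_tail _ _ _ P (fun i => eps i) m ME n 'I_(p n)
      (fun j l => noise_form _ _ _ (Pm n) (lam n) (rho n) (row j (Qm n)) 0 l)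
      _ _ m2 meps iE Ee hME iL0 kb0 (fun j => rowQ n j n0).
    exists B => //; split => //; move: PB; rewrite card_ord bE//.
    by rewrite (_ : k * (C_b * npow n (- nu_b)) / 2 = k / 2 * (C_b * npow n (- nu_b)))// mulrAC.
  have W2 : whp _ _ _ P (fun n => [set w | forall i, `|\sum_l noise_form _ _ _ (Pm n) (lam n)
      (rho n) (row i (cmat (Xf n) (Qm n) (N n))) 0 l * eps l w| <= t / 4]).
    apply: (whp_bound _ _ _ _ _ _ 1%N) => [u u0|n n0].
      exact: (form_tail_small _ _ _ _ _ _ _ _ _ _
        (ex_intro _ N1 p1le) (ltW (mzg ME)) CM0 c0 t40 m0 eta0 u0).
    have CL0 : 0 < CM / L n by rewrite divr_gt0// L0.
    have [B mB [PB hB]] := union_tail _ _ _ P (fun i => eps i) m ME n 'I_(p1 n)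
      (fun i l => noise_form _ _ _ (Pm n) (lam n) (rho n) (row i (cmat (Xf n) (Qm n) (N n))) 0 l)
      _ _ m2 meps iE Ee hME CL0 t40 (fun j => rowC n j n0).
    by exists B => //; split => //; move: PB; rewrite card_ord.
  have W3 : whp _ _ _ P (fun n => [set w | \sum_(j in N n) (\sum_l noise_form _ _ _ (Pm n) (lam n)
      (rho n) (row j (Qm n)) 0 l * eps l w) ^+ 2 <= e3]).
    apply: (whp_bound _ _ _ _ _
      (fun n => #|N n|%:R * (mz_const R m ME * (L n)^-1 ^+ 2) / e3) 1%N) => [u u0|n n0].
      have u'0 : 0 < u * e3 / mz_const R m ME by rewrite divr_gt0// mulr_gt0.
      have hB : exists N0, forall n, (N0 <= n)%N -> 0 <= (L n)^-1 /\ (L n)^-1 <= c_lam^-1 * npow n (- eta).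
        by exists 1%N => n n0; rewrite invr_ge0 ltW ?L0// /L invfM npowN.
      have [D h] := card_sumsq_small _ _ _ _ _ _ _ _ hcard hB as0 (lexx _) u'0.
      exists D => n /h; rewrite ler_pdivlMr// ler_pdivrMr//.
      by rewrite -mulrA [_ ^+ 2 * _]mulrC.
    have iL0 : 0 < (L n)^-1 by rewrite invr_gt0 L0.
    exact: (sumsq_markov _ _ _ P (fun i => eps i) m ME n 'I_(p n) (N n)
      (fun j l => noise_form _ _ _ (Pm n) (lam n) (rho n) (row j (Qm n)) 0 l)
      _ _ m2 meps iE Ee hME iL0 e30 (fun j => rowQ n j n0)).
  have W5 := lln_whp _ _ _ P (fun i => eps i) m ME e5 m2 meps iE Ee hME e50.
  have W6 := whp_all _ _ _ P _ s (fun u n => [set w | `|Fhat (\col_(i < n) eps i w) u - F u| <= e / 4])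
    (fun u _ => lln_indicator _ _ _ P (fun i => eps i) u (e / 4) meps iE lawE e40).
  have W := whp_and _ _ _ P _ _ (whp_and _ _ _ P _ _ W1 W2) (whp_and _ _ _ P _ _
    (whp_and _ _ _ P _ _ W3 W4) (whp_and _ _ _ P _ _ W5 W6)).
  exists t => //; split.
    exists N1 => n nN1 x z xz; apply: le_trans (pe n nN1).
    have := phi_exp_modulus _ F (e / 4) t x z (p1 n) F01 Ft4 xz.
    move=> /le_trans; apply; have : 0 <= (p1 n)%:R * e by rewrite mulr_ge0// ltW.
    by move: e0; clear; lra.
  apply: (whp_imp _ _ _ P _ _ (maxn (maxn (maxn 1 N1) (maxn D1 D2))
    (maxn (maxn (maxn D3 D4) (maxn D5 D6)) (maxn D7 D8))) W) => n.
  rewrite !geq_max -!andbA => /andP[n0 /andP[nN1 /andP[/dbk bk /andP[/dCb bC /andP[/dN Nb]]]]].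
  move=> /andP[/doff off /andP[/dlo1 l1 /andP[/dlo2 l2 /andP[/tail1 t1 /tail2 t2]]]].
  move=> w [[w1 w2] [[w3 w4] [w5 w6]]].
  pose ev := \col_(i < n) eps i w.
  have FhF x : `|Fhat ev x - F x| <= 2 * (e / 4).
    exact: (glivenko_grid _ _ _ F s _ F01 (ltW e40) sP w6).
  have evE (a : 'rV[R]_n) : \sum_l a 0 l * ev l 0 = \sum_l a 0 l * eps l w.
    by apply: eq_bigr => l _; rewrite mxE.
  have nz1 j : `|\sum_l noise_form _ _ _ (Pm n) (lam n) (rho n) (row j (Qm n)) 0 l * ev l 0|
      <= k * b n / 2 by rewrite evE; exact: w1.
  have nz2 i : `|\sum_l noise_form _ _ _ (Pm n) (lam n) (rho n)
      (row i (cmat (Xf n) (Qm n) (N n))) 0 l * ev l 0| <= t / 4 by rewrite evE; exact: w2.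
  have nz3 : \sum_(j in N n) (\sum_l noise_form _ _ _ (Pm n) (lam n) (rho n)
      (row j (Qm n)) 0 l * ev l 0) ^+ 2 <= e3.
    by under eq_bigr do rewrite evE; exact: w3.
  have ev2 : n%:R^-1 * \sum_i ev i 0 ^+ 2 <= S + 1.
    by under eq_bigr do rewrite mxE; exact: w4.
  have ev1 : `|n%:R^-1 * \sum_i ev i 0| <= e5.
    by under eq_bigr do rewrite mxE; exact: w5.
  have c1 := le_trans (ler_norm _) l1.
  have c2 := le_trans (ler_norm _) l2.
  have tails : (p n)%:R * (mz_const R m MZ * ((L n)^-1 / (k * b n / 2 / K)) `^ m) +
      (p1 n)%:R * (mz_const R m MZ * (CM / L n / (t / 2 / K)) `^ m) <= e.
    have -> : k * b n / 2 / K = k / 2 / K * (C_b * npow n (- nu_b)).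
      by rewrite bE//; field; rewrite gt_eqF.
    by rewrite [leRHS]splitr; exact: lerD.
  have [HA HB] := @fixed_n_close _ _ R P' n (p n) (p1 n) (r n) (X n) (Xf n) (Pm n) (Qm n)
    (lam n) (Qperp n) (rho n) (b n) (beta n) ev (fun i => epsf i) (fun i => Z i) (fun i => V i)
    F m MZ (L n) C_lam c_b CM S K e t e3 e5 (XE n) (PP n) (QQ n) (QpQp n) (QQp n) (one n)
    (rho0 n n0) (L0 n n0) (Ll n) C0 (lU n) n0 (p1gt n n0) (b0 n n0) cb0 cb1
    (thout n n0) (thin n n0) m2 mZ iZ EZ EZq mV iV lawV mEf iEf lawFF Fm F01 t0 e0 Ft4 FhF
    nz1 nz2 nz3 ev2 ev1 bk CM0 bC (fun i => cCM n i n0) Nb off c1 c2 small K1 KS tails.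
  by split => x; apply: le_trans (pe n nN1); [exact: HA|exact: HB].
(* The conditional probabilities are those of sections of functions on the product space, where
   joint measurability is proved. *)
pose h1 n (z : Omega * Omega') := colmaxabs (boot_pred_err (X n) (Xf n) (Qm n) (lam n)
  (Qperp n) (rho n) (b n) (y n z.1) (\col_(i < n) Z i z.2) (\col_(i < p1 n) V i z.2)).
pose h2 n (z : Omega * Omega') := colmaxabs (pred_err (X n) (Xf n) (Qm n) (lam n)
  (rho n) (b n) (beta n) (y n z.1) (\col_(i < p1 n) epsf i z.2)).
have my n : entrywise_measurable _ _ _ _ _ (fun z : Omega * Omega' => y n z.1).
  apply: entrywiseD; first exact: entrywise_cst.
  apply: (entrywise_col _ _ _ _ (fun i (z : Omega * Omega') => eps i z.1)) => i.
  exact: (measurableT_comp (meps i) measurable_fst).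
have mh1 n : (0 < n)%N -> measurable_fun setT (h1 n).
  move=> n0; apply: measurable_colmaxabs; apply: entrywise_boot_pred_err => //.
    apply: (entrywise_col _ _ _ _ (fun i (z : Omega * Omega') => Z i z.2)) => i.
    exact: (measurableT_comp (mZ i) measurable_snd).
  apply: (entrywise_col _ _ _ _ (fun i (z : Omega * Omega') => V i z.2)) => i.
  exact: (measurableT_comp (mV i) measurable_snd).
have mh2 n : measurable_fun setT (h2 n).
  apply: measurable_colmaxabs; apply: entrywise_pred_err => //.
  apply: (entrywise_col _ _ _ _ (fun i (z : Omega * Omega') => epsf i z.2)) => i.
  exact: (measurableT_comp (mEf i) measurable_snd).
split=> [e e0|a a0 a1 e e0].
  have e20 : 0 < e / 2 by rewrite divr_gt0.
  have [t t0 [_ W]] := core _ e20.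
  apply: (whp_cvg0 _ _ _ P _ 1%N) => [n n0|].
    exact: (measurable_sup_dist _ _ _ _ R P' (h1 n) (h2 n) e (mh1 n n0) (mh2 n)).
  apply: (whp_imp _ _ _ P _ _ 0%N W) => n _ w [HA HB] [x [x0]].
  apply/negP; rewrite -leNgt; have := ler_distD (G n x) (Aboot n w x) (Btrue n w x).
  by rewrite (distrC (G n x)); have := HA x; have := HB x; clear; lra.
(* A third, because [quantile_level] loses a factor 3. *)
have e30 : 0 < e / 3 by rewrite divr_gt0.
have [t t0 [[N0 hG] W]] := core _ e30.
apply: (whp_cvg0 _ _ _ P _ 1%N) => [n n0|].
  exact: (measurable_level_dist _ _ _ _ R P' (h1 n) (h2 n) a e (mh1 n n0)
    (fun z => colmaxabs_ge0 _ _ _) (mh2 n) a0 a1).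
apply: (whp_imp _ _ _ P _ _ (maxn 1 N0) W) => n; rewrite geq_max => /andP[n0 nN0] w [HA HB].
apply/negP; rewrite -leNgt.
have ms := section_measurable _ _ _ _ _ (h1 n) w (mh1 n n0).
have ne := quantile_set_nonempty _ _ _ P' _ a ms a0.
have lb := quantile_set_lbound _ _ _ P' _ a (fun w' => colmaxabs_ge0 _ _ _ : 0 <= h1 n (w, w')) a1.
have := quantile_level R (Aboot n w) (Btrue n w) (G n) (1 - a) t (e / 3) t0 HA HB (hG n nN0) ne lb.
by rewrite mulrC divfK.
Qed.
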